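(* There is a randomized algorithm that, given any undirected graph $G=(V,E,\omega)$ with $n$ vertices and positive integer edge weights, and any parameters $2\le\kappa\le(\log n)/4$, $1/2>\rho\ge 1/\kappa$ and $0<\epsilon<1/2$, constructs a $(\beta,\epsilon)$-hopset $H$ for $G$ with $O(n^{1+1/\kappa}\cdot\log n)$ edges in expectation, in expected time $O\big((|E|+n\log n)\cdot (n^\rho/\rho)\cdot\log n\big)$, where $\beta=O\left(\frac{\log\kappa+1/\rho}{\epsilon}\right)^{\log\kappa+1/\rho}$.
   Context: For a weighted undirected graph $G=(V,E,\omega)$, $d_G$ denotes the shortest-path distance. For a set $H$ of weighted edges on $V$ (weights $\omega_H$), $G\cup H$ denotes the graph with edge set $E\cup H$, where edges of $H$ get weight $\omega_H$ and edges of $E\setminus H$ keep weight $\omega$. For a positive integer $\beta$, $d^{(\beta)}_{G'}(u,v)$ is the minimum length of a $u$–$v$ path in $G'$ with at most $\beta$ edges ($\infty$ if none). $H$ is a $(\beta,\epsilon)$-hopset for $G$ if for every $u,v\in V$: $d_G(u,v)\le d^{(\beta)}_{G\cup H}(u,v)\le(1+\epsilon)d_G(u,v)$. *)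

(* Defs.v *)
From HB Require Import structures.
From mathcomp Require Import all_boot all_order all_algebra.
From mathcomp Require Import all_classical all_reals all_analysis.

Set Implicit Arguments.
Unset Strict Implicit.
Unset Printing Implicit Defensive.

Import Order.TTheory GRing.Theory Num.Theory.
Import numFieldNormedType.Exports.

Local Open Scope classical_set_scope.
Local Open Scope ring_scope.

(** * Weighted graphs, hop-bounded distances, hopsets *)

(* The value of [wt] on a pair which is not an edge is irrelevant. *)
Record wgraph (R : realType) (n : nat) := WGraph {
  adj : rel 'I_n;
  wt : 'I_n -> 'I_n -> R;
  adj_sym : forall u v, adj u v = adj v u;
  adj_irr : forall u, adj u u = false;
  wt_sym : forall u v, wt u v = wt v u }.

Section Graphs.
Variables (R : realType) (n : nat).
Implicit Types (G H : wgraph R n) (u v : 'I_n) (q : seq 'I_n).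

Definition nedges G : nat :=
  #|[set e : 'I_n * 'I_n | adj G e.1 e.2 && (e.1 < e.2)%N]|%SET.

Definition pos_int_weights G : Prop :=
  forall u v, adj G u v -> exists2 k : nat, (0 < k)%N & wt G u v = k%:R.

Definition union_adj G H : rel 'I_n := fun u v => adj G u v || adj H u v.
Definition union_wt G H u v : R := if adj H u v then wt H u v else wt G u v.

Lemma union_adj_sym G H u v : union_adj G H u v = union_adj G H v u.
Proof. by rewrite /union_adj (adj_sym G) (adj_sym H). Qed.

Lemma union_adj_irr G H u : union_adj G H u u = false.
Proof. by rewrite /union_adj !adj_irr. Qed.

Lemma union_wt_sym G H u v : union_wt G H u v = union_wt G H v u.
Proof. by rewrite /union_wt (adj_sym H) (wt_sym H) (wt_sym G). Qed.

Definition gunion G H : wgraph R n :=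
  WGraph (@union_adj_sym G H) (@union_adj_irr G H) (@union_wt_sym G H).

(* A path is given by its start [u] and the sequence [q] of its other
   vertices, so that it has [size q] edges. *)
Definition is_path G u v q : Prop :=
  [/\ path (adj G) u q, last u q = v & uniq (u :: q)].

Fixpoint plength G u q : R :=
  if q is x :: q' then wt G u x + plength G x q' else 0.

(* There are finitely many paths, so the infima are minima (or +oo). *)
Definition dist G u v : \bar R :=
  ereal_inf [set (plength G u q)%:E | q in [set q | is_path G u v q]].

Definition hop_dist (b : nat) G u v : \bar R :=
  ereal_inf [set (plength G u q)%:E
            | q in [set q | is_path G u v q /\ (size q <= b)%N]].

Definition is_hopset G H (b : nat) (eps : R) : Prop :=
  forall u v,
    (dist G u v <= hop_dist b (gunion G H) u v)%E /\
    (hop_dist b (gunion G H) u v <= (1 + eps)%:E * dist G u v)%E.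

End Graphs.

(** * Randomized real RAM *)

(* A program is a fixed structured command acting on finitely many arrays of
   w-bit words and finitely many arrays of real numbers.  Array names are
   literals of the program; indices are computed words.  Results of word
   operations are reduced modulo 2 ^ w (subtraction is truncated at 0).  Real
   numbers can be added, subtracted, multiplied, divided and compared; words
   can be cast to reals, but there is no rounding of reals to words. *)

Inductive wop := WAdd | WSub | WMul | WDiv | WMod.
Inductive rop := RAdd | RSub | RMul | RDiv.

Inductive wexp :=
  | WConst of nat
  | WLoad of nat & wexp
  | WBin of wop & wexp & wexp.

Inductive rexp :=
  | RCast of wexp
  | RLoad of nat & wexp
  | RBin of rop & rexp & rexp.

Inductive bexp :=
  | BWLt of wexp & wexp
  | BWEq of wexp & wexp
  | BRLt of rexp & rexp
  | BNot of bexp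
  | BAnd of bexp & bexp.

Inductive cmd :=
  | CSkip
  | CWStore of nat & wexp & wexp
  | CRStore of nat & wexp & rexp
  | CFlip of nat & wexp
  | CSeq of cmd & cmd
  | CIf of bexp & cmd & cmd
  | CWhile of bexp & cmd.

Section Machine.
Variable R : realType.

Record state := State { words : nat -> nat -> nat; reals : nat -> nat -> R }.

Definition upd (T : Type) (m : nat -> nat -> T) (k i : nat) (x : T) :=
  fun k' i' => if (k' == k) && (i' == i) then x else m k' i'.

Variable w : nat.

Definition eval_wop (o : wop) : nat -> nat -> nat :=
  match o with
  | WAdd => addn | WSub => subn | WMul => muln | WDiv => divn | WMod => modn
  end.

Definition eval_rop (o : rop) (x y : R) : R :=
  match o with
  | RAdd => x + y | RSub => x - y | RMul => x * y | RDiv => x / y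
  end.

Fixpoint eval_w (s : state) (e : wexp) : nat :=
  match e with
  | WConst k => (k %% 2 ^ w)%N
  | WLoad k a => words s k (eval_w s a)
  | WBin o e1 e2 => (eval_wop o (eval_w s e1) (eval_w s e2) %% 2 ^ w)%N
  end.

Fixpoint eval_r (s : state) (e : rexp) : R :=
  match e with
  | RCast a => (eval_w s a)%:R
  | RLoad k a => reals s k (eval_w s a)
  | RBin o e1 e2 => eval_rop o (eval_r s e1) (eval_r s e2)
  end.

Fixpoint eval_b (s : state) (e : bexp) : bool :=
  match e with
  | BWLt e1 e2 => (eval_w s e1 < eval_w s e2)%N
  | BWEq e1 e2 => eval_w s e1 == eval_w s e2
  | BRLt e1 e2 => eval_r s e1 < eval_r s e2
  | BNot b => ~~ eval_b s b
  | BAnd b1 b2 => eval_b s b1 && eval_b s b2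
  end.

(* One step executes the head [c] of the stack of commands [c :: k].  A fresh
   bit is drawn at every step; only [CFlip] looks at it. *)
Definition step (bit : bool) (c : cmd) (k : seq cmd) (s : state) :
    seq cmd * state :=
  match c with
  | CSkip => (k, s)
  | CWStore j a e =>
      (k, State (upd (words s) j (eval_w s a) (eval_w s e)) (reals s))
  | CRStore j a e =>
      (k, State (words s) (upd (reals s) j (eval_w s a) (eval_r s e)))
  | CFlip j a =>
      (k, State (upd (words s) j (eval_w s a) (bit %% 2 ^ w)%N)
                (reals s))
  | CSeq c1 c2 => (c1 :: c2 :: k, s)
  | CIf b c1 c2 => ((if eval_b s b then c1 else c2) :: k, s)
  | CWhile b c1 => (if eval_b s b then c1 :: c :: k else k, s)
  end.

(* [run bs k s = Some s'] iff the execution started in [s], fed with the bits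
   [bs], halts in state [s'] after exactly [size bs] steps. *)
Fixpoint run (bs : seq bool) (k : seq cmd) (s : state) : option state :=
  match k, bs with
  | [::], [::] => Some s
  | [::], _ :: _ => None
  | _ :: _, [::] => None
  | c :: k', b :: bs' => let ks := step b c k' s in run bs' ks.1 ks.2
  end.

(* The outcomes are the bit strings driving a complete execution of [p], and
   [bs] has probability 2 ^ - size bs.  An expression of [p] has size bounded
   in terms of [p] only, so counting steps measures time up to a constant
   factor.  [expect] is an expectation if [p] halts almost surely, that is, if
   [expect p s (fun=> 1) = 1]. *)
Definition halting_runs (p : cmd) (s : state) : set (seq bool) :=
  [set bs | exists s', run bs [:: p] s = Some s'].

Definition expect (p : cmd) (s : state) (X : seq bool -> R) : \bar R :=
  (\esum_(bs in halting_runs p s) (X bs / 2 ^+ size bs)%:E)%E.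

(** * Input and output of graphs *)

Variable n : nat.

(* Each edge is listed once, in one of its two orientations. *)
Definition edge_listing (G : wgraph R n) (l : seq ('I_n * 'I_n)) : Prop :=
  [/\ uniq l,
      forall u v, (u, v) \in l -> (v, u) \notin l &
      forall u v, adj G u v = ((u, v) \in l) || ((v, u) \in l)].

(* Input: word array 0 starts with the numbers of vertices and of edges, word
   arrays 1 and 2 hold the endpoints of the edges, real array 1 their weights,
   real array 0 the parameters; all other cells are 0. *)
Definition init_state (G : wgraph R n) (l : seq ('I_n * 'I_n))
    (kappa rho eps : R) : state :=
  State
    (fun k i => match k with
       | 0 => nth 0%N [:: n; size l] i
       | 1 => nth 0%N [seq val e.1 | e <- l] i
       | 2 => nth 0%N [seq val e.2 | e <- l] i
       | _ => 0%N
       end)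
    (fun k i => match k with
       | 0 => nth 0 [:: kappa; rho; eps] i
       | 1 => nth 0 [seq wt G e.1 e.2 | e <- l] i
       | _ => 0
       end).

(* The output overwrites the input, in the same format. *)
Definition outputs (s : state) (H : wgraph R n) : Prop :=
  exists2 l, edge_listing H l &
    [seq (words s 1 i, words s 2 i, reals s 1 i) | i <- iota 0 (words s 0 1)]
    = [seq (val e.1, val e.2, wt H e.1 e.2) | e <- l].

End Machine.

Definition log2 (R : realType) (x : R) : R := ln x / ln 2.

(* Main.v *)
(** Sample the vertices into a decreasing hierarchy A_0 = V, A_1, ..., A_k, A_{k+1} = empty
    by giving every vertex a uniform L-bit key (L = log n rounded up) and taking for A_i the
    vertices with key below a threshold t_i.  The densities t_i / t_{i+1} = 2^e_i start at
    about n^(1/kappa), have exponents which double at each level, and stop growing at about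
    n^rho; hence k <= log kappa + 1/rho.  The hopset joins every v to its nearest vertex of
    A_{i+1} (its pivot), and every v in A_i to the vertices s of A_i \ A_{i+1} in its bunch,
    that is, to those which are closer to v than A_{i+1}.

    Hop bound: cut a shortest path into J ~ k / eps pieces.  By induction on i, two vertices
    at distance d are joined by few hops up to a relative error 8 i / J, unless both have a
    pivot in A_{i+1} at distance O(d).  For the induction step, the pieces between the first
    and the last one for which this fails are bypassed through the pivots of the ends, which
    are joined by an edge unless both of them have pivots in A_{i+2} at distance O(d).

    Size: sort the vertices by their distance to v.  Only those before the first member of
    A_{i+1} can lie in the bunch, so its expected size is at most a truncated geometric sum
    bounded by t_i / t_{i+1}, or, for i = k, by the expected size of A_k.

    Time: the bunches of a level are found by Dijkstra searches run simultaneously from all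
    vertices of A_i \ A_{i+1} on pairs (source, vertex), where the search from s is pruned at
    the vertices to which s is not closer than their pivot.  The priority queue is a
    tournament tree over the 2^(2L) pairs, so that each operation costs O(log n). *)

Require Import Defs.
From mathcomp Require Import all_boot all_order all_algebra.
From mathcomp Require Import all_classical all_reals all_analysis.
From mathcomp Require Import zify ring lra.

Import Order.TTheory GRing.Theory Num.Theory.
Import numFieldNormedType.Exports.
Local Open Scope ring_scope.

Set Implicit Arguments.
Unset Strict Implicit.
Unset Printing Implicit Defensive.

(** The expectations are sums over complete executions, and the machine draws a fresh bit at every
    step. They become finite averages because every bit that is looked at is drawn in a prefix whose
    length [T] depends on the input only. What follows is determined by this prefix, so the
    executions extending it have total weight 2^-T, whatever their length.

    Why exponents double: a vertex is in A_i with probability 2^-(e_0 + ... + e_{i-1}), and its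
    bunch then has expected size at most 2^e_i. If e_{i+1} <= 2 e_i, the product never exceeds
    2^e_0, about n^(1/kappa); doubling is the fastest growth with this property. The cap at about
    n^rho limits the work of a level, and 2 rho < 1 leaves O(n) edges for the last level, where all
    pairs may be joined.

    The densities are powers of two because the machine can neither extract roots nor round reals:
    exponents are found by counting, and the thresholds divide exactly. The true depth depends on n,
    whereas beta must not; the analysis therefore pads the hierarchy with empty levels. *)

Section Semantics.

(** * Step-bounded total correctness of commands *)

Variables (R : realType) (w : nat).
Implicit Types (c : cmd) (s : state R).
Local Open Scope nat_scope.

(* Total correctness with a step bound: [c] halts after the same number [t <= T]
   of steps whatever the bits drawn. *)
Definition tr c s (T : nat) (Q : state R -> Prop) : Prop :=
  exists t s', [/\ t <= T, Q s' &
    forall bs bs' k, size bs = t ->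
      run w (bs ++ bs') (c :: k) s = run w bs' k s'].

Lemma tr_conseq c s T T' (Q Q' : state R -> Prop) :
  tr c s T Q -> T <= T' -> (forall s', Q s' -> Q' s') -> tr c s T' Q'.
Proof.
move=> [t [s' [tT Qs H]]] TT QQ; exists t, s'; split=> //; last exact: QQ.
exact: leq_trans TT.
Qed.

Lemma tr_le c s T T' (Q : state R -> Prop) : tr c s T Q -> T <= T' -> tr c s T' Q.
Proof. by move=> h l; apply: tr_conseq h l _. Qed.

Lemma tr_step c s s' (Q : state R -> Prop) :
  (forall b k, step w b c k s = (k, s')) -> Q s' -> tr c s 1 Q.
Proof.
move=> st q; exists 1, s'; split=> // [[|b [|? ?]]] // bs' k _ /=.
by rewrite st.
Qed.

Lemma tr_skip s (Q : state R -> Prop) : Q s -> tr CSkip s 1 Q.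
Proof. exact: tr_step. Qed.

Lemma tr_wstore j a e s (Q : state R -> Prop) :
  Q (State (upd (words s) j (eval_w w s a) (eval_w w s e)) (reals s)) ->
  tr (CWStore j a e) s 1 Q.
Proof. exact: tr_step. Qed.

Lemma tr_rstore j a e s (Q : state R -> Prop) :
  Q (State (words s) (upd (reals s) j (eval_w w s a) (eval_r w s e))) ->
  tr (CRStore j a e) s 1 Q.
Proof. exact: tr_step. Qed.

Lemma tr_seq c1 c2 s T1 T2 (Q : state R -> Prop) :
  tr c1 s T1 (fun s1 => tr c2 s1 T2 Q) -> tr (CSeq c1 c2) s (T1 + T2).+1 Q.
Proof.
move=> [t1 [s1 [l1 [t2 [s2 [l2 q H2]]] H1]]]; exists (t1 + t2).+1, s2.
split=> //; first by rewrite ltnS leq_add.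
case=> [|b bs] //= bs' k [sz].
rewrite -{1}(cat_take_drop t1 bs) -catA H1 ?size_takel ?sz ?leq_addr //.
by rewrite H2 // size_drop sz addKn.
Qed.

Lemma tr_if b c1 c2 s T1 T2 (Q : state R -> Prop) :
  (eval_b w s b -> tr c1 s T1 Q) -> (~~ eval_b w s b -> tr c2 s T2 Q) ->
  tr (CIf b c1 c2) s (maxn T1 T2).+1 Q.
Proof.
move=> H1 H2.
suff: tr (if eval_b w s b then c1 else c2) s (maxn T1 T2) Q.
  move=> [t [s' [l q H]]]; exists t.+1, s'; split=> // [[|b' bs]] //= bs' k [sz].
  exact: H.
case: ifP => [h|/negbT h].
  by apply: tr_conseq (H1 h) _ _ => //; rewrite leq_maxl.
by apply: tr_conseq (H2 h) _ _ => //; rewrite leq_maxr.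
Qed.

(* [I f s]: the loop invariant, with [f] an upper bound on the time left. *)
Lemma tr_while (I : nat -> state R -> Prop) b c f s :
  (forall f s, I f s -> eval_b w s b ->
     exists T, tr c s T (fun s' => exists f', I f' s' /\ T + f' < f)) ->
  I f s ->
  tr (CWhile b c) s f.+1 (fun s' => exists f', I f' s' /\ ~~ eval_b w s' b).
Proof.
move=> H; elim/ltn_ind: f s => f IH s Is.
case hb: (eval_b w s b); last first.
  exists 1, s; split=> //; first by exists f; rewrite hb.
  by case=> [|b' [|? ?]] //= bs' k _; rewrite hb.
have [T [t [s1 [l [f' [If' lf] H1]]]]] := H f s Is hb.
have ff : f' < f by apply: leq_ltn_trans lf; exact: leq_addl.
have [t2 [s2 [l2 q H2]]] := IH f' ff s1 If'.
exists (t + t2).+1, s2; split=> //.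
  rewrite ltnS; apply: leq_trans lf; rewrite -addnS; exact: leq_add.
case=> [|b' bs] //= bs' k [sz]; rewrite hb /=.
rewrite -{1}(cat_take_drop t bs) -catA H1 ?size_takel ?sz ?leq_addr //.
by rewrite H2 // size_drop sz addKn.
Qed.

End Semantics.

(** * Tournament trees *)

Section Tournament.
Variable (R : realType).
Local Open Scope nat_scope.
Implicit Types (t : nat -> nat) (K : nat -> R) (M : nat).

(* Keys are stored shifted by one; [0] means that there is none. *)
Definition better K (a b : nat) : nat :=
  if (a == 0) || ((b != 0) && (K b.-1 < K a.-1)%R) then b else a.

Definition tournament M t K : Prop :=
  (forall j, 0 < j < M -> t j = better K (t (2 * j)) (t (2 * j + 1))) /\
  (forall c, c < M -> t (M + c) = 0 \/ t (M + c) = c.+1).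

Lemma better_in K a b : better K a b = a \/ better K a b = b.
Proof. by rewrite /better; case: ifP; auto. Qed.

Lemma better_le K a b : 
  (a <> 0 -> better K a b <> 0 /\ (K (better K a b).-1 <= K a.-1)%R) /\
  (b <> 0 -> better K a b <> 0 /\ (K (better K a b).-1 <= K b.-1)%R).
Proof.
rewrite /better; case: eqP => [->|a0] /=; first by split.
case: (b =P 0) => [->|b0] /=; first by split.
by case: ltP => h; split=> // _; split=> //; apply: ltW.
Qed.

(** A winner climbs only from its own leaf, so the leaf of the candidate at [j] lies [d] levels
    below [j]. Hence a change at one leaf concerns only the ancestors of that leaf. *)
Lemma tournament_leaf M t K : tournament M t K ->
  forall j, 0 < j < 2 * M -> t j <> 0 ->
  exists d, [/\ (M + (t j).-1) %/ 2 ^ d = j, (t j).-1 < M &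
               t (M + (t j).-1) = t j].
Proof.
move=> [Hn Hl] j; have [m] := ubnP (2 * M - j); elim: m j => // m IH j lm jM tj.
case: (ltnP j M) => jlt; last first.
  have jE : j = M + (j - M) by lia.
  have [|h|h] := Hl (j - M); first lia.
    by rewrite -jE in h.
  by exists 0; rewrite -jE in h; rewrite h expn0 divn1 /=; split; rewrite -?jE ?h; lia.
have jH : 0 < j < M by lia.
have E := Hn j jH.
have [e|e] := better_in K (t (2 * j)) (t (2 * j + 1)); rewrite e in E.
- have [|||d [h1 h2 h3]] := IH (2 * j); [lia|lia|by rewrite -E|].
  exists d.+1; rewrite E h3 expnSr divnMA h1; split=> //.
  by rewrite mulKn.
- have [|||d [h1 h2 h3]] := IH (2 * j + 1); [lia|lia|by rewrite -E|].
  exists d.+1; rewrite E h3 expnSr divnMA h1; split=> //.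
  by rewrite mulnC divnMDl // addn0.
Qed.

Lemma tournament_root M t K : tournament M t K ->
  forall j, 0 < j < 2 * M -> t j <> 0 ->
  t 1 <> 0 /\ (K (t 1).-1 <= K (t j).-1)%R.
Proof.
move=> [Hn Hl] j; elim/ltn_ind: j => j IH jM tj.
case: (eqVneq j 1) tj => [->|j1] tj; first by [].
have [h0 h1] := better_le K (t (2 * (j %/ 2))) (t (2 * (j %/ 2) + 1)).
have h : 0 < j %/ 2 < M by lia.
have E := Hn _ h.
have [n0 n1] : t (j %/ 2) <> 0 /\ (K (t (j %/ 2)%N).-1 <= K (t j).-1)%R.
  have /orP [/eqP jE|/eqP jE] :
      (j == 2 * (j %/ 2)) || (j == 2 * (j %/ 2) + 1) by lia.
    by rewrite -E -jE in h0; apply: h0.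
  by rewrite -E -jE in h1; apply: h1.
have [|||a1 a2] := IH (j %/ 2); [lia|lia|by []|].
by split=> //; apply: le_trans n1.
Qed.

End Tournament.

(** * Walks and distances *)

Section Walks.
Variables (R : realType) (n : nat) (G : wgraph R n).
Implicit Types (u v x : 'I_n) (q : seq 'I_n) (l : R).

(** Unlike the paths of [is_path], walks may repeat vertices and so can be concatenated freely;
    [shorten_walk] gets back to simple paths where [dist] and [hop_dist] require them. *)
Definition walk u v l : Prop :=
  exists q, [/\ path (adj G) u q, last u q = v & plength G u q = l].

Definition hop_walk (b : nat) u v l : Prop :=
  exists q, [/\ path (adj G) u q, last u q = v, (size q <= b)%N &
                plength G u q <= l].

Lemma plength_cat u q1 q2 :
  plength G u (q1 ++ q2) = plength G u q1 + plength G (last u q1) q2.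
Proof. by elim: q1 u => [|x q1 IH] u /=; rewrite ?add0r // IH addrA. Qed.

Lemma walk0 u : walk u u 0.
Proof. by exists [::]. Qed.

Lemma walk_edge u v : adj G u v -> walk u v (wt G u v).
Proof. by move=> h; exists [:: v]; split=> //=; rewrite ?h // addr0. Qed.

Lemma walk_cat u v x l l' : walk u v l -> walk v x l' -> walk u x (l + l').
Proof.
move=> [q [h1 h2 <-]] [q' [h1' h2' <-]]; exists (q ++ q').
by rewrite cat_path last_cat plength_cat h2 h1 h1'.
Qed.

Lemma rev_walk u q : path (adj G) u q -> exists q',
  [/\ path (adj G) (last u q) q', last (last u q) q' = u, size q' = size q &
      plength G (last u q) q' = plength G u q].
Proof.
elim: q u => [|x q IH] u /=; first by move=> _; exists [::].
case/andP=> ux /IH [q' [h1 h2 h3 h4]]; exists (rcons q' u).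
rewrite rcons_path last_rcons size_rcons h1 h2 h3 adj_sym ux; split=> //.
by rewrite -cats1 plength_cat /= h2 h4 addr0 addrC wt_sym.
Qed.

Lemma walk_sym u v l : walk u v l -> walk v u l.
Proof. by move=> [q [h1 <- <-]]; have [q' [? ? ? ?]] := rev_walk h1; exists q'. Qed.

Lemma walk_ind_last s (P : 'I_n -> R -> Prop) : P s 0 ->
  (forall y z l, walk s y l -> P y l -> adj G y z -> P z (l + wt G y z)) ->
  forall v l, walk s v l -> P v l.
Proof.
move=> P0 PS v l [q [h1 <- <-]] {v l}; elim/last_ind: q h1 => [|q z IH] //.
rewrite rcons_path last_rcons => /andP[h1 h2].
rewrite -cats1 plength_cat /= addr0; apply: PS => //; last exact: IH.
by exists q.
Qed.

Lemma hop_walk_cat b b' u v x l l' :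
  hop_walk b u v l -> hop_walk b' v x l' -> hop_walk (b + b') u x (l + l').
Proof.
move=> [q [h1 h2 h3 h4]] [q' [h1' h2' h3' h4']]; exists (q ++ q').
rewrite cat_path last_cat plength_cat h2 h1 h1' size_cat; split=> //.
  exact: leq_add.
exact: lerD.
Qed.

Lemma hop_walk_sym b u v l : hop_walk b u v l -> hop_walk b v u l.
Proof.
move=> [q [h1 <- h2 h3]]; have [q' [? ? ? h]] := rev_walk h1.
by exists q'; split=> //; [lia | rewrite h].
Qed.

Lemma hop_walk_le b b' u v l l' :
  hop_walk b u v l -> (b <= b')%N -> l <= l' -> hop_walk b' u v l'.
Proof.
move=> [q [h1 h2 h3 h4]] h5 h6; exists q; split=> //; first lia.
exact: le_trans h6.
Qed.

Lemma hop_walk0 b u v l : u = v -> 0 <= l -> hop_walk b u v l.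
Proof. by move=> -> h; exists [::]. Qed.

Hypothesis wt_ge0 : forall u v, adj G u v -> 0 <= wt G u v.

Lemma plength_ge0 u q : path (adj G) u q -> 0 <= plength G u q.
Proof.
elim: q u => //= x q IH u /andP[ux /IH h]; apply: addr_ge0 => //; exact: wt_ge0.
Qed.

Lemma walk_ge0 u v l : walk u v l -> 0 <= l.
Proof. by move=> [q [h1 h2 <-]]; apply: plength_ge0. Qed.

Lemma shorten_walk u q : path (adj G) u q -> exists q',
  [/\ is_path G u (last u q) q', (size q' <= size q)%N &
      plength G u q' <= plength G u q].
Proof.
elim: q u => [|x q IH] u /=; first by move=> _; exists [::].
case/andP=> ux px; have [q' [[h1 h2 h3] h4 h5]] := IH _ px.
have w0 := wt_ge0 ux.
have [ui|ui] := boolP (u \in x :: q'); last first.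
  exists (x :: q'); split=> //=; last by rewrite lerD2l.
  by split=> //=; rewrite ?ux //= ?h1 //; move: h3 => /= ->; rewrite ui.
move: ui; rewrite inE; case/orP => [/eqP ex|].
  exists q'; split=> //=; [by rewrite ex|exact: (leq_trans h4)|rewrite ex in w0 *].
  by move: h5 w0; lra.
move=> ui; case/splitPr: ui h1 h2 h3 h4 h5 => q1 q2 h1 h2 h3 h4 h5.
move: h1; rewrite cat_path /= => /and3P[h1 h1' h1''].
exists q2; split.
- split=> //; first by rewrite -h2 last_cat.
  by move: h3; rewrite -cat_cons cat_uniq => /and3P[_ _].
- by move: h4; rewrite size_cat /=; lia.
- move: h5; rewrite plength_cat /=.
  have := plength_ge0 h1; have := wt_ge0 h1'; lra.
Qed.

Lemma dist_le u v l : walk u v l -> (dist G u v <= l%:E)%E.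
Proof.
move=> [q [h1 h2 <-]]; have [q' [h3 _ h4]] := shorten_walk h1.
apply: (@le_trans _ _ (plength G u q')%:E); last by rewrite lee_fin.
by apply: ereal_inf_lbound; exists q' => //=; rewrite -h2.
Qed.

Lemma hop_dist_le b u v l : hop_walk b u v l -> (hop_dist b G u v <= l%:E)%E.
Proof.
move=> [q [h1 h2 h0 h]]; have [q' [h3 h5 h4]] := shorten_walk h1.
apply: (@le_trans _ _ (plength G u q')%:E); last first.
  by rewrite lee_fin; apply: le_trans h.
apply: ereal_inf_lbound; exists q' => //=; rewrite -h2; split=> //.
exact: leq_trans h0.
Qed.

Lemma dist_no_walk u v : (forall l, ~ walk u v l) -> dist G u v = +oo%E.
Proof.
move=> h; rewrite /dist (_ : [set _ | _ in _]%classic = set0) ?ereal_inf0 //.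
apply/seteqP; split=> // y [q [h1 h2 h3] _] /=.
by apply: (h (plength G u q)); exists q.
Qed.

End Walks.

Section Distances.
Variables (R : realType) (n : nat) (G : wgraph R n).
Hypothesis HG : pos_int_weights G.
Implicit Types (u v x : 'I_n) (q : seq 'I_n) (l : R).

(** For unconnected vertices this is the default value 0 of [fine], so it is informative only beside
    a walk. *)
Definition rdist u v : R := fine (dist G u v).

Lemma pos_int_wt_gt0 u v : adj G u v -> 0 < wt G u v.
Proof. by move=> /HG [k k0 ->]; rewrite ltr0n. Qed.

Lemma pos_int_wt_ge0 u v : adj G u v -> 0 <= wt G u v.
Proof. by move=> /pos_int_wt_gt0 /ltW. Qed.

Local Notation wt0 := pos_int_wt_ge0.

Lemma walk_nat u v l : walk G u v l -> exists k : nat, l = k%:R.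
Proof.
move=> [q [h1 _ <-]]; elim: q u h1 => [|x q IH] u /=; first by exists 0%N.
case/andP=> /HG [k _ ->] /IH [k' ->]; exists (k + k')%N; by rewrite natrD.
Qed.

(** Integer weights make every walk length a natural number, so the infimum defining [dist] is
    attained. *)
Lemma rdist_spec u v l : walk G u v l ->
  [/\ walk G u v (rdist u v), rdist u v <= l & dist G u v = (rdist u v)%:E].
Proof.
move=> h.
have ex : exists k : nat, `[< walk G u v k%:R >].
  by have [k e] := walk_nat h; exists k; apply/asboolP; rewrite -e.
case: (ex_minnP ex) => k /asboolP hk mk.
have dE : dist G u v = k%:R%:E.
  apply/eqP; rewrite eq_le (dist_le wt0 hk) /=.
  apply: le_ereal_inf_tmp => y /= [q [h1 h2 _] <-].
  have hq : walk G u v (plength G u q) by exists q.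
  have [k' e] := walk_nat hq; rewrite e lee_fin ler_nat.
  by apply: mk; apply/asboolP; rewrite -e.
have rE : rdist u v = k%:R by rewrite /rdist dE.
have [k' e] := walk_nat h; rewrite rE dE; split=> //.
by rewrite e ler_nat; apply: mk; apply/asboolP; rewrite -e.
Qed.

Lemma walk_eq0 u v : walk G u v 0 -> u = v.
Proof.
move=> [[|x q] [/= h1 h2 h3]] //; case/andP: h1 => h1 h4.
exfalso; have := pos_int_wt_gt0 h1; have := plength_ge0 wt0 h4; lra.
Qed.

(** Cuts a walk before the edge that crosses length [l]. The crossing edge is kept apart because it
    may be arbitrarily long; it becomes a hop of its own. *)
Lemma plength_prefix u q l : 0 <= l -> path (adj G) u q ->
  plength G u q <= l \/ exists q1 y q2, [/\ q = q1 ++ y :: q2,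
    plength G u q1 <= l & l < plength G u q1 + wt G (last u q1) y].
Proof.
elim: q u l => [|x q IH] u l l0 /=; first by left.
case/andP=> ux px; case: (ltP l (wt G u x)) => hw.
  by right; exists [::], x, q; rewrite /= add0r.
have [|h|[q1 [y [q2 [-> h1 h2]]]]] := IH x (l - wt G u x) _ px; first by lra.
  by left; lra.
by right; exists (x :: q1), y, q2; split=> //=; lra.
Qed.

End Distances.

(** * The hopset argument *)

Section Hopset.
Variables (R : realType) (n : nat) (G H : wgraph R n).
Hypothesis HG : pos_int_weights G.
Variables (A : nat -> pred 'I_n) (k : nat).
Local Notation d := (rdist G).
Local Notation U := (gunion G H).
Local Notation walkG := (walk G).
Local Notation hw := (hop_walk U).
Implicit Types (u v x y z p : 'I_n) (l : R).

Hypothesis wtH : forall u v, adj H u v -> wt H u v = d u v /\ walkG u v (d u v).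
Hypothesis A_0 : forall v, A 0 v.
Hypothesis A_last : forall v, ~~ A k.+1 v.
Hypothesis pivot : forall i p v l, (i <= k)%N -> A i.+1 p -> walkG p v l ->
  exists p', [/\ A i.+1 p', walkG p' v (d p' v), d p' v <= l & 
                 p' = v \/ adj H p' v].
(** The third case gives a vertex of [A i.+1] near [v] only; one near [s] is obtained from the
    reversed walk. *)
Hypothesis bunch : forall i s v l, (i <= k)%N -> A i s -> A i v ->
  walkG s v l -> [\/ s = v, adj H s v |
    exists p l', [/\ A i.+1 p, walkG p v l' & l' <= l]].

Let wt0 := pos_int_wt_ge0 HG.

Lemma union_wt_ge u v : adj U u v -> walkG u v (wt U u v).
Proof.
rewrite /= /union_adj /union_wt; case: ifP => [/wtH [-> //]|_].
by rewrite orbF; apply: walk_edge.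
Qed.

Lemma union_wt_ge0 u v : adj U u v -> 0 <= wt U u v.
Proof. by move=> /union_wt_ge; apply: walk_ge0. Qed.

Lemma union_walk u q : path (adj U) u q -> walkG u (last u q) (plength U u q).
Proof.
elim: q u => [|x q IH] u; first by move=> _; apply: walk0.
case/andP=> /union_wt_ge h /IH h'; exact: walk_cat h h'.
Qed.

Lemma hw_edgeG u v : adj G u v -> hw 1 u v (wt G u v).
Proof.
move=> uv; exists [:: v]; split=> //=; first by rewrite /union_adj uv.
rewrite addr0 /union_wt; case: ifP => // /wtH [-> _].
by have [] := rdist_spec HG (walk_edge uv).
Qed.

Lemma hw_edgeH u v : adj H u v -> hw 1 u v (d u v).
Proof.
move=> uv; exists [:: v]; split=> //=; first by rewrite /union_adj uv orbT.
by rewrite addr0 /union_wt uv; have [->] := wtH uv.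
Qed.

Definition shortest u v l : Prop :=
  walkG u v l /\ forall l', walkG u v l' -> l <= l'.

Definition near i r u : Prop :=
  exists z l', [/\ A i z, walkG z u l' & l' <= r].

(** Greedy cutting: a maximal prefix of length at most [r] together with the next edge exceeds [r],
    so [N] pieces suffice, and a piece with its edge costs [b.+1] hops. The single edges are within
    stretch [c] because [1 <= c]. In the second alternative [x] is the start of the first piece that
    fails and [y] the end of the last one; the part between them is left to the caller. *)
Lemma segments i b (c r : R) : 1 <= c -> 0 < r ->
  (forall u v l, shortest u v l -> l <= r ->
     hw b u v (c * l) \/ near i (2 * r) u /\ near i (2 * r) v) ->
  forall N u v l, shortest u v l -> l <= N%:R * r ->
   hw (N * b.+1) u v (c * l) \/
   exists x y b1 b2 l1 l2 l3,
    [/\ hw b1 u x (c * l1) /\ hw b2 y v (c * l3),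
        walkG u x l1 /\ walkG x y l2 /\ walkG y v l3,
        (b1 + b2 <= N * b.+1)%N, l1 + l2 + l3 = l &
        near i (2 * r) x /\ near i (2 * r) y].
Proof.
move=> c1 r0 Hs; elim=> [|N IH] u v l [[q [pq lq ql]] sh] lN.
  left; have h0 : l = 0.
    by apply/eqP; rewrite eq_le -{2}ql (plength_ge0 wt0) // andbT; lra.
  have uv : u = v by apply: (walk_eq0 HG); rewrite -h0; exists q.
  by rewrite h0 mulr0; apply: hop_walk0.
have [h|[q1 [y [q2 [qE h1 h2]]]]] := plength_prefix (ltW r0) pq.
  have suv : shortest u v l by split=> //; exists q.
  have lr : l <= r by rewrite -ql.
  have [h'|[n1 n2]] := Hs u v l suv lr.
  - by left; apply: hop_walk_le h' _ _ => //; rewrite mulSn; lia.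
  - right; exists u, v, 0%N, 0%N, 0, l, 0; rewrite mulr0; split=> //; last by lra.
      by split; apply: hop_walk0.
    by split; [exact: walk0|split; [exists q|exact: walk0]].
move: pq lq ql; rewrite qE cat_path last_cat plength_cat /= => /and3P[p1 e1 p2].
set x := last u q1 in e1 h2 *; move=> lq ql.
set a := plength G u q1 in h1 h2 ql; set e := wt G x y in h2 ql.
set g := plength G y q2 in ql.
have wux : walkG u x a by exists q1.
have wyv : walkG y v g by exists q2.
have we : walkG x y e by apply: walk_edge.
have s1 : shortest u x a.
  split=> // l' /walk_cat /(_ (walk_cat we wyv)) /sh; lra.
have s2 : shortest y v g.
  split=> // l' /(walk_cat (walk_cat wux we)) /sh; lra.
have e0 : 0 <= e by apply: wt0.
have ce : e <= c * e by rewrite ler_peMl.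
have gN : g <= N%:R * r.
  move: lN; rewrite -natr1 mulrDl mul1r; lra.
have hxy : hw 1 x y (c * e) by apply: hop_walk_le (hw_edgeG e1) _ ce.
have cE : c * l = c * a + c * e + c * g by rewrite -ql; ring.
have wuy := walk_cat wux we; have wxv := walk_cat we wyv.
have wuv : walkG u v l by rewrite -ql addrA; apply: walk_cat wyv; apply: walk_cat we.
(* Four cases: whether the first piece fails, and whether a later one does. If the first fails, the
   new [x] is [u]; otherwise it is inherited from the rest. *)
have [f1|[nu nx]] := Hs _ _ _ s1 h1; have [f2|F2] := IH _ _ _ s2 gN.
- left; rewrite cE; apply: hop_walk_le (hop_walk_cat (hop_walk_cat f1 hxy) f2) _ _ => //.
  by rewrite mulSn; clear; lia.
- right; case: F2 => x' [y' [b1 [b2 [l1 [l2 [l3 [[F1 F2] [F3 [F4 F5]] F6 F7 F8]]]]]]].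
  exists x', y', (b + 1 + b1)%N, b2, (a + e + l1), l2, l3; split=> //.
  + split=> //; rewrite !mulrDr; apply: hop_walk_cat F1.
    exact: hop_walk_cat hxy.
  + by split=> //; apply: walk_cat F3.
  + by move: F6; rewrite mulSn; clear; lia.
  + by rewrite -ql -F7; ring.
- right; exists u, x, 0%N, (1 + N * b.+1)%N, 0, a, (e + g); split=> //.
  + split; first by rewrite mulr0; apply: hop_walk0.
    by rewrite mulrDr; apply: hop_walk_cat f2.
  + by split=> //; apply: walk0.
  + by rewrite mulSn; clear; lia.
  + by rewrite -ql; ring.
- right; case: F2 => x' [y' [b1 [b2 [l1 [l2 [l3 [[F1 F2] [F3 [F4 F5]] F6 F7 [F8 F9]]]]]]]].
  exists u, y', 0%N, b2, 0, (a + e + l1 + l2), l3; split=> //.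
  + by split=> //; rewrite mulr0; apply: hop_walk0.
  + split; first exact: walk0.
    by split=> //; apply: walk_cat F4; apply: walk_cat F3.
  + by move: F6; rewrite mulSn; clear; lia.
  + by rewrite -ql -F7; ring.
Qed.

(** [J] pieces with their connecting edges, and three hops for the detour: to a pivot, across to the
    other pivot, and back. *)
Fixpoint hopbound (J i : nat) : nat :=
  if i is i'.+1 then (J * (hopbound J i').+1 + 3)%N else 1%N.

Lemma hop_or_near (J : nat) : (6 <= J)%N -> forall i, (i <= k)%N ->
  forall u v l, shortest u v l ->
  hw (hopbound J i) u v ((1 + (8 * i)%:R / J%:R) * l) \/
  near i.+1 (2 * l) u /\ near i.+1 (2 * l) v.
Proof.
move=> J6; have J0 : 0 < J%:R :> R by rewrite ltr0n; lia.
elim=> [|i IH] ik u v l [wuv sh].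
  rewrite muln0 mul0r addr0 mul1r.
  have l0 := walk_ge0 wt0 wuv.
  have [uv|nuv] := eqVneq u v.
    by left; apply: hop_walk0.
  have [du ld _] := rdist_spec HG wuv.
  have [euv|huv|[p [lp [Ap wp lpl]]]] := bunch ik (A_0 u) (A_0 v) wuv.
  - by rewrite euv eqxx in nuv.
  - by left; apply: hop_walk_le (hw_edgeH huv) _ _.
  have [euv|huv|[p' [lp' [Ap' wp' lpl']]]] := bunch ik (A_0 v) (A_0 u) (walk_sym wuv).
  - by rewrite euv eqxx in nuv.
  - left; apply: hop_walk_le (hop_walk_sym (hw_edgeH huv)) _ _ => //.
    by have [] := rdist_spec HG (walk_sym wuv).
  by right; split; [exists p', lp'|exists p, lp]; split=> //; lra.
have l0 := walk_ge0 wt0 wuv.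
have [lz|lz] := eqVneq l 0.
  left; apply: hop_walk0; last by rewrite lz mulr0.
  by apply: (walk_eq0 HG); rewrite -lz.
have lp : 0 < l by rewrite lt_neqAle eq_sym lz.
have ii : (i <= k)%N by lia.
set c : R := 1 + (8 * i)%:R / J%:R in IH *.
have c1 : 1 <= c by rewrite /c lerDl divr_ge0.
set r : R := l / J%:R.
have r0 : 0 < r by apply: divr_gt0.
have lr : l = J%:R * r by rewrite /r mulrC divfK // gt_eqF.
have Hs : forall u v l, shortest u v l -> l <= r ->
     hw (hopbound J i) u v (c * l) \/ near i.+1 (2 * r) u /\ near i.+1 (2 * r) v.
  move=> u' v' l' s' l'r; case: (IH ii _ _ _ s') => [|[[z [a [h1 h2 h3]]] [z' [a' [h1' h2' h3']]]]].
    by left.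
  by right; split; [exists z, a | exists z', a']; split=> //; lra.
have lJ : l <= J%:R * r by rewrite -lr.
have [h|] := segments c1 r0 Hs (conj wuv sh) lJ.
  left; apply: hop_walk_le h _ _ => /=; first lia.
  apply: ler_wpM2r => //; rewrite /c lerD2l ler_pM2r ?invr_gt0 //.
  by rewrite ler_nat; lia.
move=> [x [y [b1 [b2 [l1 [l2 [l3 [[H1 H2] [W1 [W2 W3]] bb ll [Nx Ny]]]]]]]]].
have [z [a [Az wz az]]] := Nx; have [z' [a' [Az' wz' az']]] := Ny.
have [p [Ap wp dp pH]] := pivot ii Az wz.
have [p' [Ap' wp' dp' pH']] := pivot ii Az' wz'.
have wpp : walkG p p' (d p x + l2 + d p' y).
  by apply: walk_cat (walk_sym wp'); apply: walk_cat W2.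
have hop1 z1 x1 : z1 = x1 \/ adj H z1 x1 -> walkG z1 x1 (d z1 x1) -> hw 1 z1 x1 (d z1 x1).
  move=> [e|hh] ww; last exact: hw_edgeH.
  by apply: hop_walk0 => //; apply: walk_ge0 ww.
have h1 := hop1 _ _ pH wp; have h2 := hop1 _ _ pH' wp'.
have l10 := walk_ge0 wt0 W1; have l20 := walk_ge0 wt0 W2; have l30 := walk_ge0 wt0 W3.
(* The vertices of the next level found below lie within [l2 + 4 * r] of a pivot, hence within
   [l + 6 * r] of the ends [u] and [v]; [6 <= J] turns this into [2 * l]. *)
have J6r : 6 * r <= l.
  by rewrite lr; apply: ler_wpM2r; [exact: ltW|rewrite (ler_nat R 6)].
have good : hw 1 p p' (d p x + l2 + d p' y) ->
  hw (hopbound J i.+1) u v ((1 + (8 * i.+1)%:R / J%:R) * l).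
  move=> hpp.
  have := hop_walk_cat (hop_walk_cat (hop_walk_cat (hop_walk_cat H1 (hop_walk_sym h1)) hpp) h2) H2.
  move=> hh; apply: hop_walk_le hh _ _ => /=; first by move: bb; clear; lia.
  (* Origin of the 8: the pivots are within [2 * r] of [x] and [y], and each of these two distances
     is paid twice, on the edge to the pivot and in the length of the edge between the pivots. *)
  have -> : (1 + (8 * i.+1)%:R / J%:R) * l = c * l + 8 * r.
    by rewrite /c /r mulnS natrD; field; rewrite gt_eqF.
  have cl2 : l2 <= c * l2 by rewrite ler_peMl.
  have -> : c * l = c * l1 + c * l2 + c * l3 by rewrite -ll; ring.
  lra.
have [ep|hpp|[s [ls [As ws lsl]]]] := bunch ik Ap Ap' wpp.
- by left; apply: good; apply: hop_walk0 => //; apply: walk_ge0 wpp.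
- left; apply: good; apply: hop_walk_le (hw_edgeH hpp) _ _ => //.
  by have [] := rdist_spec HG wpp.
have [ep|hpp|[s' [ls' [As' ws' lsl']]]] := bunch ik Ap' Ap (walk_sym wpp).
- by left; apply: good; apply: hop_walk0 => //; apply: walk_ge0 wpp.
- left; apply: good; apply: hop_walk_le (hop_walk_sym (hw_edgeH hpp)) _ _ => //.
  by have [] := rdist_spec HG (walk_sym wpp).
right; split.
- exists s', (ls' + d p x + l1); split=> //; last by lra.
  by apply: walk_cat (walk_sym W1); apply: walk_cat wp.
- exists s, (ls + d p' y + l3); split=> //; last by lra.
  by apply: walk_cat W3; apply: walk_cat wp'.
Qed.

Lemma hopset_of_hierarchy (J : nat) (eps : R) : (6 <= J)%N -> 0 < eps ->
  (8 * k)%:R <= eps * J%:R -> is_hopset G H (hopbound J k) eps.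
Proof.
move=> J6 e0 Je u v; have J0 : 0 < J%:R :> R by rewrite ltr0n; lia.
split.
  apply: le_ereal_inf_tmp => y /= [q [[h1 h2 _] _] <-].
  by apply: (dist_le wt0); rewrite -h2; apply: union_walk.
have [[l wuv]|nw] := pselect (exists l, walkG u v l); last first.
  rewrite dist_no_walk; last by move=> l h; apply: nw; exists l.
  by rewrite gt0_muley ?leey // lte_fin; lra.
have [wd _ dE] := rdist_spec HG wuv.
have sd : shortest u v (d u v).
  by split=> // l' /(rdist_spec HG)[].
have [h|[[z [? [h _ _]]] _]] := hop_or_near J6 (leqnn k) sd; last first.
  by have := A_last z; rewrite h.
rewrite dE -EFinM.
apply: (le_trans (hop_dist_le union_wt_ge0 h)).
rewrite lee_fin; apply: ler_wpM2r; first exact: walk_ge0 wd.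
by rewrite lerD2l ler_pdivrMr.
Qed.

Lemma hopbound_le J i : (3 <= J)%N -> (hopbound J i <= (3 * J) ^ i)%N.
Proof.
move=> J3; elim: i => [|i IH] //=; rewrite expnS.
have : (0 < hopbound J i)%N by case: (i) => //= ?; lia.
set b := hopbound J i in IH *; set B := (_ ^ _)%N in IH *; nia.
Qed.

End Hopset.

(** * Simultaneous Dijkstra searches from several sources *)

(* A pair [(s, v)] of a source and a vertex is queued, has a tentative distance
   [aK s v] (if [akd s v]), or is expanded.  A vertex [v] is closed once a pivot,
   a source [p] with [x p < tp], has been found for it, at distance [apd v]. *)
Record astate (R : realType) (n : nat) := AState {
  aq : 'I_n -> 'I_n -> bool;
  akd : 'I_n -> 'I_n -> bool;
  aE : 'I_n -> 'I_n -> bool;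
  aK : 'I_n -> 'I_n -> R;
  acl : 'I_n -> bool;
  apd : 'I_n -> R }.

Definition upd2 (n : nat) (T : Type) (f : 'I_n -> 'I_n -> T) s0 v0 (y : T) :=
  fun s v => if (s == s0) && (v == v0) then y else f s v.

Lemma upd2_eq n T (f : 'I_n -> 'I_n -> T) s v y : upd2 f s v y s v = y.
Proof. by rewrite /upd2 !eqxx. Qed.

Section Search.
Variables (R : realType) (n : nat) (G : wgraph R n).
Hypothesis HG : pos_int_weights G.
Variables (x : 'I_n -> nat) (tp lo hi : nat).
Implicit Types (a : astate R n) (s t v y z p : 'I_n) (l m : R).

(* The current sources are those with [lo <= x s < hi]; either they are the
   pivots, or all the pivots have been dealt with before. *)
Hypothesis phase : (lo = 0 /\ hi = tp \/ lo = tp)%N.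

(** [X] is the set of sources started so far, [m] the distance at the last expansion, and [P] the
    arcs of expanded pairs still to be relaxed. The order of expansion is recorded only for sources
    of the current phase, [lo <= x s]. The third case of [i_disc] covers the pairs dropped by
    pruning, and [i_str] says that a source which is no pivot is expanded only where it is strictly
    closer than the pivot. *)
Record dinv a (X : 'I_n -> bool) m (P : 'I_n -> 'I_n -> 'I_n -> Prop) : Prop := DInv {
  i_q : forall s v, aq a s v ->
    [/\ akd a s v, ~~ aE a s v, (lo <= x s)%N & m <= aK a s v];
  i_X : forall s, X s -> [/\ (x s < hi)%N, akd a s s & aK a s s <= 0];
  i_k : forall s v, akd a s v -> X s /\ walk G s v (aK a s v);
  i_E : forall s v, aE a s v -> akd a s v /\ ((lo <= x s)%N -> aK a s v <= m);
  i_rel : forall s y z, aE a s y -> adj G y z ->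
    P s y z \/ akd a s z /\ aK a s z <= aK a s y + wt G y z;
  i_disc : forall s v, akd a s v ->
    [\/ aq a s v, aE a s v | acl a v /\ apd a v <= aK a s v];
  i_cl : forall v, acl a v -> exists p,
    [/\ (x p < tp)%N, aE a p v & aK a p v = apd a v];
  i_piv : forall p v, aE a p v -> (x p < tp)%N -> acl a v /\ apd a v = aK a p v;
  i_uniq : forall p p' v, aE a p v -> aE a p' v -> (x p < tp)%N -> (x p' < tp)%N ->
    p = p';
  i_str : forall s v, aE a s v -> (tp <= x s)%N -> acl a v -> aK a s v < apd a v }.

Definition no_arc : 'I_n -> 'I_n -> 'I_n -> Prop := fun _ _ _ => False.

Definition push_source a s0 :=
  AState (upd2 (aq a) s0 s0 true) (upd2 (akd a) s0 s0 true) (aE a)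
         (upd2 (aK a) s0 s0 0) (acl a) (apd a).

Lemma dinv_push_source a X s0 : dinv a X 0 no_arc ->
  (forall t y, aE a t y -> (x t < lo)%N) -> ~~ X s0 -> (lo <= x s0 < hi)%N ->
  dinv (push_source a s0) (fun s => X s || (s == s0)) 0 no_arc.
Proof.
move=> I HE nX /andP[lx xh].
have nk v : ~~ akd a s0 v by apply/negP => /(i_k I)[h _]; rewrite h in nX.
have nE v : ~~ aE a s0 v by apply/negP => /(i_E I)[h _]; rewrite (negbTE (nk v)) in h.
split; rewrite /= /upd2.
- move=> s v; case: ifP => [/andP[/eqP-> /eqP->] _|_]; last exact: (i_q I).
  by rewrite nE lexx.
- move=> s /orP[h|/eqP->]; last by rewrite eqxx /= xh lexx.
  case: ifP => [/andP[/eqP-> _]|_]; last exact: (i_X I).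
  by rewrite xh lexx.
- move=> s v; case: ifP => [/andP[/eqP-> /eqP->] _|_ /(i_k I)[-> ?]] //.
  by rewrite eqxx orbT; split=> //; apply: walk0.
- move=> s v h; have [h1 h2] := i_E I h.
  by case: ifP => [/andP[/eqP e /eqP e']|_] //; rewrite e (negbTE (nE _)) in h.
- move=> s y z h yz; have [//|[h1 h2]] := i_rel I h yz; right.
  case: (eqVneq s s0) => [e|] /=; last by rewrite h1.
  by rewrite e (negbTE (nE _)) in h.
- move=> s v; case: ifP => [_ _|_]; [by constructor 1 | exact: (i_disc I)].
- move=> v /(i_cl I)[p [h1 h2 h3]]; exists p; split=> //.
  case: (eqVneq p s0) => [e|] //=; by rewrite e (negbTE (nE _)) in h2.
- move=> p v h1 h2; have [h3 h4] := i_piv I h1 h2; split=> //.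
  case: (eqVneq p s0) => [e|] //=; by rewrite e (negbTE (nE _)) in h1.
- exact: (i_uniq I).
- move=> s v h; case: (eqVneq s s0) => [e|_] /=; last exact: (i_str I h).
  by rewrite e (negbTE (nE _)) in h.
Qed.

Definition pop a s0 v0 :=
  AState (upd2 (aq a) s0 v0 false) (akd a) (aE a) (aK a) (acl a) (apd a).

Lemma dinv_discard a X m s0 v0 : dinv a X m no_arc -> aq a s0 v0 ->
  acl a v0 -> apd a v0 <= aK a s0 v0 -> dinv (pop a s0 v0) X m no_arc.
Proof.
move=> I h1 h2 h3; case: I => i1 i2 i3 i4 i5 i6 i7 i8 i9 i10.
split=> //=; rewrite /upd2.
- by move=> s v; case: ifP => // _; apply: i1.
- move=> s v h; case: ifP => [/andP[/eqP-> /eqP->]|_]; last exact: i6.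
  by constructor 3.
Qed.

Definition expand a s0 v0 :=
  AState (upd2 (aq a) s0 v0 false) (akd a) (upd2 (aE a) s0 v0 true) (aK a)
   (fun v => if (v == v0) && (x s0 < tp)%N then true else acl a v)
   (fun v => if (v == v0) && (x s0 < tp)%N then aK a s0 v0 else apd a v).

(** In the pivot phase a closed vertex was closed by an expanded pivot at distance at most [m],
    while queued keys are at least [m]. So it is never live again, and each vertex is expanded for
    at most one pivot. In the other phase no source is a pivot. *)
Lemma live_open a X m P s0 v0 : dinv a X m P -> aq a s0 v0 ->
  ~~ acl a v0 || (aK a s0 v0 < apd a v0) -> (x s0 < tp)%N ->
  ~~ acl a v0 /\ hi = tp.
Proof.
move=> I h1 h2 xt; have [_ _ lx mk] := i_q I h1.
case: phase => [[l0 ht]|lt]; last by rewrite -lt ltnNge lx in xt.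
split=> //; case/orP: h2 => // kp; apply/negP => c.
have [p [p1 p2 p3]] := i_cl I c; have [_ pm] := i_E I p2.
have : aK a p v0 <= m by apply: pm; rewrite l0.
rewrite p3; lra.
Qed.

Lemma dinv_expand a X m s0 v0 : dinv a X m no_arc -> aq a s0 v0 ->
  (forall s v, aq a s v -> aK a s0 v0 <= aK a s v) ->
  ~~ acl a v0 || (aK a s0 v0 < apd a v0) ->
  dinv (expand a s0 v0) X (aK a s0 v0) (fun s y _ => s = s0 /\ y = v0).
Proof.
move=> I h1 hm h2; have [hk hE hl hmk] := i_q I h1.
have op := live_open I h1 h2.
case: I => i1 i2 i3 i4 i5 i6 i7 i8 i9 i10.
split=> //=; rewrite /upd2.
- move=> s v; case: ifP => // _ h; have [a1 a2 a3 a4] := i1 s v h.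
  by split=> //; apply: hm.
- move=> s v; case: ifP => [/andP[/eqP-> /eqP->] _|_ h] //.
  have [a1 a2] := i4 s v h; split=> // h'; apply: (le_trans (a2 h')) => //.
- move=> s y z; case: ifP => [/andP[/eqP-> /eqP->] _|_ h] yz; first by left.
  by have [//|h'] := i5 s y z h yz; right.
- move=> s v h; case: ifP => [/andP[/eqP-> /eqP->]|_]; first by constructor 2.
  have [h'|h'|[h' h'']] := i6 s v h; [by constructor 1|by constructor 2|].
  constructor 3; case: ifP => // /andP[/eqP e xt].
  by have [] := op xt; rewrite -e h'.
- move=> v; case: ifP => [/andP[/eqP-> xt] _|hv c].
    by exists s0; rewrite !eqxx.
  have [p [p1 p2 p3]] := i7 v c; exists p; split=> //.
  by case: ifP.
- move=> p v; case: ifP => [/andP[/eqP-> /eqP->] _ ->|hn h xp]; first by rewrite eqxx.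
  have [h3 h4] := i8 p v h xp; case: ifP => // /andP[/eqP e xt].
  by have [] := op xt; rewrite -e h3.
- move=> p p' v.
  have aux p1 : aE a p1 v0 -> (x p1 < tp)%N -> (x s0 < tp)%N -> False.
    by move=> e1 x1 /op[+ _]; have [-> _] := i8 _ _ e1 x1.
  case: ifP => [/andP[/eqP-> /eqP->] _|_ h].
    by case: ifP => [/andP[/eqP-> _]|_ h x1 x2] //; case: (aux p').
  case: ifP => [/andP[/eqP-> /eqP ev] _ x1 x2|_]; last exact: i9.
  by rewrite ev in h; case: (aux p).
- move=> s v; case: ifP => [/andP[/eqP-> /eqP->] _ ts|_ h ts].
    rewrite eqxx /= ltnNge ts /= => c; case/orP: h2 => //; by rewrite c.
  case: ifP => [/andP[/eqP e xt] _|_]; last exact: i10.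
  have [h3 _] := i4 s v h; have [h4 _] := i3 s v h3; have [h5 _ _] := i2 s h4.
  by have [_ e'] := op xt; rewrite e' ltnNge ts in h5.
Qed.

Definition relax a s0 v0 z :=
  if ~~ akd a s0 z || (aK a s0 v0 + wt G v0 z < aK a s0 z) then
    AState (upd2 (aq a) s0 z true) (upd2 (akd a) s0 z true) (aE a)
           (upd2 (aK a) s0 z (aK a s0 v0 + wt G v0 z)) (acl a) (apd a)
  else a.

Lemma dinv_relax a X s0 v0 z L : (lo <= x s0)%N -> aE a s0 v0 -> adj G v0 z ->
  dinv a X (aK a s0 v0) (fun s y z' => [/\ s = s0, y = v0 & z' \in z :: L]) ->
  [/\ dinv (relax a s0 v0 z) X (aK a s0 v0)
        (fun s y z' => [/\ s = s0, y = v0 & z' \in L]),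
      aE (relax a s0 v0 z) = aE a, acl (relax a s0 v0 z) = acl a,
      apd (relax a s0 v0 z) = apd a &
      forall s v, aE a s v -> aK (relax a s0 v0 z) s v = aK a s v].
Proof.
move=> lx Ev vz I; rewrite /relax.
have w0 := pos_int_wt_gt0 HG vz.
case: ifP => [hc|/negbT]; last first.
  rewrite negb_or negbK => /andP[hk]; rewrite -leNgt => hle.
  case: I => i1 i2 i3 i4 i5 i6 i7 i8 i9 i10; split=> //; split=> //.
  move=> s y z' h yz; have [[-> -> ]|h'] := i5 s y z' h yz; last by right.
  by rewrite inE => /orP[/eqP->|]; [right|left].
(* Dijkstra's argument: an expanded pair has a key at most that of [(s0, v0)], and the arc has
   positive weight, so the new distance cannot improve it. *)
have nE : ~~ aE a s0 z.
  apply/negP => h; have [h1 h2] := i_E I h; move: hc; rewrite h1 /=.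
  by have := h2 lx; lra.
have K' s v : aE a s v ->
    upd2 (aK a) s0 z (aK a s0 v0 + wt G v0 z) s v = aK a s v.
  by rewrite /upd2; case: ifP => // /andP[/eqP-> /eqP->]; rewrite (negbTE nE).
have [hk _] := i_E I Ev; have [X0 W0] := i_k I hk.
split=> //; case: I => i1 i2 i3 i4 i5 i6 i7 i8 i9 i10; split=> //=.
- move=> s v; rewrite /upd2; case: ifP => [/andP[/eqP-> /eqP->] _|_]; last exact: i1.
  by split=> //; lra.
- move=> s /i2 [h1 h2 h3]; rewrite /upd2; case: ifP => // /andP[/eqP e /eqP e'].
  by split=> //; move: hc h3; rewrite -e -e' h2 /=; lra.
- move=> s v; rewrite /upd2; case: ifP => [/andP[/eqP-> /eqP->] _|_]; last exact: i3.
  by split=> //; apply: walk_cat W0 _; apply: walk_edge.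
- move=> s v h; rewrite K' //; have [h1 h2] := i4 s v h; split=> //.
  by rewrite /upd2; case: ifP.
- move=> s y z' h yz; rewrite (K' s y) //.
  have aux : akd a s z' /\ aK a s z' <= aK a s y + wt G y z' ->
    upd2 (akd a) s0 z true s z' /\
    upd2 (aK a) s0 z (aK a s0 v0 + wt G v0 z) s z' <= aK a s y + wt G y z'.
    rewrite /upd2; case: ifP => // /andP[/eqP es /eqP ez] [h1 h2]; split=> //.
    by move: hc; rewrite -es -ez h1 /= => h3; apply: ltW; apply: lt_le_trans h2.
  have [[es ey]|h'] := i5 s y z' h yz; last by right; apply: aux.
  rewrite inE => /orP[/eqP ez|]; last by left.
  by right; rewrite es ey ez !upd2_eq.
- move=> s v; rewrite /upd2; case: ifP => [_ _|_]; [by constructor 1|exact: i6].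
- by move=> v /i7 [p [h1 h2 h3]]; exists p; rewrite K'.
- by move=> p v h1 h2; rewrite K' //; apply: i8.
- by move=> s v h; rewrite K' //; apply: i10.
Qed.

Lemma dinv_weaken a X m (P P' : 'I_n -> 'I_n -> 'I_n -> Prop) : dinv a X m P ->
  (forall s y z, aE a s y -> adj G y z -> P s y z -> P' s y z) -> dinv a X m P'.
Proof.
move=> [i1 i2 i3 i4 i5 i6 i7 i8 i9 i10] h; split=> //.
by move=> s y z h1 h2; case: (i5 s y z h1 h2); auto.
Qed.

(** Pruning loses nothing: once the walk meets a vertex [y] closed at distance at most [l], the
    search from the pivot of [y] takes over. Where that pivot expands a vertex, it closes it at the
    same distance; where it is pruned, the vertex is closed already. *)
Lemma dinv_complete a X m : dinv a X m no_arc -> (forall s v, ~~ aq a s v) ->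
  forall s v l, X s -> walk G s v l ->
  aE a s v /\ aK a s v <= l \/ acl a v /\ apd a v <= l.
Proof.
move=> I q0 s v l Xs; move: v l; apply: walk_ind_last.
  have [_ h1 h2] := i_X I Xs; have [h|h|[h h']] := i_disc I h1.
  - by rewrite (negbTE (q0 _ _)) in h.
  - by left.
  - by right; split=> //; apply: le_trans h2.
have step : forall t y z l, aE a t y -> aK a t y <= l -> adj G y z ->
    aE a t z /\ aK a t z <= l + wt G y z \/ acl a z /\ apd a z <= l + wt G y z.
  move=> t y z l Ey Kl yz; have [//|[h1 h2]] := i_rel I Ey yz.
  have [h|h|[h h']] := i_disc I h1.
  - by rewrite (negbTE (q0 _ _)) in h.
  - by left; split=> //; lra.
  - by right; split=> //; lra.
move=> y z l _ [[Ey Kl]|[cy pl]] yz; first exact: step yz.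
have [p [p1 p2 p3]] := i_cl I cy; rewrite -p3 in pl.
have [[h1 h2]|h] := step _ _ _ _ p2 pl yz; last by right.
by right; have [h3 ->] := i_piv I h1 p1.
Qed.

Lemma dinv_pivot a X m : dinv a X m no_arc -> (forall s v, ~~ aq a s v) ->
  forall p v l, X p -> (x p < tp)%N -> walk G p v l -> acl a v /\ apd a v <= l.
Proof.
move=> I q0 p v l Xp xp w; have [[h1 h2]|//] := dinv_complete I q0 Xp w.
by have [h3 ->] := i_piv I h1 xp.
Qed.

(** The alternative is that [v] is closed within the true distance. For a pivot the closing distance
    is its key by [i_piv]; for any other source this contradicts the strictness in [i_str]. *)
Lemma dinv_exact a X m : dinv a X m no_arc -> (forall s v, ~~ aq a s v) ->
  forall s v, aE a s v -> walk G s v (aK a s v) /\ aK a s v = rdist G s v.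
Proof.
move=> I q0 s v h; have [h1 _] := i_E I h; have [Xs w] := i_k I h1.
split=> //; have [w' d1 _] := rdist_spec HG w.
apply/eqP; rewrite eq_le d1 andbT.
have [[]//|[c p]] := dinv_complete I q0 Xs w'.
case: (ltnP (x s) tp) => xs; first by have [_ <-] := i_piv I h xs.
by have := i_str I h xs c; lra.
Qed.

Definition qsize a : nat := #|[set p : 'I_n * 'I_n | aq a p.1 p.2]|%SET.

Lemma qsize_push a a' s0 v0 : aq a' = upd2 (aq a) s0 v0 true ->
  (qsize a' <= (qsize a).+1)%N.
Proof.
move=> e; rewrite /qsize e.
pose B := [set p : 'I_n * 'I_n | aq a p.1 p.2]%SET.
have : (#|((s0, v0) |: B)%SET| <= #|B|.+1)%N by rewrite cardsU1; case: (_ \notin _).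
apply: leq_trans; apply: subset_leq_card; apply/fintype.subsetP => -[s v].
by rewrite !inE /upd2 xpair_eqE /=; case: ifP.
Qed.

Lemma qsize_pop a a' s0 v0 : aq a s0 v0 -> aq a' = upd2 (aq a) s0 v0 false ->
  ((qsize a').+1 = qsize a)%N.
Proof.
move=> h e; rewrite /qsize e [RHS](cardsD1 (s0, v0)) inE h add1n.
congr _.+1; apply: eq_card => -[s v].
by rewrite !inE /upd2 xpair_eqE /=; case: ifP.
Qed.

End Search.

Arguments no_arc {n} _ _ _.

(** * The program *)

Local Open Scope nat_scope.

(* Words: 0 [n] and the number of listed edges; 1, 2 endpoints of the listed edges;
   3 tournament tree; 4 [P], the power of two above [n]; 5 loop counter; 6 random
   keys; 7, 8 the last levels at which a pair had a tentative distance and at which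
   a vertex was closed; 9, 10, 11 adjacency lists; 12 pairs already output;
   13 current node; 14 current pair; 15 current arc; 16, 17 thresholds of the
   current and of the next level; 18 their quotient; 19 its limit; 20 level;
   21 random bit; 22 [log P].
   Reals: 0 parameters; 1 weights of the listed edges; 2 tentative distances;
   3 distances to the pivots; 4 weights of the arcs; 5 multiples of a parameter.
   The pair [(s, v)] has the code [s * P + v], its leaf in the tree of [M = P * P]
   leaves is the node [M + s * P + v], and nodes contain codes shifted by one. *)

Definition V (k : nat) : wexp := WLoad k (WConst 0).
Definition vj := V 13.
Definition eM := WBin WMul (V 4) (V 4).
Definition ej := WBin WSub vj eM.

Definition c_fix : cmd :=
  CWhile (BWLt (WConst 1) vj)
   (CSeq (CWStore 13 (WConst 0) (WBin WDiv vj (WConst 2)))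
    (let l := WLoad 3 (WBin WMul (WConst 2) vj) in
     let r := WLoad 3 (WBin WAdd (WBin WMul (WConst 2) vj) (WConst 1)) in
     CIf (BNot (BAnd (BNot (BWEq l (WConst 0)))
           (BNot (BAnd (BNot (BWEq r (WConst 0)))
                 (BRLt (RLoad 2 (WBin WSub r (WConst 1)))
                       (RLoad 2 (WBin WSub l (WConst 1))))))))
      (CWStore 3 vj r) (CWStore 3 vj l))).

(* Gives a new key to the pair whose leaf is the current node. *)
Definition c_set (key : rexp) : cmd :=
  CSeq (CRStore 2 ej key)
  (CSeq (CWStore 7 ej (V 20))
  (CSeq (CWStore 3 vj (WBin WAdd ej (WConst 1))) c_fix)).

Definition c_pop : cmd :=
  CSeq (CWStore 14 (WConst 0) (WBin WSub (WLoad 3 (WConst 1)) (WConst 1)))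
  (CSeq (CWStore 13 (WConst 0) (WBin WAdd eM (V 14)))
  (CSeq (CWStore 3 vj (WConst 0)) c_fix)).

Ltac keepnat := repeat match goal with H : ?T |- _ =>
  lazymatch T with
  | nat => fail | @eq ?U _ _ => tryif unify U nat then fail else clear H
  | is_true (leq _ _) => fail
  | is_true (andb (leq _ _) (leq _ _)) => fail
  | _ => clear H end end.
Ltac nlia := keepnat; lia.

(** * Frame conditions and symbolic execution *)

Section Same.
Variable R : realType.
Implicit Types s : state R.

(** Frame condition: [L1] and [L2] list the word arrays and the real arrays that may have
    changed. *)
Definition same (L1 L2 : seq nat) s s' : Prop :=
  (forall k i, k \notin L1 -> words s' k i = words s k i) /\
  (forall k i, k \notin L2 -> reals s' k i = reals s k i).

Lemma same_refl L1 L2 s : same L1 L2 s s.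
Proof. by []. Qed.

Lemma same_trans L1 L2 s1 s2 s3 :
  same L1 L2 s1 s2 -> same L1 L2 s2 s3 -> same L1 L2 s1 s3.
Proof. by move=> [h1 h2] [h3 h4]; split=> k i h; rewrite ?h3 ?h4 ?h1 ?h2. Qed.

Lemma same_sub L1 L2 L1' L2' s s' : same L1 L2 s s' ->
  all (fun k => k \in L1') L1 -> all (fun k => k \in L2') L2 -> same L1' L2' s s'.
Proof.
move=> [h1 h2] /allP a1 /allP a2; split=> k i h.
  by rewrite h1 //; apply: contra h; apply: a1.
by rewrite h2 //; apply: contra h; apply: a2.
Qed.

Lemma same_wstore L1 L2 s s' j i y : same L1 L2 s s' -> j \in L1 ->
  same L1 L2 s (State (upd (words s') j i y) (reals s')).
Proof.
move=> [h1 h2] jL; split=> k i' h; last exact: h2.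
by rewrite /= /upd; case: eqP => [e|_] /=; [rewrite e jL in h|exact: h1].
Qed.

Lemma same_rstore L1 L2 s s' j i y : same L1 L2 s s' -> j \in L2 ->
  same L1 L2 s (State (words s') (upd (reals s') j i y)).
Proof.
move=> [h1 h2] jL; split=> k i' h; first exact: h1.
by rewrite /= /upd; case: eqP => [e|_] /=; [rewrite e jL in h|exact: h2].
Qed.

End Same.

Section Stores.
Variables (R : realType) (w : nat).

Lemma tr_ws j a e (s : state R) i y (Q : state R -> Prop) :
  eval_w w s a = i -> eval_w w s e = y ->
  Q (State (upd (words s) j i y) (reals s)) -> tr w (CWStore j a e) s 1 Q.
Proof. by move=> <- <-; apply: tr_wstore. Qed.

Lemma tr_rs j a e (s : state R) i y (Q : state R -> Prop) :
  eval_w w s a = i -> eval_r w s e = y ->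
  Q (State (words s) (upd (reals s) j i y)) -> tr w (CRStore j a e) s 1 Q.
Proof. by move=> <- <-; apply: tr_rstore. Qed.

Lemma mW y : y < 2 ^ w -> y %% 2 ^ w = y.
Proof. exact: modn_small. Qed.

End Stores.

(* Evaluates the expressions of the program, discharging overflow conditions. *)
Ltac cells := repeat match goal with
  | H : words ?s ?k ?i = _ |- context [words ?s ?k ?i] => rewrite H
  | H : divn ?a ?b = _ |- context [divn ?a ?b] => rewrite H
  | H : modn ?a ?b = _ |- context [modn ?a ?b] => rewrite H end.
Ltac mods := repeat match goal with |- context [modn ?a (expn 2 ?w)] =>
  lazymatch a with context [modn _ (expn 2 w)] => fail | _ => idtac end;
  rewrite (@mW w a); [|by cells; nlia] end.
Ltac ev := rewrite /= ?mod0n /upd /= ?eqxx /=; cells; mods; cells; mods.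
Tactic Notation "wst" constr(i) constr(y) :=
  apply: (@tr_ws _ _ _ _ _ _ i y); [by ev; try nlia|by ev; try nlia|].
Tactic Notation "rst" constr(i) constr(y) :=
  apply: (@tr_rs _ _ _ _ _ _ i y); [by ev; try nlia|by ev; try nlia|].

(** * Updates of the tournament tree *)

Section Tree.
Variables (R : realType) (w P M D : nat).
Hypothesis PM : M = P * P.
Hypothesis HW : 2 ^ w = M * M.
Hypothesis MD : M = 2 ^ D.
Hypothesis Mbig : 100 <= M.
Implicit Types s : state R.
Local Notation tr := (@tr R w).

(** The program only forms numbers that are small multiples of [M], the number of codes of pairs;
    this margin serves the overflow conditions. *)
Lemma W_big : 100 * M <= 2 ^ w.
Proof. by rewrite HW leq_mul2r Mbig orbT. Qed.

Definition tour t (K : nat -> R) := tournament M t K /\ forall j, t j <= M.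

(** An entry naming [c] can only sit on the path from its leaf to the root. All other nodes compare
    candidates with unchanged keys, so only the ancestors of the leaf need repair. *)
Lemma tour_update t t' K K' c y : tour t K -> c < M ->
  (forall i, i != c -> K' i = K i) ->
  (forall i, t' i = if i == M + c then y else t i) -> y = 0 \/ y = c.+1 ->
  (forall i, 0 < i < M -> (forall d, i <> (M + c) %/ 2 ^ d.+1) ->
     t' i = better K' (t' (2 * i)) (t' (2 * i + 1))) /\
  (forall c, c < M -> t' (M + c) = 0 \/ t' (M + c) = c.+1) /\
  (forall j, t' j <= M).
Proof.
move=> [T tM] cM KK tt yy; split; last first.
  split=> [i iM|j]; last by rewrite tt; case: ifP => _ //; lia.
  by rewrite tt eqn_add2l; case: eqP => [->|_] //; apply: (proj2 T).
move=> i iM anc.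
have child j : j = 2 * i \/ j = 2 * i + 1 -> t' j = t j /\ (t j <> 0 -> (t j).-1 != c).
  move=> hj; have ji : j %/ 2 = i by lia.
  split.
    rewrite tt; case: eqP => // e; case: (anc 0).
    by rewrite expn1 -e.
  move=> tj; apply/eqP => e.
  have [|d [h1 _ _]] := tournament_leaf T _ tj; first lia.
  by case: (anc d); rewrite expnSr divnMA -e h1.
have [e1 n1] := child (2 * i) (or_introl erefl).
have [e2 n2] := child (2 * i + 1) (or_intror erefl).
rewrite e1 e2 tt; case: eqP => [e|_]; first by move: iM; rewrite e; lia.
rewrite (proj1 T) // /better.
case: eqP => //= z1; case: (t (2 * i + 1) =P 0) => //= z2.
by rewrite !KK //; [exact: n1|exact: n2].
Qed.

Lemma fix_spec s j t K : words s 4 0 = P -> words s 13 0 = j -> M <= j < 2 * M ->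
  words s 3 = t -> reals s 2 = K ->
  (forall i, 0 < i < M -> (forall d, i <> j %/ 2 ^ d.+1) ->
     t i = better K (t (2 * i)) (t (2 * i + 1))) ->
  (forall c, c < M -> t (M + c) = 0 \/ t (M + c) = c.+1) ->
  (forall j, t j <= M) ->
  tr c_fix s (5 * D.+1).+1 (fun s' =>
    [/\ tour (words s' 3) K, forall c, words s' 3 (M + c) = t (M + c) &
        same [:: 3; 13] [::] s s']).
Proof.
move=> h4 h13 jM h3 hK hn hl hb.
have WB := W_big.
(* The tournament equation may fail only at proper ancestors of the current node; [f'] bounds the
   number of rounds left, of five steps each. *)
pose I f s' := exists j f',
  [/\ f = 5 * f', words s' 13 0 = j, 0 < j < 2 * M & j < 2 ^ f'] /\
  [/\ forall i, 0 < i < M -> (forall d, i <> j %/ 2 ^ d.+1) ->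
     words s' 3 i = better K (words s' 3 (2 * i)) (words s' 3 (2 * i + 1)),
    forall c, words s' 3 (M + c) = t (M + c),
    forall j, words s' 3 j <= M,
    reals s' 2 = K &
    same [:: 3; 13] [::] s s'].
have := @tr_while R w I (BWLt (WConst 1) vj) _ (5 * D.+1) s _ _.
move=> H; apply: tr_conseq (H _ _ _) _ _ => //.
- move=> f s' [j' [f' [[-> e13 j'M jf] [n' l' b' k' sm]]]].
  rewrite /= mod0n e13 mW; last nlia.
  move=> j1; case: f' jf => [|f']; first by rewrite expn0; nlia.
  rewrite expnS => jf; eexists; apply: tr_seq.
  wst 0 (j' %/ 2).
  set s1 := State _ _.
  have post y : y = better K (words s' 3 (2 * (j' %/ 2))) (words s' 3 (2 * (j' %/ 2) + 1)) ->
      exists f'0, I f'0 (State (upd (words s1) 3 (j' %/ 2) y) (reals s1)) /\ 4 + f'0 < 5 * f'.+1.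
    move=> ->; exists (5 * f'); split; last nlia.
    exists (j' %/ 2), f'; split; first by split=> //; rewrite /= ?/upd /= //; nlia.
    rewrite /s1; split=> //.
    + move=> i iM anc; rewrite /upd /=; have nj d : i <> j' %/ 2 ^ d.+1 \/ i = j' %/ 2.
        case: d => [|d]; first by rewrite expn1; case: (i =P j' %/ 2); auto.
        by left; rewrite expnS divnMA; apply: anc.
      have [ij|ij] := eqVneq i (j' %/ 2).
        by rewrite ij ?eqxx !ifF //; apply/eqP; nlia.
      have c1 : (2 * i == j' %/ 2) = false.
        by apply/eqP => e; apply: (anc 0); rewrite expn1; nlia.
      have c2 : (2 * i + 1 == j' %/ 2) = false.
        by apply/eqP => e; apply: (anc 0); rewrite expn1; nlia.
      rewrite c1 c2; apply: n' => // d e; case: (nj d) => // e'.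
      by rewrite e' eqxx in ij.
    + by move=> c; rewrite /upd /= ifF ?l' //; apply/eqP; nlia.
    + move=> i; rewrite /upd /=; case: ifP => _ //.
      by have [->|->] := better_in K (words s' 3 (2 * (j' %/ 2))) (words s' 3 (2 * (j' %/ 2) + 1)).
    + by apply: same_wstore => //; apply: same_wstore.
  have bl := b' (2 * (j' %/ 2)); have br := b' (2 * (j' %/ 2) + 1).
  have ER : eval_w w s1 (WLoad 3 (WBin WAdd (WBin WMul (WConst 2) vj) (WConst 1))) = words s' 3 (2 * (j' %/ 2) + 1) by ev.
  have EL : eval_w w s1 (WLoad 3 (WBin WMul (WConst 2) vj)) = words s' 3 (2 * (j' %/ 2)) by ev.
  apply: (@tr_if _ _ _ _ _ _ 1 1) => hc.
  + apply: (@tr_ws _ _ _ _ _ _ (j' %/ 2)); [by ev|exact: ER|apply: post]; move: hc; ev.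
    by rewrite k' !subn1 negb_and !negbK /better => ->.
  + apply: (@tr_ws _ _ _ _ _ _ (j' %/ 2)); [by ev|exact: EL|apply: post]; move: hc; ev.
    by rewrite k' !subn1 negb_and !negbK /better => /negbTE ->.
- exists j, D.+1; rewrite -h3 -hK; split; first by split=> //; rewrite ?expnS -?MD //; nlia.
  by split=> //; [rewrite h3 hK|rewrite h3].
- move=> s2 [f [[j' [f' [[_ e13 j'M _] [n' l' b' k' sm]]]]]].
  rewrite /= mod0n e13 mW; last nlia.
  rewrite -leqNgt => j1; split=> //; split=> //; split=> [i iM|c cM].
    by apply: n' => // d; rewrite divn_small; [nlia|have := expn_gt0 2 d.+1; rewrite expnS; nlia].
  by rewrite l'; apply: hl.
Qed.

Lemma set_spec s c key r : words s 4 0 = P -> words s 13 0 = M + c -> c < M ->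
  tour (words s 3) (reals s 2) -> eval_r w s key = r ->
  tr (c_set key) s (5 * D + 12) (fun s' =>
   [/\ tour (words s' 3) (reals s' 2),
       forall i, words s' 3 (M + i) = if i == c then c.+1 else words s 3 (M + i),
       forall i, reals s' 2 i = if i == c then r else reals s 2 i,
       forall i, words s' 7 i = if i == c then words s 20 0 else words s 7 i &
       same [:: 3; 7; 13] [:: 2] s s']).
Proof.
move=> h4 h13 cM T hr; have WB := W_big.
have KK i : i != c -> upd (reals s) 2 c r 2 i = reals s 2 i.
  by move=> /negbTE ic; rewrite /upd /= ic.
have tt i : upd (words s) 3 (M + c) c.+1 3 i = if i == M + c then c.+1 else words s 3 i.
  by rewrite /upd /=; case: eqP.
have [u1 [u2 u3]] := tour_update T cM KK tt (or_intror erefl).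
eapply tr_conseq.
- apply: tr_seq; rst c r; apply: tr_seq; wst c (words s 20 0).
  apply: tr_seq; wst (M + c) c.+1.
  apply: (@fix_spec _ (M + c) _ _ _ _ _ erefl erefl); [by []|by []|nlia|by move: u1; rewrite /upd /=|by move: u2; rewrite /upd /=|by move: u3; rewrite /upd /=].
- nlia.
- move=> s' [t1 t2 sm]; have s2 i : reals s' 2 i = if i == c then r else reals s 2 i.
    by rewrite (proj2 sm) //= /upd /=; case: eqP.
  split=> //.
  + suff -> : reals s' 2 = upd (reals s) 2 c r 2 by [].
    by apply/funext => i; rewrite s2 /upd /=; case: eqP.
  + by move=> i; rewrite t2 /upd /= eqn_add2l; case: eqP.
  + by move=> i; rewrite (proj1 sm) //= /upd /=; case: eqP.
  + apply: same_trans (same_sub sm _ _) => //.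
    by do !(apply: same_wstore => //); apply: same_rstore.
Qed.

Lemma root_min t K : tour t K -> t 1 <> 0 ->
  [/\ (t 1).-1 < M, t (M + (t 1).-1) = t 1 &
    forall i, i < M -> t (M + i) <> 0 -> (K (t 1%N).-1 <= K i)%R].
Proof.
move=> T h1; have [|d [_ cM tc]] := tournament_leaf (proj1 T) _ h1; first by nlia.
split=> // i iM ti; have [|_ ri] := tournament_root (proj1 T) _ ti; first nlia.
by case: (proj2 (proj1 T) i iM) ri => [//|->].
Qed.

Lemma pop_spec s c : words s 4 0 = P -> tour (words s 3) (reals s 2) ->
  words s 3 1 = c.+1 ->
  tr c_pop s (5 * D + 12) (fun s' =>
   [/\ words s' 14 0 = c, tour (words s' 3) (reals s' 2),
       forall i, words s' 3 (M + i) = if i == c then 0 else words s 3 (M + i) &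
       same [:: 3; 13; 14] [::] s s']).
Proof.
move=> h4 T h1; have WB := W_big.
have [|cM tc _] := root_min T; first by rewrite h1.
have b1 := proj2 T 1; rewrite h1 /= in cM tc b1.
have tt i : upd (words s) 3 (M + c) 0 3 i = if i == M + c then 0 else words s 3 i.
  by rewrite /upd /=; case: eqP.
have [u1 [u2 u3]] := tour_update T cM (fun i _ => erefl (reals s 2 i)) tt (or_introl erefl).
eapply tr_conseq.
- apply: tr_seq; wst 0 c; apply: tr_seq; wst 0 (M + c).
  apply: tr_seq; wst (M + c) 0.
  apply: (@fix_spec _ (M + c) _ _ _ _ _ erefl erefl); [by []|by []|nlia|by move: u1; rewrite /upd /=|by move: u2; rewrite /upd /=|by move: u3; rewrite /upd /=].
- nlia.
- move=> s' [t1 t2 sm]; split=> //.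
  + by rewrite (proj1 sm).
  + suff -> : reals s' 2 = reals s 2 by [].
    by apply/funext => i; rewrite (proj2 sm).
  + by move=> i; rewrite t2 /upd /= eqn_add2l; case: eqP.
  + apply: same_trans (same_sub sm _ _) => //.
    by do !(apply: same_wstore => //).
Qed.

End Tree.

(** * The pruned search from many sources *)

Definition eK := RLoad 2 (V 14).
Definition eS := WBin WDiv (V 14) (V 4).
Definition eV := WBin WMod (V 14) (V 4).
Definition ea := WBin WSub (V 15) (WConst 1).
Definition cnt := WLoad 0 (WConst 1).
Definition bor b1 b2 := BNot (BAnd (BNot b1) (BNot b2)).

Definition c_relax : cmd :=
  CSeq (CWStore 13 (WConst 0)
         (WBin WAdd eM (WBin WAdd (WBin WSub (V 14) eV) (WLoad 11 ea))))
  (CSeq (CIf (BNot (BAnd (BWEq (WLoad 7 ej) (V 20))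
             (BNot (BRLt (RBin RAdd eK (RLoad 4 ea)) (RLoad 2 ej)))))
           (c_set (RBin RAdd eK (RLoad 4 ea))) CSkip)
        (CWStore 15 (WConst 0) (WLoad 10 ea))).

Definition c_arcs : cmd :=
  CSeq (CWStore 15 (WConst 0) (WLoad 9 eV))
       (CWhile (BNot (BWEq (V 15) (WConst 0))) c_relax).

Definition c_close : cmd :=
  CIf (BWLt (WLoad 6 eS) (V 17))
    (CSeq (CWStore 8 eV (V 20)) (CRStore 3 eV eK)) CSkip.

(** A pivot is joined to every vertex it expands, any other source only to vertices with key below
    the current threshold. Array 12 is marked in both orientations, so that no edge is listed
    twice. *)
Definition c_emit : cmd :=
  CIf (BAnd (bor (BWLt (WLoad 6 eS) (V 17)) (BWLt (WLoad 6 eV) (V 16)))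
            (BAnd (BNot (BWEq eS eV)) (BWEq (WLoad 12 (V 14)) (WConst 0))))
    (CSeq (CWStore 12 (V 14) (WConst 1))
    (CSeq (CWStore 12 (WBin WAdd (WBin WMul eV (V 4)) eS) (WConst 1))
    (CSeq (CWStore 1 cnt eS)
    (CSeq (CWStore 2 cnt eV)
    (CSeq (CRStore 1 cnt eK)
          (CWStore 0 (WConst 1) (WBin WAdd cnt (WConst 1))))))))
    CSkip.

Definition c_dijkstra : cmd :=
  CWhile (BNot (BWEq (WLoad 3 (WConst 1)) (WConst 0)))
    (CSeq c_pop
      (CIf (BNot (BAnd (BWEq (WLoad 8 eV) (V 20))
                       (BNot (BRLt eK (RLoad 3 eV)))))
        (CSeq c_close (CSeq c_emit c_arcs)) CSkip)).

Section Level.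
Variables (R : realType) (n : nat) (G : wgraph R n).
Hypothesis HG : pos_int_weights G.
Variables (w P M D : nat).
Hypothesis PM : M = P * P.
Hypothesis HW : 2 ^ w = M * M.
Hypothesis MD : M = 2 ^ D.
Hypothesis Mbig : 100 <= M.
Hypothesis nP : n <= P.
Variables (x : 'I_n -> nat) (th tp sg : nat) (nb : 'I_n -> seq 'I_n).
Hypothesis nbE : forall v z, adj G v z = (z \in nb v).
Implicit Types (st : state R) (s t u v z p : 'I_n) (a : astate R n).
Implicit Types (E : 'I_n -> 'I_n -> bool).
Local Notation tr := (@tr R w).
Local Notation tour := (tour M).

Definition code (s v : 'I_n) : nat := s * P + v.

Lemma vertex_lt v : v < P. Proof. exact: leq_trans nP. Qed.

Lemma P_le_M : P <= M.
Proof. by rewrite PM leq_pmulr //; move: PM Mbig; case: (P) => [|?] // ->. Qed.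

Lemma code_div u v : code u v %/ P = u.
Proof. by have vP := vertex_lt v; rewrite /code divnMDl ?divn_small ?addn0 //; apply: leq_ltn_trans vP. Qed.

Lemma code_mod u v : code u v %% P = v.
Proof. by rewrite /code modnMDl modn_small // vertex_lt. Qed.

Lemma code_lt u v : code u v < M.
Proof. have := vertex_lt u; have := vertex_lt v; rewrite /code PM; nia. Qed.

Lemma code_eq u v u' v' : (code u v == code u' v') = (u == u') && (v == v').
Proof.
apply/eqP/andP => [e|[/eqP-> /eqP->] //].
by rewrite -!val_eqE /= -(code_div u v) -(code_mod u v) e code_div code_mod.
Qed.

(* [a] heads the linked list (with pointers shifted by one) of the arcs from [v],
   whose heads are listed in [L]. *)
Fixpoint chain (nx to : nat -> nat) (aw : nat -> R) v (a : nat) (L : seq 'I_n) :=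
  if L is z :: L' then
    [/\ 0 < a <= M, to a.-1 = z, aw a.-1 = wt G v z & chain nx to aw v (nx a.-1) L']
  else a = 0.

Definition stat st : Prop :=
  [/\ words st 0 0 = n, words st 4 0 = P, forall v, words st 6 v = x v &
      forall v, chain (words st 10) (words st 11) (reals st 4) v (words st 9 v) (nb v)].

Definition lvl st : Prop :=
  [/\ words st 16 0 = th, words st 17 0 = tp & words st 20 0 = sg].

Lemma chain_ext nx to aw nx' to' aw' v b L :
  nx =1 nx' -> to =1 to' -> aw =1 aw' ->
  chain nx to aw v b L -> chain nx' to' aw' v b L.
Proof.
move=> h1 h2 h3; elim: L b => //= z L IH b [h4 h5 h6 h7].
by rewrite -h2 -h3 -h1; split=> //; apply: IH.
Qed.

Lemma stat_same L1 L2 st st' : same (0 :: L1) L2 st st' -> words st' 0 0 = words st 0 0 ->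
  ~~ has (mem L1) [:: 4; 6; 9; 10; 11] -> 4 \notin L2 -> stat st -> stat st'.
Proof.
move=> [h1 h2] h0 /hasPn nL n2 [s1 s2 s3 s4].
have W k i : k \in [:: 4; 6; 9; 10; 11] -> words st' k i = words st k i.
  by move=> hk; rewrite h1 // inE negb_or (nL _ hk) andbT; move: hk; case: k.
split; first by rewrite h0.
- by rewrite W.
- by move=> v; rewrite W.
- by move=> v; rewrite W //; apply: chain_ext (s4 v) => i; rewrite ?W ?h2.
Qed.

Lemma lvl_same L1 L2 st st' : same L1 L2 st st' -> ~~ has (mem L1) [:: 16; 17; 20] ->
  lvl st -> lvl st'.
Proof.
move=> [h1 h2] /hasPn nL [s1 s2 s3].
by split; rewrite h1 // nL.
Qed.

(** Arrays 7 and 8 hold stamps: an entry other than the current [sg] counts as unset, so raising the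
    stamp clears both at once, whereas clearing the [M] cells of array 7 one by one would be too
    slow. The set [E] of expanded pairs is a ghost component, not stored by the program. *)
Definition absst st E : astate R n :=
  AState (fun u v => words st 3 (M + code u v) != 0)
         (fun u v => words st 7 (code u v) == sg) E
         (fun u v => reals st 2 (code u v))
         (fun v => words st 8 v == sg) (fun v => reals st 3 v).

Definition treeok st : Prop :=
  tour (words st 3) (reals st 2) /\
  (forall c, c < M -> words st 3 (M + c) <> 0 -> exists u v, c = code u v) /\
  (forall i, words st 7 i <= sg /\ words st 8 i <= sg).

Lemma set_abs st E u v key r : words st 4 0 = P -> words st 13 0 = M + code u v ->
  words st 20 0 = sg -> treeok st -> eval_r w st key = r ->
  tr (c_set key) st (5 * D + 12) (fun st' =>
    [/\ treeok st', same [:: 3; 7; 13] [:: 2] st st' &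
      absst st' E = AState (upd2 (aq (absst st E)) u v true)
        (upd2 (akd (absst st E)) u v true) E (upd2 (aK (absst st E)) u v r)
        (acl (absst st E)) (apd (absst st E))]).
Proof.
move=> h4 h13 h20 [T [lf sgs]] hr; have cM := code_lt u v.
apply: tr_conseq (set_spec PM HW MD Mbig h4 h13 cM T hr) (leqnn _) _.
move=> st' [t1 t2 t3 t4 sm]; split=> //.
  split=> //; split=> [c cc|i].
    by rewrite t2; case: eqP => [-> _|_]; [exists u, v|exact: lf].
  by rewrite t4 (proj1 sm) //; case: ifP => _; rewrite ?h20 ?leqnn; have [] := sgs i.
rewrite /absst /=; congr AState; apply/funext => u'; rewrite ?(proj1 sm) ?(proj2 sm) //;
  apply/funext => v'; rewrite /upd2 ?t2 ?t3 ?t4 ?h20 code_eq; case: ifP => //.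
by rewrite eqxx.
Qed.

Lemma relax_spec st E s0 v0 z L : stat st -> lvl st -> treeok st ->
  words st 14 0 = code s0 v0 -> 
  chain (words st 10) (words st 11) (reals st 4) v0 (words st 15 0) (z :: L) ->
  tr c_relax st (5 * D + 20) (fun st' =>
    [/\ treeok st', same [:: 3; 7; 13; 15] [:: 2] st st',
        absst st' E = relax G (absst st E) s0 v0 z &
        chain (words st 10) (words st 11) (reals st 4) v0 (words st' 15 0) L]).
Proof.
move=> S [l1 l2 l3] T h14 /= [aM h11 haw ch]; have [h0 h4 _ _] := S.
have WB := W_big HW Mbig; have Ple := P_le_M; have cM := code_lt s0 v0; have cz := code_lt s0 z.
have cm := code_mod s0 v0; have zP := vertex_lt z; have vP := vertex_lt v0.
have c1 : code s0 v0 = s0 * P + v0 by [].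
have c2 : code s0 z = s0 * P + z by [].
have eJ : M + code s0 z - P * P = code s0 z by nlia.
rewrite -subn1 in h11 haw.
eapply tr_le.
- apply: tr_seq; wst 0 (M + code s0 z).
  set s1 := State _ _.
  have E1 : eval_w w s1 ej = code s0 z by ev; nlia.
  have E2 : eval_r w s1 (RBin RAdd eK (RLoad 4 ea)) =
      (reals st 2 (code s0 v0) + wt G v0 z)%R by ev; rewrite haw.
  apply: tr_seq; apply: tr_if => hc.
  + apply: tr_conseq (@set_abs s1 E s0 z _ _ _ _ _ T E2) (leqnn _) _ => //.
    move=> s2 [t1 sm ab].
    have e15 : words s2 15 0 = words st 15 0 by rewrite (proj1 sm).
    apply: (@tr_ws _ _ _ _ _ _ 0 (words st 10 (words st 15 0).-1)); first by ev.
      by ev; rewrite (proj1 sm) //= subn1.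
    have ab' : absst s2 E = relax G (absst st E) s0 v0 z.
      by rewrite ab /relax; move: hc; ev; rewrite eJ haw negb_and negbK => ->.
    split=> //.
    + apply: same_wstore => //.
      by apply: same_trans (same_sub sm _ _) => //; apply: same_wstore => //; exact: same_refl.
  + apply: tr_skip; apply: (@tr_ws _ _ _ _ _ _ 0 (words st 10 (words st 15 0).-1)).
    * by ev.
    * by ev; rewrite subn1.
    have ab' : absst s1 E = relax G (absst st E) s0 v0 z.
      by rewrite /relax; move: hc; ev; rewrite eJ haw negb_and negbK => /negbTE ->.
    split=> //.
    + by do !(apply: same_wstore => //).
- nlia.
Qed.

Local Notation u0 := (5 * D + 24).

Lemma arcs_spec st E X lo hi s0 v0 : stat st -> lvl st -> treeok st ->
  words st 14 0 = code s0 v0 -> lo <= x s0 -> E s0 v0 ->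
  dinv G x tp lo hi (absst st E) X (reals st 2 (code s0 v0))
    (fun s y _ => s = s0 /\ y = v0) ->
  tr c_arcs st (u0 * size (nb v0) + 5) (fun st' =>
    [/\ treeok st', same [:: 3; 7; 13; 15] [:: 2] st st',
        dinv G x tp lo hi (absst st' E) X (reals st 2 (code s0 v0)) no_arc,
        qsize (absst st' E) <= qsize (absst st E) + size (nb v0) &
        forall s v, E s v -> reals st' 2 (code s v) = reals st 2 (code s v)]).
Proof.
move=> S Lv T h14 lx E0 I0; have [h0 h4 _ hch] := S.
have WB := W_big HW Mbig; have Ple := P_le_M; have cM := code_lt s0 v0.
have cm := code_mod s0 v0; have vP := vertex_lt v0.
pose m := reals st 2 (code s0 v0).
pose I f st' := exists L, [/\ f = u0 * size L,
    chain (words st 10) (words st 11) (reals st 4) v0 (words st' 15 0) L,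
    {subset L <= nb v0}, treeok st' & same [:: 3; 7; 13; 15] [:: 2] st st'] /\
  [/\ dinv G x tp lo hi (absst st' E) X m (fun s y z => [/\ s = s0, y = v0 & z \in L]),
    qsize (absst st' E) + size L <= qsize (absst st E) + size (nb v0) &
    forall s v, E s v -> reals st' 2 (code s v) = reals st 2 (code s v)].
apply: (@tr_le _ _ _ _ (1 + (u0 * size (nb v0)).+1).+1); last by nlia.
apply: tr_seq; wst 0 (words st 9 v0).
set s1 := State _ _.
have sm1 : same [:: 3; 7; 13; 15] [:: 2] st s1.
  by rewrite /s1; apply: same_wstore => //; exact: same_refl.
apply: tr_conseq (tr_while (I := I) _ _) (leqnn _) _.
- move=> f st' [L [[-> ch sL T' sm] [I1 q1 k1]]] /=.
  have S' : stat st'.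
    have sm0 : same (0 :: [:: 3; 7; 13; 15]) [:: 2] st st' by apply: same_sub sm _ _.
    by apply: (stat_same sm0) => //; rewrite (proj1 sm).
  have Lv' : lvl st' by apply: (lvl_same sm).
  have h14' : words st' 14 0 = code s0 v0 by rewrite (proj1 sm).
  case: L => [|z L] in ch sL I1 q1 *.
    by move: ch => /= e; ev.
  move=> _; exists (5 * D + 20).
  have ch' : chain (words st' 10) (words st' 11) (reals st' 4) v0 (words st' 15 0) (z :: L).
    by apply: chain_ext ch => i; rewrite ?(proj1 sm) ?(proj2 sm).
  apply: tr_conseq (relax_spec E S' Lv' T' h14' ch') (leqnn _) _.
  move=> s2 [t2 sm2 ab ch2]; exists (u0 * size L); split; last by rewrite /= mulnS; lia.
  have vz : adj G v0 z by rewrite nbE sL // mem_head.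
  have mE : m = aK (absst st' E) s0 v0 by rewrite /= k1.
  rewrite mE in I1; have [J1 J2 J3 J4 J5] := dinv_relax HG lx (E0 : aE (absst st' E) s0 v0) vz I1.
  rewrite -ab -mE in J1 J5.
  exists L; split; split => //.
  + by apply: chain_ext ch2 => i; rewrite ?(proj1 sm) ?(proj2 sm).
  + by move=> y yL; apply: sL; rewrite inE yL orbT.
  + by apply: same_trans sm (same_sub sm2 _ _).
  + have qq : qsize (absst s2 E) <= (qsize (absst st' E)).+1.
      rewrite ab /relax; case: ifP => _ //.
      by apply: (@qsize_push _ _ _ _ s0 z).
    by move: q1 => /=; lia.
  + by move=> s v h; rewrite -k1 //; have := J5 s v h.
- exists (nb v0); split; split => //.
  + by apply: dinv_weaken I0 _ => s y z Es yz [e1 e2]; split=> //; rewrite -nbE -e2.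
- move=> st' [f [[L [[_ ch sL T' sm] [I1 q1 k1]]]]] /=.
  case: L => [|z L] in ch sL I1 q1 *; last first.
    by move: ch => /= [b1 _ _ _] b2; exfalso; move: b2; ev; lia.
  move=> _; split=> //; last by move: q1; rewrite /= addn0.
  by apply: dinv_weaken I1 _ => s y z _ _ [].
Qed.

Definition has_edge (o : seq ('I_n * 'I_n * R)) u v :=
  ((u, v) \in map fst o) || ((v, u) \in map fst o).

Definition outrep st (o : seq ('I_n * 'I_n * R)) : Prop :=
  [/\ words st 0 1 = size o,
    forall i d, i < size o -> [/\ words st 1 i = (nth d o i).1.1,
      words st 2 i = (nth d o i).1.2 & reals st 1 i = (nth d o i).2],
    forall u v, (words st 12 (code u v) != 0) = has_edge o u v,
    uniq (map fst o) & 
    forall u v, (u, v) \in map fst o -> (v, u) \notin map fst o].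

Definition emit o u v (r : R) :=
  if ((x u < tp) || (x v < th)) && ((u != v) && ~~ has_edge o u v)
  then rcons o (u, v, r) else o.

Lemma outrep_size st o : outrep st o -> size o <= M.
Proof.
move=> [_ _ _ un _]; rewrite -(size_map fst) -(card_uniqP un).
apply: leq_trans (max_card _) _; rewrite card_prod card_ord PM.
exact: leq_mul.
Qed.

Lemma outrep_same L1 L2 st st' o : same L1 L2 st st' ->
  ~~ has (mem L1) [:: 0; 1; 2; 12] -> 1 \notin L2 -> outrep st o -> outrep st' o.
Proof.
move=> [h1 h2] /hasPn nL n2 [p1 p2 p3 p4 p5].
have W k i : k \in [:: 0; 1; 2; 12] -> words st' k i = words st k i.
  by move=> hk; rewrite h1 // (nL _ hk).
split=> //; first by rewrite W.
- by move=> i d /p2; rewrite !W // h2.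
- by move=> u v; rewrite W.
Qed.

Lemma emit_spec st o s0 v0 : stat st -> lvl st -> words st 14 0 = code s0 v0 ->
  outrep st o ->
  tr c_emit st 13 (fun st' =>
    [/\ outrep st' (emit o s0 v0 (reals st 2 (code s0 v0))),
       same [:: 0; 1; 2; 12] [:: 1] st st' & words st' 0 0 = words st 0 0]).
Proof.
move=> [h0 h4 hx _] [l1 l2 l3] h14 O; have oM := outrep_size O.
have WB := W_big HW Mbig; have Ple := P_le_M; have cM := code_lt s0 v0; have cM' := code_lt v0 s0.
have cm := code_mod s0 v0; have cd := code_div s0 v0.
have vP := vertex_lt v0; have sP := vertex_lt s0.
have hxs := hx s0; have hxv := hx v0; have [p1 p2 p3 p4 p5] := O.
have c2 : v0 * P + s0 = code v0 s0 by [].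
have b12 : (words st 12 (code s0 v0) == 0) = ~~ has_edge o s0 v0.
  by rewrite -p3 negbK.
have condE : eval_b w st (BAnd (bor (BWLt (WLoad 6 eS) (V 17)) (BWLt (WLoad 6 eV) (V 16)))
            (BAnd (BNot (BWEq eS eV)) (BWEq (WLoad 12 (V 14)) (WConst 0)))) =
   ((x s0 < tp) || (x v0 < th)) && ((s0 != v0) && ~~ has_edge o s0 v0).
  by ev; rewrite b12 negb_and !negbK.
apply: (@tr_le _ _ _ _ (maxn (1 + (1 + (1 + (1 + (1 + 1).+1).+1).+1).+1).+1 1).+1) => //.
apply: tr_if; rewrite condE /emit => hc; last first.
  by rewrite (negbTE hc); apply: tr_skip; split=> //; exact: same_refl.
rewrite hc; case/and3P: hc => _ sv nh.
apply: tr_seq; wst (code s0 v0) 1.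
apply: tr_seq; wst (code v0 s0) 1.
apply: tr_seq; wst (size o) s0.
apply: tr_seq; wst (size o) v0.
apply: tr_seq; rst (size o) (reals st 2 (code s0 v0)).
wst 1 (size o).+1.
split.
- rewrite /upd /=; split=> //=; first by rewrite size_rcons.
  + move=> i d; rewrite size_rcons ltnS leq_eqVlt => io.
    rewrite nth_rcons /upd /=; case: (eqVneq i (size o)) io => [-> _|ne /= io].
      by rewrite ltnn.
    by rewrite io; apply: p2.
  + move=> u v; rewrite /has_edge map_rcons !mem_rcons !inE !xpair_eqE !code_eq.
    rewrite orbACA -[(_ \in _) || _]/(has_edge o u v) -p3.
    case: (eqVneq u v0) => /= _; case: (eqVneq v s0) => /= _;
    case: (eqVneq u s0) => /= _; case: (eqVneq v v0) => /= _; rewrite ?orbT //.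
  + rewrite map_rcons rcons_uniq p4 andbT.
    by apply: contra nh; rewrite /has_edge => ->.
  + move: nh; rewrite /has_edge negb_or => /andP[n1 n2] u v.
    rewrite map_rcons !mem_rcons !inE !xpair_eqE negb_or => /orP[/andP[/eqP-> /eqP->]|h].
      by rewrite n2 andbT eq_sym negb_and sv.
    rewrite p5 // andbT; apply/negP => /andP[/eqP e /eqP e'].
    by rewrite e e' in h; rewrite h in n2.
- apply: same_wstore => //; apply: same_rstore => //.
  by do 4!(apply: same_wstore => //); exact: same_refl.
- by [].
Qed.

Variable o0 : seq ('I_n * 'I_n * R).

Definition outinv a (o : seq ('I_n * 'I_n * R)) : Prop :=
  [/\ forall e, e \in o -> e \in o0 \/
        [/\ aE a e.1.1 e.1.2, e.2 = aK a e.1.1 e.1.2 &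
            (x e.1.1 < tp) || (x e.1.2 < th)],
      forall u v, aE a u v -> u != v -> (x u < tp) || (x v < th) -> has_edge o u v &
      {subset o0 <= o}].

Lemma outinv_expand a o s v : outinv a o -> ~~ aE a s v ->
  outinv (expand x tp a s v) (emit o s v (aK a s v)).
Proof.
move=> [i1 i2 i3] nE; rewrite /emit.
have old e : e \in o -> e \in o0 \/
    [/\ upd2 (aE a) s v true e.1.1 e.1.2, e.2 = aK a e.1.1 e.1.2 &
        (x e.1.1 < tp) || (x e.1.2 < th)].
  by move=> /i1 [|[e1 e2 e3]]; [left|right; split=> //; rewrite /upd2; case: ifP].
case: ifP => hc; split=> //=.
- move=> e; rewrite mem_rcons inE => /orP[/eqP->|/old //].
  by right; rewrite upd2_eq; case/and3P: hc.
- move=> u' v'; rewrite /upd2; case: ifP => [/andP[/eqP-> /eqP->] _ _ _|_ h1 h2 h3].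
    by rewrite /has_edge map_rcons mem_rcons mem_head.
  have := i2 _ _ h1 h2 h3; rewrite /has_edge map_rcons !mem_rcons !inE.
  by case/orP => ->; rewrite ?orbT.
- by move=> e /i3 h; rewrite mem_rcons inE h orbT.
- move=> u' v'; rewrite /upd2; case: ifP => [/andP[/eqP-> /eqP->] _ h1 h2|_]; last exact: i2.
  by move: hc; rewrite h1 h2 /= => /negbT; rewrite negbK.
Qed.

Lemma outinv_ext a a' o : aE a' = aE a ->
  (forall s v, aE a s v -> aK a' s v = aK a s v) -> outinv a o -> outinv a' o.
Proof.
move=> e1 e2 [i1 i2 i3]; split=> //; last by rewrite e1.
move=> e /i1 [|[h1 h2 h3]]; [by left|right; split=> //; first by rewrite e1].
by rewrite e2.
Qed.

Local Notation u1 := (5 * D + 70).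
Definition dset := ([:: 0; 1; 2; 3; 7; 8; 12; 13; 14; 15], [:: 1; 2; 3]).
Local Notation dsame := (same dset.1 dset.2).

Variables (lo hi : nat) (X : 'I_n -> bool).
Hypothesis phase : (lo = 0 /\ hi = tp \/ lo = tp)%N.
(** [mu] bounds the expansions to come, each weighted by the degree plus one, and [Z] is what is
    known about the pivots. Both stay abstract because the two phases of a level are charged
    differently. *)
Variables (mu : ('I_n -> 'I_n -> bool) -> ('I_n -> bool) -> nat)
  (Z : ('I_n -> bool) -> ('I_n -> R) -> Prop).
Hypothesis mu_expand : forall a m s v (a' := expand x tp a s v),
  dinv G x tp lo hi a X m no_arc -> Z (acl a) (apd a) -> aq a s v ->
  ~~ acl a v || (aK a s v < apd a v)%R ->
  mu (aE a') (acl a') + (size (nb v)).+1 <= mu (aE a) (acl a) /\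
  Z (acl a') (apd a').

Definition dstate st E o (m : R) : Prop :=
  [/\ stat st /\ lvl st, treeok st, dinv G x tp lo hi (absst st E) X m no_arc,
     outrep st o /\ outinv (absst st E) o &
     Z (acl (absst st E)) (apd (absst st E))].

Lemma words_same L1 L2 st st' k : same L1 L2 st st' -> k \notin L1 ->
  words st' k = words st k.
Proof. by move=> [h _] hk; apply/funext => i; apply: h. Qed.

Lemma reals_same L1 L2 st st' k : same L1 L2 st st' -> k \notin L2 ->
  reals st' k = reals st k.
Proof. by move=> [_ h] hk; apply/funext => i; apply: h. Qed.

Lemma absst_same L1 L2 st st' E : same L1 L2 st st' -> ~~ has (mem L1) [:: 3; 7; 8] ->
  ~~ has (mem L2) [:: 2; 3] -> absst st' E = absst st E.
Proof.
by move=> sm /hasPn n1 /hasPn n2; rewrite /absst !(words_same sm) ?n1 // !(reals_same sm) ?n2.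
Qed.

Lemma treeok_same L1 L2 st st' : same L1 L2 st st' -> ~~ has (mem L1) [:: 3; 7; 8] ->
  2 \notin L2 -> treeok st -> treeok st'.
Proof.
move=> sm /hasPn n1 n2; rewrite /treeok !(words_same sm) ?n1 //.
by rewrite (reals_same sm).
Qed.

Lemma close_spec st E s0 v0 : stat st -> lvl st -> treeok st ->
  words st 14 0 = code s0 v0 -> aq (absst st E) s0 v0 = false ->
  tr c_close st 4 (fun st' => 
   [/\ absst st' (upd2 E s0 v0 true) = expand x tp (absst st E) s0 v0,
       treeok st' & same [:: 8] [:: 3] st st']).
Proof.
move=> [h0 h4 hx _] [l1 l2 l3] [T [lf sgs]] h14 q0.
have WB := W_big HW Mbig; have Ple := P_le_M; have cM := code_lt s0 v0.
have cm := code_mod s0 v0; have cd := code_div s0 v0.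
have vP := vertex_lt v0; have sP := vertex_lt s0; have hxs := hx s0.
have q1 : upd2 (aq (absst st E)) s0 v0 false = aq (absst st E).
  by apply/funext => s; apply/funext => v; rewrite /upd2; case: ifP => // /andP[/eqP-> /eqP->].
apply: (@tr_le _ _ _ _ (maxn (1 + 1).+1 1).+1) => //.
apply: tr_if; ev => hc.
  apply: tr_seq; wst v0 sg; rst v0 (reals st 2 (code s0 v0)); split.
  - rewrite /expand q1 hc /absst /=; congr AState; apply/funext => v;
      by rewrite /upd /= val_eqE andbT; case: (v =P v0) => // _; rewrite eqxx.
  - split=> //; split=> // i; rewrite /upd /=; case: ifP => _; last exact: sgs.
    by rewrite leqnn; have [] := sgs i.
  - by apply: same_rstore => //; apply: same_wstore => //; exact: same_refl.
apply: tr_skip; split=> //.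
by rewrite /expand q1 (negbTE hc) /absst /=; congr AState; apply/funext => v; rewrite andbF.
Qed.

Lemma live_spec st E o s0 v0 : stat st -> lvl st -> treeok st ->
  words st 14 0 = code s0 v0 -> lo <= x s0 -> ~~ E s0 v0 ->
  let a := absst st E in let a' := expand x tp a s0 v0 in
  aq a s0 v0 = false ->
  dinv G x tp lo hi a' X (aK a s0 v0) (fun s y _ => s = s0 /\ y = v0) ->
  outrep st o -> outinv a o -> Z (acl a') (apd a') ->
  tr (CSeq c_close (CSeq c_emit c_arcs)) st (u0 * size (nb v0) + 26) (fun st' =>
    exists o', [/\ dstate st' (aE a') o' (aK a s0 v0), dsame st st',
      qsize (absst st' (aE a')) <= qsize a + size (nb v0) &
      acl (absst st' (aE a')) = acl a']).
Proof.
move=> S Lv T h14 lx nE a a' q0 I0 O OI HZ.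
apply: (@tr_le _ _ _ _ (4 + (13 + (u0 * size (nb v0) + 5)).+1).+1); last by nlia.
apply: tr_seq; apply: tr_conseq (close_spec S Lv T h14 q0) (leqnn _) _.
move=> s1 [ab1 T1 sm1].
have S1 : stat s1.
  apply: (@stat_same [:: 8] [:: 3] st) => //; last by rewrite (proj1 sm1).
  exact: same_sub sm1 _ _.
have Lv1 : lvl s1 by apply: (lvl_same sm1).
have h14' : words s1 14 0 = code s0 v0 by rewrite (proj1 sm1).
have Or1 : outrep s1 o by apply: (outrep_same sm1).
apply: tr_seq; apply: tr_conseq (emit_spec S1 Lv1 h14' Or1) (leqnn _) _.
move=> s2 [Or2 sm2 h02].
have S2 : stat s2.
  by apply: (@stat_same [:: 1; 2; 12] [:: 1] s1) => //; rewrite h02; case: S1.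
have Lv2 : lvl s2 by apply: (lvl_same sm2).
have T2 : treeok s2 by apply: (treeok_same sm2).
have ab2 : absst s2 (aE a') = a' by rewrite (absst_same _ sm2).
have h14'' : words s2 14 0 = code s0 v0 by rewrite (proj1 sm2).
have k2 : reals s2 2 = reals st 2 by rewrite (reals_same sm2) // (reals_same sm1).
have E0 : aE a' s0 v0 by rewrite /= upd2_eq.
have I2 : dinv G x tp lo hi (absst s2 (aE a')) X (reals s2 2 (code s0 v0))
    (fun s y _ => s = s0 /\ y = v0) by rewrite ab2 k2.
apply: tr_conseq (arcs_spec S2 Lv2 T2 h14'' lx E0 I2) (leqnn _) _.
move=> s3 [T3 sm3 I3 q3 k3].
rewrite k2 in I3 k3; rewrite (reals_same sm1) // in Or2.
have sm03 : dsame st s3.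
  apply: same_trans (same_sub sm3 _ _) => //.
  by apply: same_trans (same_sub sm2 _ _) => //; apply: same_sub sm1 _ _.
have c3 : acl (absst s3 (aE a')) = acl a' by rewrite -ab2 /= (words_same sm3).
have d3 : apd (absst s3 (aE a')) = apd a' by rewrite -ab2 /= (reals_same sm3).
exists (emit o s0 v0 (aK a s0 v0)); split=> //; last by move: q3; rewrite ab2 /qsize /=; 
  rewrite (_ : upd2 _ _ _ _ = aq a) //; apply/funext => s; apply/funext => v;
  rewrite /upd2; case: ifP => // /andP[/eqP-> /eqP->].
split=> //.
- split; last by apply: (lvl_same sm3).
  apply: (@stat_same [:: 3; 7; 13; 15] [:: 2] s2) => //.
    exact: same_sub sm3 _ _.
  by rewrite (proj1 sm3).
- split; first by apply: outrep_same sm3 _ _ Or2.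
  by apply: outinv_ext (outinv_expand OI nE).
- by rewrite c3 d3.
Qed.

Lemma expand_pop a s v : expand x tp (pop a s v) s v = expand x tp a s v.
Proof.
rewrite /expand /=; congr AState; apply/funext => s'; apply/funext => v'.
by rewrite /upd2; case: ifP => // ->.
Qed.

Lemma queue_empty st : treeok st -> words st 3 1 = 0 ->
  forall c, c < M -> words st 3 (M + c) = 0.
Proof.
move=> [[T _] _] h c cM; apply/eqP; apply: contraT => /eqP hc.
by have [|] := tournament_root T _ hc; first nlia; rewrite h.
Qed.

(** Potential argument with the queue size plus twice [mu]. A discard removes one pair from the
    queue. An expansion at [v] may queue [size (nb v)] pairs but lowers [mu] by at least
    [(size (nb v)).+1]; the factor 2 pays both for the later pops of these pairs and for the arcs
    relaxed now. *)
Lemma dijkstra_spec st E o m : dstate st E o m ->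
  let a := absst st E in
  tr c_dijkstra st (u1 * (qsize a + 2 * mu (aE a) (acl a))).+1 (fun st' =>
    exists E' o' m', [/\ dstate st' E' o' m', dsame st st' &
      forall c, c < M -> words st' 3 (M + c) = 0]).
Proof.
move=> d0 a; have WB := W_big HW Mbig; have Ple := P_le_M.
pose I f st' := exists E' o' m', [/\ dstate st' E' o' m', dsame st st' & 
   f = u1 * (qsize (absst st' E') + 2 * mu E' (acl (absst st' E')))].
apply: tr_conseq (tr_while (I := I) _ _) (leqnn _) _; last first.
- move=> st' [f [[E' [ o' [m' [d' sm _]]]]]] /=; ev; rewrite negbK => /eqP h1.
  by exists E', o', m'; split=> //; apply: queue_empty => //; case: d'.
- by exists E, o, m; split=> //; exact: same_refl.
move=> f {o m d0} s1 [E1 [ os [m [[[S Lv] T I1 [Or OI] HZ] sm ->]]]]; ev => /eqP h1.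
pose c := (words s1 3 1).-1.
have h1c : words s1 3 1 = c.+1 by rewrite /c prednK // lt0n; apply/eqP.
have [h0 h4 hx _] := S; have [l1 l2 l3] := Lv; have [tT [lf sgs]] := T.
have [|cM] := root_min PM HW MD Mbig tT; first by rewrite h1c.
rewrite h1c /= => tc cmin.
have [s0 [v0 ce]] : exists u v, c = code u v by apply: lf; rewrite ?tc.
have q0 : aq (absst s1 E1) s0 v0 by rewrite /= -ce tc.
have [hk hE lx mk] := i_q I1 q0.
have kmin s v : aq (absst s1 E1) s v ->
    (aK (absst s1 E1) s0 v0 <= aK (absst s1 E1) s v)%R.
  by move=> /eqP h; rewrite /= -ce; apply: cmin => //; apply: code_lt.
have cm := code_mod s0 v0; have vP := vertex_lt v0.
set a1 := absst s1 E1 in I1 HZ OI q0 hk kmin hE mk *.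
pose live := ~~ acl a1 v0 || (aK a1 s0 v0 < apd a1 v0)%R.
exists (if live then 5 * D + 12 + (u0 * size (nb v0) + 26 + 2) else 5 * D + 12 + 3).
have popped st' : words st' 14 0 = c -> tour (words st' 3) (reals st' 2) ->
    (forall i, words st' 3 (M + i) = if i == c then 0 else words s1 3 (M + i)) ->
    same [:: 3; 13; 14] [::] s1 st' ->
    [/\ stat st', lvl st', treeok st' , absst st' E1 = pop a1 s0 v0 & 
        outrep st' os /\ dsame st st'].
  move=> h14 t1 t2 sm'; split.
  - apply: (@stat_same [:: 3; 13; 14] [::] s1) => //; first exact: same_sub sm' _ _.
    by rewrite (proj1 sm').
  - exact: lvl_same sm' _ _.
  - split=> //; split=> [c' cM'|i]; last by rewrite !(words_same sm').
    by rewrite t2; case: eqP => // _; apply: lf.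
  - rewrite /a1 /pop /absst /= !(reals_same sm') // (words_same (k := 7) sm') //.
    rewrite (words_same (k := 8) sm') //; congr AState.
    by apply/funext => s; apply/funext => v; rewrite t2 /upd2 ce code_eq; case: ifP.
  - split; first exact: outrep_same sm' _ _ Or.
    by apply: same_trans sm _; apply: same_sub sm' _ _.
apply: (@tr_le _ _ _ _ (5 * D + 12 + (if live then u0 * size (nb v0) + 26 + 1 else 2)).+1); last first.
  by case: (live); lia.
apply: tr_seq; apply: tr_conseq (pop_spec PM HW MD Mbig h4 tT h1c) (leqnn _) _.
move=> s2 [h14 t1 t2 sm2]; have [S2 Lv2 T2 ab2 [Or2 sm02]] := popped s2 h14 t1 t2 sm2.
have bE : eval_b w s2 (BNot (BAnd (BWEq (WLoad 8 eV) (V 20))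
                       (BNot (BRLt eK (RLoad 3 eV))))) = live.
  have h4' : words s2 4 0 = P by case: S2.
  have h20' : words s2 20 0 = sg by case: Lv2.
  rewrite ce in h14.
  ev; rewrite negb_and negbK (words_same sm2) // !(reals_same sm2) //.
have [hl|hl] := boolP live; last first.
  apply: (@tr_le _ _ _ _ (maxn 0 1).+1) => //.
  apply: tr_if; rewrite bE (negbTE hl) // => _; apply: tr_skip.
  move: hl; rewrite /live negb_or negbK -leNgt => /andP[hc hp].
  exists (u1 * (qsize (absst s2 E1) + 2 * mu E1 (acl (absst s2 E1)))); split.
    exists E1, os, m; split=> //; split=> //; rewrite ?ab2 //.
    by apply: (dinv_discard I1).
  rewrite ab2; have := qsize_pop (a' := pop a1 s0 v0) q0 erefl.
  by rewrite /= => <-; nlia.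
have [mu1 Z1] := mu_expand I1 HZ q0 hl.
have I2 := dinv_expand phase I1 q0 kmin hl.
apply: (@tr_le _ _ _ _ (maxn (u0 * size (nb v0) + 26) 0).+1); last first.
  by rewrite maxn0 addn1.
apply: tr_if; rewrite bE hl // => _.
have h14' : words s2 14 0 = code s0 v0 by rewrite h14.
have q2 : aq (absst s2 E1) s0 v0 = false by rewrite ab2 /= upd2_eq.
have := @live_spec s2 E1 os s0 v0 S2 Lv2 T2 h14' lx hE q2.
move=> LS; cbv zeta in LS; rewrite ab2 expand_pop in LS.
have {}LS := LS I2 Or2 OI Z1.
apply: tr_conseq LS (leqnn _) _.
move=> s3 [ o' [d3 sm3 q3 c3]].
set E3 := aE _ in d3 q3 c3.
exists (u1 * (qsize (absst s3 E3) + 2 * mu E3 (acl (absst s3 E3)))); split.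
  exists E3, o', (aK a1 s0 v0); split=> //.
  by apply: same_trans sm02 sm3.
rewrite c3; have := qsize_pop (a' := pop a1 s0 v0) q0 erefl.
move: mu1 q3; rewrite /=; set q1 := qsize _; set q4 := qsize _; set q5 := qsize _.
set m1 := mu _ _; set m2 := mu _ _; clear; nia.
Qed.

End Level.

(** * One level of the hierarchy *)

Definition ei := V 5.

Definition c_scan (lo hi : wexp) : cmd :=
  CSeq (CWStore 5 (WConst 0) (WConst 0))
    (CWhile (BWLt ei (WLoad 0 (WConst 0)))
      (CSeq (CIf (BAnd (BNot (BWLt (WLoad 6 ei) lo)) (BWLt (WLoad 6 ei) hi))
              (CSeq (CWStore 13 (WConst 0)
                       (WBin WAdd eM (WBin WAdd (WBin WMul ei (V 4)) ei)))
                    (c_set (RCast (WConst 0)))) CSkip)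
            (CWStore 5 (WConst 0) (WBin WAdd ei (WConst 1))))).

(** The pivots are searched first, so that all closing distances are known when the other sources of
    the level start. Both phases use the same stamp, so the second one sees the tables left by the
    first. *)
Definition c_level : cmd :=
  CSeq (CIf (BWLt (V 19) (V 16))
          (CWStore 17 (WConst 0) (WBin WDiv (V 16) (V 18)))
          (CWStore 17 (WConst 0) (WConst 0)))
  (CSeq (CWStore 20 (WConst 0) (WBin WAdd (V 20) (WConst 1)))
  (CSeq (c_scan (WConst 0) (V 17))
  (CSeq c_dijkstra
  (CSeq (c_scan (V 17) (V 16))
  (CSeq c_dijkstra
  (CSeq (CWStore 16 (WConst 0) (V 17))
    (CIf (BWLt (WBin WMul (V 18) (V 18)) (V 19))
       (CWStore 18 (WConst 0) (WBin WMul (V 18) (V 18)))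
       (CWStore 18 (WConst 0) (V 19))))))))).

Definition c_levels : cmd := CWhile (BWLt (WConst 0) (V 16)) c_level.

Section LevelCmd.
Variables (R : realType) (n : nat) (G : wgraph R n).
Hypothesis HG : pos_int_weights G.
Variables (w P M D : nat).
Hypothesis PM : M = P * P.
Hypothesis HW : 2 ^ w = M * M.
Hypothesis MD : M = 2 ^ D.
Hypothesis Mbig : 100 <= M.
Hypothesis nP : n <= P.
Variables (x : 'I_n -> nat) (nb : 'I_n -> seq 'I_n).
Hypothesis nbE : forall v z, adj G v z = (z \in nb v).
Implicit Types (st : state R) (s t u v z p : 'I_n) (a : astate R n).
Implicit Types (E : 'I_n -> 'I_n -> bool).
Local Notation tr := (@tr R w).
Local Notation stat := (stat G P M x nb).
Local Notation treeok := (treeok n P M).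
Local Notation absst := (absst P M).
Local Notation outrep := (outrep P).
Local Notation dinv := (dinv G x).
Local Notation u1 := (5 * D + 70).

Definition scanned (lo hi k : nat) : 'I_n -> bool :=
  fun s => (x s < lo) || [&& s < k, lo <= x s & x s < hi].

Lemma scan_spec th tp sg lo hi elo ehi st E :
  (forall st, lvl th tp sg st -> eval_w w st elo = lo /\ eval_w w st ehi = hi) ->
  lo <= hi ->
  stat st -> lvl th tp sg st -> treeok sg st ->
  dinv tp lo hi (absst sg st E) (fun s => x s < lo) 0%R no_arc ->
  (forall t y, E t y -> x t < lo) ->
  tr (c_scan elo ehi) st (u1 * n + 5) (fun st' =>
    [/\ treeok sg st', same [:: 3; 5; 7; 13] [:: 2] st st',
        dinv tp lo hi (absst sg st' E) (fun s => x s < hi) 0%R no_arc,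
        qsize (absst sg st' E) <= qsize (absst sg st E) + n &
        forall t y, E t y -> aK (absst sg st' E) t y = aK (absst sg st E) t y]).
Proof.
move=> Hev lohi S Lv T I0 HE; have WB := W_big HW Mbig.
have Ple := P_le_M PM Mbig.
pose I f st' := exists k, [/\ k <= n, f = u1 * (n - k), words st' 5 0 = k,
    treeok sg st' & same [:: 3; 5; 7; 13] [:: 2] st st'] /\
   (dinv tp lo hi (absst sg st' E) (scanned lo hi k) 0%R no_arc /\
    qsize (absst sg st' E) <= qsize (absst sg st E) + k /\
    forall t y, E t y -> aK (absst sg st' E) t y = aK (absst sg st E) t y).
apply: (@tr_le _ _ _ _ (1 + (u1 * n).+1).+1); last by nlia.
apply: tr_seq; wst 0 0; set s1 := State _ _.
have sm1 : same [:: 3; 5; 7; 13] [:: 2] st s1.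
  by rewrite /s1; apply: same_wstore => //; exact: same_refl.
have stat' st' : same [:: 3; 5; 7; 13] [:: 2] st st' -> stat st' /\ lvl th tp sg st'.
  move=> sm; split; last exact: (lvl_same sm).
  apply: (@stat_same _ _ _ _ _ _ _ [:: 3; 5; 7; 13] [:: 2] st) => //.
    exact: same_sub sm _ _.
  by rewrite (proj1 sm).
apply: tr_conseq (tr_while (I := I) _ _) (leqnn _) _.
- move=> f st' [k [[kn -> h5 T' sm] [I1 [q1 k1]]]].
  have [[h0 h4 hx _] Lv'] := stat' _ sm; have [_ _ l3] := Lv'.
  have [e1 e2] := Hev _ Lv'.
  rewrite /= !mod0n h0 h5 => kn'; pose s0 := Ordinal kn'.
  have hxk : words st' 6 k = x s0 by have := hx s0.
  have cM := code_lt PM HW MD Mbig nP s0 s0.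
  have cE : code P s0 s0 = k * P + k by [].
  have E1 : eval_b w st' (BAnd (BNot (BWLt (WLoad 6 ei) elo)) (BWLt (WLoad 6 ei) ehi)) =
    (lo <= x s0 < hi).
    by rewrite /= !mod0n h5 hxk e1 e2 -leqNgt.
  have kP : k < P by apply: leq_trans kn' nP.
  have scE s : scanned lo hi k.+1 s = scanned lo hi k s || ((s == s0) && (lo <= x s0 < hi)).
    have -> : scanned lo hi k.+1 s = (x s < lo) ||
        ((s == s0) || (s < k)) && (lo <= x s < hi).
      by rewrite /scanned -val_eqE /= ltnS (leq_eqVlt s k).
    rewrite /scanned -orbA; congr orb.
    by case: (eqVneq s s0) => [->|ne] /=; rewrite ?ltnn // orbF.
  exists (maxn (1 + (5 * D + 12)).+1 1 + 2).+2.
  apply: (@tr_le _ _ _ _ ((maxn (1 + (5 * D + 12)).+1 1).+1 + 1).+1); last by nlia.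
  apply: tr_seq; apply: tr_if; rewrite E1 => hc; last first.
    apply: tr_skip; wst 0 k.+1.
    exists (u1 * (n - k.+1)); split; last by rewrite -(subnSK kn') mulnS; nlia.
    exists k.+1; split; split=> //.
    - by apply: same_wstore.
    - rewrite (_ : scanned lo hi k.+1 = scanned lo hi k) //.
      by apply/funext => s; rewrite scE (negbTE hc) andbF orbF.
    - by split=> //; apply: leq_trans q1 _; rewrite leq_add2l.
  apply: tr_seq; wst 0 (M + code P s0 s0).
  set s2 := State _ _.
  have T2 : treeok sg s2 by [].
  have h0' : eval_r w s2 (RCast (WConst 0)) = 0%R :> R by rewrite /= mod0n.
  apply: tr_conseq (@set_abs _ _ _ _ _ _ PM HW MD Mbig nP sg s2 E s0 s0 _ 0%R _ _ _ T2 h0') (leqnn _) _ => //.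
  move=> s3 [T3 sm3 ab3].
  have h53 : words s3 5 0 = k by rewrite (proj1 sm3).
  wst 0 k.+1.
  have sm03 : same [:: 3; 5; 7; 13] [:: 2] st s3.
    apply: same_trans (same_sub sm3 _ _) => //.
    by rewrite /s2; apply: same_wstore.
  exists (u1 * (n - k.+1)); split; last by rewrite -(subnSK kn') mulnS; nlia.
  exists k.+1; split; split=> //.
  - by apply: same_wstore.
  - change (dinv tp lo hi (absst sg s3 E) (scanned lo hi k.+1) 0%R no_arc).
    have nX : ~~ scanned lo hi k s0.
      by rewrite /scanned ltnn /= orbF -leqNgt; case/andP: hc.
    have := dinv_push_source I1 HE nX hc.
    rewrite ab3 /push_source /=; congr (dinv _ _ _ _ _ _ _).
    by apply/funext => s; rewrite scE hc andbT.
  - change (qsize (absst sg s3 E) <= qsize (absst sg st E) + k.+1 /\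
      forall t y, E t y -> aK (absst sg s3 E) t y = aK (absst sg st E) t y).
    split; last first.
      move=> t y Et; rewrite -k1 // ab3 /= /upd2; case: ifP => // /andP[/eqP et _].
      by have := HE _ _ Et; rewrite et ltnNge; case/andP: hc => ->.
    have := @qsize_push _ _ (absst sg st' E) (absst sg s3 E) s0 s0.
    by rewrite ab3 => /(_ erefl); move: q1; clear; lia.
- exists 0; rewrite subn0; split; split=> //; last by rewrite addn0; split.
  rewrite (_ : scanned lo hi 0 = fun s => x s < lo) //.
  by apply/funext => s; rewrite /scanned orbF.
- move=> st' [f [[k [[kn _ h5 T' sm] [I1 [q1 k1]]]]]].
  have [[h0 _ _ _] _] := stat' _ sm.
  rewrite /= !mod0n h0 h5 -leqNgt => nk; have kE : k = n by lia.
  rewrite kE in I1 q1; split=> //.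
  rewrite (_ : (fun s => x s < hi) = scanned lo hi n) //.
  apply/funext => s; rewrite /scanned ltn_ord /=.
  by case: (ltnP (x s) lo) => //= h; apply: leq_trans lohi.
Qed.

(** Membership of [s] in the bunch of [v], expressed by the keys alone and not by the run, so that
    it can be averaged over the keys. *)
Definition allowed (th tp : nat) s v : bool :=
  [&& tp <= x s, x s < th & [forall p, (x p < tp) ==> (dist G s v < dist G p v)%E]].

Definition work (th tp : nat) : nat :=
  \sum_(q : 'I_n * 'I_n | allowed th tp q.1 q.2) (size (nb q.2)).+1.

Definition deg_sum : nat := \sum_(v : 'I_n) (size (nb v)).+1.

(** In the pivot phase an expansion closes its vertex for good. In the second phase, measured by
    [mu2], only allowed pairs are expanded, each of them once. *)
Definition mu1 (E : 'I_n -> 'I_n -> bool) (cl : 'I_n -> bool) : nat :=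
  \sum_(v | ~~ cl v) (size (nb v)).+1.

Definition mu2 (th tp : nat) (E : 'I_n -> 'I_n -> bool) (cl : 'I_n -> bool) : nat :=
  \sum_(q : 'I_n * 'I_n | allowed th tp q.1 q.2 && ~~ E q.1 q.2) (size (nb q.2)).+1.

Definition pivots_known (tp : nat) (cl : 'I_n -> bool) (pd : 'I_n -> R) : Prop :=
  forall p v l, x p < tp -> walk G p v l -> cl v /\ (pd v <= l)%R.

Lemma mu1_expand tp a m s v (a' := expand x tp a s v) :
  dinv tp 0 tp a (fun s => x s < tp) m no_arc -> True -> aq a s v ->
  ~~ acl a v || (aK a s v < apd a v)%R ->
  mu1 (aE a') (acl a') + (size (nb v)).+1 <= mu1 (aE a) (acl a) /\ True.
Proof.
move=> I0 _ q0 lv; split=> //.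
have [hk _ _ _] := i_q I0 q0; have [xs _] := i_k I0 hk.
have [nc _] := live_open (or_introl (conj erefl erefl)) I0 q0 lv xs.
rewrite /mu1 [leqRHS](bigD1 v) //= addnC leq_add2l; apply: eq_leq; apply: eq_bigl => u.
by rewrite /a' /= xs andbT; case: (eqVneq u v) => //=; rewrite ?andbF ?andbT.
Qed.

Lemma expanded_allowed th tp a m s v : dinv tp tp th a (fun s => x s < th) m no_arc ->
  pivots_known tp (acl a) (apd a) -> akd a s v -> tp <= x s ->
  (acl a v -> (aK a s v < apd a v)%R) -> allowed th tp s v.
Proof.
move=> I0 HZ hk xs lv; have [xh ww] := i_k I0 hk.
apply/and3P; split=> //; apply/forallP => p; apply/implyP => xp.
have [_ d1 d2] := rdist_spec HG ww.
have [[l wp]|nw] := pselect (exists l, walk G p v l); last first.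
  by rewrite (@dist_no_walk _ _ _ p) ?d2 ?ltry // => l h; apply: nw; exists l.
have [wd _ ->] := rdist_spec HG wp; have [c pl] := HZ _ _ _ xp wd.
by rewrite d2 lte_fin; apply: le_lt_trans d1 _; apply: lt_le_trans pl; apply: lv.
Qed.

Lemma mu2_expand th tp a m s v (a' := expand x tp a s v) :
  dinv tp tp th a (fun s => x s < th) m no_arc ->
  pivots_known tp (acl a) (apd a) -> aq a s v ->
  ~~ acl a v || (aK a s v < apd a v)%R ->
  mu2 th tp (aE a') (acl a') + (size (nb v)).+1 <= mu2 th tp (aE a) (acl a) /\
  pivots_known tp (acl a') (apd a').
Proof.
move=> I0 HZ q0 lv; have [hk nE xs _] := i_q I0 q0.
have al : allowed th tp s v.
  by apply: (expanded_allowed I0 HZ hk xs) => c; case/orP: lv => //; rewrite c.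
have ns : (x s < tp) = false by apply/negbTE; rewrite -leqNgt.
split; last by move=> p u l h1 h2; rewrite /= ns !andbF; apply: (HZ p u l).
rewrite /mu2 [leqRHS](bigD1 (s, v)) /=; last by rewrite al nE.
rewrite addnC leq_add2l; apply: eq_leq; apply: eq_bigl => -[s' v'] /=.
rewrite /upd2 xpair_eqE; case: ifP => _; rewrite ?andbF ?andbT //=.
Qed.

Lemma dinv_init tp hi a : (forall s v, ~~ aq a s v) -> (forall s v, ~~ akd a s v) ->
  (forall s v, ~~ aE a s v) -> (forall v, ~~ acl a v) ->
  dinv tp 0 hi a (fun s => x s < 0) 0%R no_arc.
Proof.
move=> h1 h2 h3 h4; split=> //.
- by move=> s v; rewrite (negbTE (h1 _ _)).
- by move=> s v; rewrite (negbTE (h2 _ _)).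
- by move=> s v; rewrite (negbTE (h3 _ _)).
- by move=> s y z; rewrite (negbTE (h3 _ _)).
- by move=> s v; rewrite (negbTE (h2 _ _)).
- by move=> v; rewrite (negbTE (h4 _)).
- by move=> p v; rewrite (negbTE (h3 _ _)).
- by move=> p p' v; rewrite (negbTE (h3 _ _)).
- by move=> s v; rewrite (negbTE (h3 _ _)).
Qed.

(** After the pivot phase all started sources lie below the new [lo], so the clause on the order of
    expansion becomes void and [m] may restart at 0. *)
Lemma dinv_next_phase th tp a m : tp <= th -> (forall s v, ~~ aq a s v) ->
  dinv tp 0 tp a (fun s => x s < tp) m no_arc ->
  dinv tp tp th a (fun s => x s < tp) 0%R no_arc.
Proof.
move=> tt h1 [i1 i2 i3 i4 i5 i6 i7 i8 i9 i10]; split=> //.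
- by move=> s v; rewrite (negbTE (h1 _ _)).
- by move=> s /i2[h2 h3 h4]; split=> //; apply: leq_trans tt.
- move=> s v h; have [h2 _] := i4 _ _ h; split=> // ts.
  by have [xs _] := i3 _ _ h2; rewrite ltnNge ts in xs.
Qed.

Definition oexact (o : seq ('I_n * 'I_n * R)) : Prop := forall e, e \in o ->
  walk G e.1.1 e.1.2 e.2 /\ e.2 = rdist G e.1.1 e.1.2.

Definition new_edges (th tp : nat) : nat :=
  #|[set q : 'I_n * 'I_n | [&& allowed th tp q.1 q.2, x q.2 < th & q.1 != q.2]]|%SET.

Definition level_ok (th tp : nat) (o o' : seq ('I_n * 'I_n * R)) : Prop :=
  [/\ {subset o <= o'}, size o' <= size o + n + new_edges th tp,
    forall p v l, x p < tp -> walk G p v l -> exists p',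
      [/\ x p' < tp, walk G p' v (rdist G p' v), (rdist G p' v <= l)%R &
          p' = v \/ has_edge o' p' v] &
    forall s v l, x s < th -> x v < th -> walk G s v l ->
      [\/ s = v, has_edge o' s v |
       exists p l', [/\ x p < tp, walk G p v l' & (l' <= l)%R]]].

Lemma level_end th tp a m o o' : dinv tp tp th a (fun s => x s < th) m no_arc ->
  tp <= th -> (forall s v, ~~ aq a s v) -> pivots_known tp (acl a) (apd a) ->
  outinv x th tp o a o' -> uniq (map fst o') ->
  (forall u v, (u, v) \in map fst o' -> (v, u) \notin map fst o') ->
  oexact o -> oexact o' /\ level_ok th tp o o'.
Proof.
move=> I0 tt q0 HZ [oi1 oi2 oi3] un asym ox.
have EX := dinv_exact HG I0 q0.
have irr u : (u, u) \notin map fst o'.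
  by apply/negP => h; have := asym _ _ h; rewrite h.
split.
  by move=> e /oi1 [/ox //|[h1 h2 _]]; rewrite h2; apply: EX.
split=> //.
- rewrite -(size_map fst o') -(card_uniqP un) -(size_map fst o).
  (* By [i_uniq] a pair expanded for a pivot is determined by its vertex, which leaves at most [n]
     such pairs. *)
  pose A := [set q : 'I_n * 'I_n | aE a q.1 q.2 && (x q.1 < tp)]%SET.
  have An : #|A| <= n.
    have inj : {in A &, injective (@snd 'I_n 'I_n)}.
      move=> [u v] [u' v']; rewrite !inE /= => /andP[e1 x1] /andP[e2 x2] vv.
      by rewrite vv in e1 *; rewrite (i_uniq I0 e1 e2 x1 x2).
    by rewrite -(card_in_imset inj); apply: leq_trans (max_card _) _; rewrite card_ord.
  pose B := [set q : 'I_n * 'I_n | [&& allowed th tp q.1 q.2, x q.2 < th & q.1 != q.2]]%SET.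
  pose C := [set q in map fst o]%SET.
  have Co : #|C| <= size (map fst o) by rewrite cardsE; exact: card_size.
  apply: leq_trans (_ : #|(C :|: A :|: B)%SET| <= _).
    apply: subset_leq_card; apply/fintype.subsetP => q ql; rewrite !inE.
    have /mapP [e eo qe] := ql.
    have [e0|[E1 _ xx]] := oi1 _ eo; first by rewrite qe (map_f fst e0).
    rewrite qe E1 /=; case: (ltnP (x e.1.1) tp) => xt; first by rewrite orbT.
    rewrite ltnNge xt /= in xx; apply/orP; right; apply/and3P; split=> //.
      by apply: (expanded_allowed I0 HZ (proj1 (i_E I0 E1)) xt); exact: (i_str I0 E1 xt).
    by apply/eqP => ee; have := irr e.1.1; rewrite {2}ee -surjective_pairing -qe ql.
  have := cardsU C A; have := cardsU (C :|: A)%SET B.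
  rewrite /new_edges -/B; move: Co An; clear; lia.
- move=> p v l xp wp; have [c pl] := HZ _ _ _ xp wp.
  have [p' [x1 E1 K1]] := i_cl I0 c; have [w1 k1] := EX _ _ E1.
  exists p'; rewrite -k1 K1; split=> //; first by rewrite -K1.
  have [->|ne] := eqVneq p' v; [by left|right].
  by apply: oi2 => //; rewrite x1.
- move=> s v l xs xv ws.
  have [->|ne] := eqVneq s v; first by constructor 1.
  have [[E1 K1]|[c pl]] := dinv_complete I0 q0 xs ws.
    by constructor 2; apply: oi2 => //; rewrite xv orbT.
  have [p' [x1 E1 K1]] := i_cl I0 c; have [w1 k1] := EX _ _ E1.
  by constructor 3; exists p', (aK a p' v); rewrite K1; split=> //; rewrite -K1.
Qed.

Definition next_th (Rr th f : nat) : nat := if Rr < th then th %/ f else 0.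
Definition next_f (Rr f : nat) : nat := if f * f < Rr then f * f else Rr.

Definition lst st (th f Rr sg : nat) (o : seq ('I_n * 'I_n * R)) : Prop :=
  [/\ stat st, treeok sg st, outrep st o & 
      forall c, c < M -> words st 3 (M + c) = 0] /\
  [/\ words st 16 0 = th, words st 18 0 = f, words st 19 0 = Rr & words st 20 0 = sg].

Definition level_cost (th tp : nat) : nat :=
  u1 * (4 * n + 2 * deg_sum + 2 * work th tp + 2).

Lemma qsize_le a k : (forall s v, ~~ aq a s v) -> qsize a + k = k.
Proof.
move=> h; rewrite /qsize (_ : [set p | _ ]%SET = finset.set0) ?cards0 //.
by apply/setP => q; rewrite !inE (negbTE (h _ _)).
Qed.

Lemma level_spec st th f Rr sg o (tp := next_th Rr th f) :
  lst st th f Rr sg o -> oexact o -> th <= P -> 0 < f <= Rr -> Rr <= P -> sg < P ->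
  tr c_level st (level_cost th tp) (fun st' => exists o',
    [/\ lst st' tp (next_f Rr f) Rr sg.+1 o', oexact o' & level_ok th tp o o']).
Proof.
move=> [[S T Or QE] [h16 h18 h19 h20]] ox thP fR RP sP.
have WB := W_big HW Mbig; have Ple := P_le_M PM Mbig.
have tt : tp <= th by rewrite /tp /next_th; case: ifP => // _; apply: leq_div.
have tP : tp <= P by apply: leq_trans thP.
have ff : f * f <= M by rewrite PM; apply: leq_mul; nlia.
apply: (@tr_le _ _ _ _ ((maxn 1 1).+1 + (1 + ((u1 * n + 5) +
  ((u1 * (n + 2 * deg_sum)).+1 + ((u1 * n + 5) +
   ((u1 * (n + 2 * work th tp)).+1 + (1 + (maxn 1 1).+1).+1).+1).+1).+1).+1).+1).+1);
  last first.
  by rewrite /level_cost; move: deg_sum (work th tp) => d1 d2; clear; nia.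
pose s1 := State (upd (words st) 17 0 tp) (reals st).
have step1 : tr (CIf (BWLt (V 19) (V 16))
          (CWStore 17 (WConst 0) (WBin WDiv (V 16) (V 18)))
          (CWStore 17 (WConst 0) (WConst 0))) st (maxn 1 1).+1 (fun st' => st' = s1).
  apply: tr_if; ev => hc; apply: (@tr_ws _ _ _ _ _ _ 0 tp).
  - by ev.
  - by ev; rewrite /tp /next_th hc // mW //; move: tt; rewrite /tp /next_th hc; nlia.
  - by [].
  - by ev.
  - by ev; rewrite /tp /next_th (negbTE hc).
  - by [].
apply: tr_seq; apply: tr_conseq step1 (leqnn _) _ => _ ->.
apply: tr_seq; rewrite /s1; wst 0 sg.+1.
set s2 := State _ _.
have sm2 : same [:: 17; 20] [::] st s2.
  by rewrite /s2; do 2!(apply: same_wstore => //); exact: same_refl.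
have S2 : stat s2.
  apply: (@stat_same _ _ _ _ _ _ _ [:: 17; 20] [::] st) => //.
  exact: same_sub sm2 _ _.
have Lv2 : lvl th tp sg.+1 s2 by [].
have T2 : treeok sg.+1 s2.
  have [t1 [t2 t3]] := T; split=> //; split=> // i.
  by have [a1 a2] := t3 i; split; apply: leq_trans (leqnSn _).
have Or2 : outrep s2 o by apply: outrep_same sm2 _ _ Or.
pose E0 : 'I_n -> 'I_n -> bool := fun _ _ => false.
(* No stamp exceeds [sg], so nothing is set with respect to [sg.+1]. *)
have F2 : forall s v, [/\ ~~ aq (absst sg.+1 s2 E0) s v,
    ~~ akd (absst sg.+1 s2 E0) s v &
    ~~ acl (absst sg.+1 s2 E0) v].
  move=> s v; rewrite /= /upd /=; have [_ [_ t3]] := T; split.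
  - by rewrite QE //; apply: code_lt PM HW MD Mbig nP _ _.
  - by have [a1 _] := t3 (code P s v); rewrite neq_ltn ltnS a1.
  - by have [_ a1] := t3 v; rewrite neq_ltn ltnS a1.
have I2 : dinv tp 0 tp (absst sg.+1 s2 E0) (fun s => x s < 0) 0%R no_arc.
  by apply: dinv_init => // [s v|s v|v];
    [have [] := F2 s v|have [] := F2 s v|have [] := F2 v v].
have qs2 : forall k, qsize (absst sg.+1 s2 E0) + k = k.
  by move=> k; apply: qsize_le => s v; have [] := F2 s v.
have ev1 : forall st, lvl th tp sg.+1 st ->
    eval_w w st (WConst 0) = 0 /\ eval_w w st (V 17) = tp.
  by move=> st' [_ e _]; rewrite /= !mod0n.
have ev2 : forall st, lvl th tp sg.+1 st ->
    eval_w w st (V 17) = tp /\ eval_w w st (V 16) = th.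
  by move=> st' [e' e _]; rewrite /= !mod0n.
apply: tr_seq; apply: tr_conseq (scan_spec ev1 (leq0n tp) S2 Lv2 T2 I2 _) (leqnn _) _ => //.
move=> s3 [T3 sm3 I3 q3 _]; rewrite qs2 in q3.
have S3 : stat s3.
  apply: (@stat_same _ _ _ _ _ _ _ [:: 3; 5; 7; 13] [:: 2] s2) => //.
    exact: same_sub sm3 _ _.
  by rewrite (proj1 sm3).
have Lv3 : lvl th tp sg.+1 s3 by apply: (lvl_same sm3).
have Or3 : outrep s3 o by apply: outrep_same sm3 _ _ Or2.
have d3 : dstate G P M x th tp sg.+1 nb o 0 tp (fun s => x s < tp) (fun _ _ => True)
    s3 E0 o 0%R.
  by split=> //; split=> //; split=> // e eo; left.
apply: tr_seq; apply: tr_conseq (dijkstra_spec HG PM HW MD Mbig nP nbE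
  (or_introl (conj erefl erefl)) (@mu1_expand tp) d3) _ _.
  rewrite ltnS leq_mul2l; apply/orP; right; apply: leq_add => //.
  rewrite leq_mul2l /mu1 /deg_sum; apply/orP; right.
  by rewrite [leqRHS](bigID (fun v => ~~ acl (absst sg.+1 s3 E0) v)) leq_addr.
move=> s4 [E4 [ o4 [m4 [[[S4 Lv4] T4 I4 [Or4 OI4] _] sm4 QE4]]]].
have q4 s v : ~~ aq (absst sg.+1 s4 E4) s v.
  by rewrite /= QE4 //; apply: code_lt PM HW MD Mbig nP _ _.
have HE4 t y : E4 t y -> x t < tp.
  by move=> h; have [h1 _] := i_E I4 h; have [] := i_k I4 h1.
have Z4 : pivots_known tp (acl (absst sg.+1 s4 E4)) (apd (absst sg.+1 s4 E4)).
  by move=> p v l xp; apply: (dinv_pivot I4 q4).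
apply: tr_seq; apply: tr_conseq
  (scan_spec ev2 tt S4 Lv4 T4 (dinv_next_phase tt q4 I4) HE4) (leqnn _) _.
move=> s5 [T5 sm5 I5 q5 k5]; rewrite qsize_le // in q5.
have S5 : stat s5.
  apply: (@stat_same _ _ _ _ _ _ _ [:: 3; 5; 7; 13] [:: 2] s4) => //.
    exact: same_sub sm5 _ _.
  by rewrite (proj1 sm5).
have Lv5 : lvl th tp sg.+1 s5 by apply: (lvl_same sm5).
have Or5 : outrep s5 o4 by apply: outrep_same sm5 _ _ Or4.
have d5 : dstate G P M x th tp sg.+1 nb o tp th (fun s => x s < th) (pivots_known tp)
    s5 E4 o4 0%R.
  split=> //; first by split=> //; apply: outinv_ext OI4.
  by rewrite /= (words_same sm5) // (reals_same sm5).
apply: tr_seq; apply: tr_conseq (dijkstra_spec HG PM HW MD Mbig nP nbE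
  (or_intror erefl) (@mu2_expand th tp) d5) _ _.
  rewrite ltnS leq_mul2l; apply/orP; right; apply: leq_add => //.
  rewrite leq_mul2l /mu2 /work; apply/orP; right.
  rewrite [leqRHS](bigID (fun q => ~~ E4 q.1 q.2)) /=.
  by apply: leq_trans (leq_addr _ _); apply: eq_leq; apply: eq_bigl.
move=> s6 [E6 [ o6 [m6 [[[S6 Lv6] T6 I6 [Or6 OI6] Z6] sm6 QE6]]]].
have q6 s v : ~~ aq (absst sg.+1 s6 E6) s v.
  by rewrite /= QE6 //; apply: code_lt PM HW MD Mbig nP _ _.
have [g16 g17 g20] := Lv6.
have g k : k \in [:: 18; 19] -> words s6 k 0 = words st k 0.
  by move=> kk; rewrite (proj1 sm6) ?(proj1 sm5) ?(proj1 sm4) ?(proj1 sm3) ?(proj1 sm2) //;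
    move: kk; rewrite !inE => /orP[] /eqP ->.
have g18 : words s6 18 0 = f by rewrite g.
have g19 : words s6 19 0 = Rr by rewrite g.
have [ox6 ok6] : oexact o6 /\ level_ok th tp o o6.
  by have [_ _ _ un as6] := Or6; apply: (level_end I6 tt q6 Z6 OI6 un as6 ox).
apply: tr_seq; wst 0 tp.
have fin y : y = next_f Rr f ->
    lst (State (upd (upd (words s6) 16 0 tp) 18 0 y) (reals s6)) tp (next_f Rr f) Rr sg.+1 o6.
  move=> ->; set s7 := State _ _.
  have sm7 : same [:: 16; 18] [::] s6 s7.
    apply: (@same_wstore _ _ _ _ (State (upd (words s6) 16 0 tp) (reals s6))) => //.
    by apply: same_wstore => //; exact: same_refl.
  by split=> //; split=> //.
apply: tr_if; ev => hc; apply: (@tr_ws _ _ _ _ _ _ 0 (next_f Rr f)).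
- by ev.
- by ev; rewrite /next_f hc.
- by exists o6; split=> //; apply: fin.
- by ev.
- by ev; rewrite /next_f (negbTE hc).
- by exists o6; split=> //; apply: fin.
Qed.

End LevelCmd.

(** * All levels, and the graph that is output *)

Section Levels.
Variables (R : realType) (n : nat) (G : wgraph R n).
Hypothesis HG : pos_int_weights G.
Variables (P Rr f0 : nat) (x : 'I_n -> nat).
Implicit Types (s u v z p : 'I_n) (o : seq ('I_n * 'I_n * R)).

Fixpoint fq (i : nat) : nat := if i is i'.+1 then next_f Rr (fq i') else f0.
Fixpoint tq (i : nat) : nat := if i is i'.+1 then next_th Rr (tq i') (fq i') else P.

Definition hierarchy_ok (i : nat) o : Prop := forall j, j < i ->
  (forall p v l, x p < tq j.+1 -> walk G p v l -> exists p',
      [/\ x p' < tq j.+1, walk G p' v (rdist G p' v), (rdist G p' v <= l)%R &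
          p' = v \/ has_edge o p' v]) /\
  (forall s v l, x s < tq j -> x v < tq j -> walk G s v l ->
      [\/ s = v, has_edge o s v |
       exists p l', [/\ x p < tq j.+1, walk G p v l' & (l' <= l)%R]]).

Lemma has_edge_sub o o' u v : {subset o <= o'} -> has_edge o u v -> has_edge o' u v.
Proof.
by move=> sub /orP[] /mapP[e eo h]; apply/orP; [left|right]; rewrite h map_f // sub.
Qed.

Lemma hierarchy_step i o o' : hierarchy_ok i o ->
  level_ok G x (tq i) (tq i.+1) o o' -> hierarchy_ok i.+1 o'.
Proof.
move=> ho [sub _ h1 h2] j; rewrite ltnS leq_eqVlt => /orP[/eqP->|ji]; first by [].
have [g1 g2] := ho j ji; split.
  move=> p v l a b; have [p' [b1 b2 b3 b4]] := g1 _ _ _ a b; exists p'; split=> //.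
  by case: b4 => [->|/(has_edge_sub sub)]; [left|right].
move=> s v l a b c; have [e|e|e] := g2 _ _ _ a b c.
- by constructor 1.
- by constructor 2; apply: has_edge_sub e.
- by constructor 3.
Qed.

Hypothesis f0_ge : 2 <= f0.
Hypothesis f0_le : f0 <= Rr.

Lemma fq_bounds i : 2 <= fq i <= Rr.
Proof.
elim: i => [|i IH] /=; first by rewrite f0_ge.
rewrite /next_f; case: (ltnP (fq i * fq i) Rr) => h; last by rewrite leqnn (leq_trans f0_ge).
by rewrite (ltnW h) andbT; case/andP: IH; move: (fq i) => f; clear; nia.
Qed.

Lemma tq_half i : 2 * tq i.+1 <= tq i.
Proof.
rewrite /= /next_th; case: ifP => _ //; have := fq_bounds i; move: (fq i) => f.
case/andP=> h _; apply: leq_trans (leq_trunc_div (tq i) f).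
by rewrite mulnC leq_mul2l h orbT.
Qed.

Lemma tq_le i : tq i * 2 ^ i <= P.
Proof.
elim: i => [|i IH]; first by rewrite muln1.
by rewrite expnS mulnA; apply: leq_trans IH; rewrite leq_mul2r mulnC tq_half orbT.
Qed.

Lemma tq_leP i : tq i <= P.
Proof. by apply: leq_trans (tq_le i); rewrite leq_pmulr // expn_gt0. Qed.

Definition graph_adj o u v : bool := (u != v) && has_edge o u v.

Lemma graph_adj_sym o u v : graph_adj o u v = graph_adj o v u.
Proof. by rewrite /graph_adj eq_sym /has_edge orbC. Qed.

Lemma graph_adj_irr o u : graph_adj o u u = false.
Proof. by rewrite /graph_adj eqxx. Qed.

Lemma rdist_sym u v : rdist G u v = rdist G v u.
Proof.
have [[l w]|nw] := pselect (exists l, walk G u v l); last first.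
  rewrite /rdist !dist_no_walk // => l h; apply: nw; exists l => //.
  exact: walk_sym.
have [w1 l1 _] := rdist_spec HG w; have [w2 l2 _] := rdist_spec HG (walk_sym w1).
have [_ l3 _] := rdist_spec HG (walk_sym w2).
by apply/eqP; rewrite eq_le l3 l2.
Qed.

(** With distances as weights, symmetry comes for free; on the listed edges they are the recorded
    lengths, by [oexact]. *)
Definition graph_of o : wgraph R n :=
  WGraph (graph_adj_sym o) (graph_adj_irr o) rdist_sym.

Lemma graph_of_listing st o : outrep P st o ->
  edge_listing (graph_of o) (map fst o).
Proof.
move=> [_ _ _ un as0]; split=> // u v; rewrite /= /graph_adj.
case: (eqVneq u v) => //= ->; rewrite orbb; apply/esym/negbTE/negP => h.
by have := as0 _ _ h; rewrite h.
Qed.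

Lemma graph_of_outputs st o : outrep P st o -> oexact G o -> outputs st (graph_of o).
Proof.
move=> Or ox; exists (map fst o); first exact: graph_of_listing Or.
have [e1 e2 _ _ _] := Or; rewrite e1 -map_comp.
case: o {Or} => [|d o'] // in ox e1 e2 *; set o := d :: o' in ox e1 e2 *.
apply: (@eq_from_nth _ (0, 0, 0%R)) => [|i]; rewrite size_map size_iota ?size_map // => io.
rewrite (nth_map 0) ?size_iota // nth_iota // (nth_map d) // add0n.
have [-> -> ->] := e2 i d io; rewrite /=.
by have [_ ->] := ox _ (mem_nth d io).
Qed.

Lemma nedges_graph_of st o : outrep P st o -> nedges (graph_of o) <= size o.
Proof.
move=> Or; rewrite -(size_map fst) /nedges.
pose swap (e : 'I_n * 'I_n) := if e.1 < e.2 then e else (e.2, e.1).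
apply: leq_trans (_ : #|[set swap e | e in map fst o]%SET| <= _); last first.
  by apply: leq_trans (leq_imset_card _ _) _; apply: card_size.
apply: subset_leq_card; apply/fintype.subsetP => -[u v]; rewrite inE /=.
case/andP => /andP[_ /orP[h|h]] uv; apply/imsetP.
  by exists (u, v) => //; rewrite /swap /= uv.
by exists (v, u) => //; rewrite /swap /= ltnNge (ltnW uv).
Qed.

Lemma graph_of_hopset k o (J : nat) (eps : R) : hierarchy_ok k.+1 o -> oexact G o ->
  (forall v, x v < P) -> tq k.+1 = 0 ->
  6 <= J -> (0 < eps)%R -> ((8 * k)%:R <= eps * J%:R)%R ->
  is_hopset G (graph_of o) (hopbound J k) eps.
Proof.
move=> ho ox xP tk J6 e0 Je.
have he u v : has_edge o u v -> u <> v -> adj (graph_of o) u v.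
  by move=> h /eqP ne; rewrite /= /graph_adj ne.
apply: (@hopset_of_hierarchy _ _ G (graph_of o) HG (fun i v => x v < tq i) k) => //.
- move=> u v /andP[_ h]; split=> //.
  suff w1 : exists l, walk G u v l by case: w1 => l /(rdist_spec HG)[].
  case/orP: h => /mapP[e eo h]; have [w1 _] := ox _ eo.
    by exists e.2; rewrite -h /= in w1.
  by exists e.2; apply: walk_sym; rewrite -h /= in w1.
- by move=> v; rewrite tk.
- move=> i p v l ik xp ww; have [h1 _] := ho i ik.
  have [p' [b1 b2 b3 b4]] := h1 _ _ _ xp ww; exists p'; split=> //.
  by case: (eqVneq p' v) b4 => [->|ne [?|h]]; [left|left|right; apply: he => //; apply/eqP].
- move=> i s v l ik xs xv ww; have [_ h2] := ho i ik.
  have [e|e|e] := h2 _ _ _ xs xv ww; [by constructor 1| |by constructor 3].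
  by case: (eqVneq s v) => [->|ne]; [constructor 1|constructor 2; apply: he => //; apply/eqP].
Qed.

Variables (w M D : nat).
Hypothesis PM : M = P * P.
Hypothesis HW : 2 ^ w = M * M.
Hypothesis MD : M = 2 ^ D.
Hypothesis Mbig : 100 <= M.
Hypothesis nP : n <= P.
Hypothesis RrP : Rr <= P.
Variable nb : 'I_n -> seq 'I_n.
Hypothesis nbE : forall v z, adj G v z = (z \in nb v).

Definition total_work (k : nat) : nat :=
  \sum_(j < k.+1) level_cost G D x nb (tq j) (tq j.+1).

Definition total_edges (k : nat) : nat :=
  \sum_(j < k.+1) (n + new_edges G x (tq j) (tq j.+1)).

Lemma levels_spec st k : lst G P M x nb st P f0 Rr 0 [::] ->
  (forall i, i <= k -> 0 < tq i) -> tq k.+1 = 0 ->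
  @tr R w c_levels st (total_work k + k.+2) (fun st' => exists o,
    [/\ outrep P st' o, oexact G o, hierarchy_ok k.+1 o & size o <= total_edges k]).
Proof.
move=> L0 tpos tk.
have WB := W_big HW Mbig; have Ple := P_le_M PM Mbig.
pose I f st' := exists i o, [/\ lst G P M x nb st' (tq i) (fq i) Rr i o, oexact G o,
   hierarchy_ok i o, i <= k.+1 & 
   size o <= \sum_(0 <= j < i) (n + new_edges G x (tq j) (tq j.+1)) /\
   f = \sum_(i <= j < k.+1) (level_cost G D x nb (tq j) (tq j.+1)).+1].
apply: (@tr_le _ _ _ _ (\sum_(0 <= j < k.+1) (level_cost G D x nb (tq j) (tq j.+1)).+1).+1);
  last first.
  rewrite /total_work big_mkord.
  under eq_bigr do rewrite -addn1.
  by rewrite big_split /= sum_nat_const card_ord muln1 !addnS ltnSn.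
apply: tr_conseq (tr_while (I := I) _ _) (leqnn _) _.
- move=> f st' [i [ o [L1 ox ho ik [so ->]]]].
  have [_ [h16 _ _ _]] := L1; rewrite /= !mod0n h16 => ti.
  have {}ik : i <= k.
    rewrite leqNgt; apply/negP => ki.
    have e : i = k.+1 by apply/eqP; rewrite eqn_leq ik.
    by rewrite e tk in ti.
  (* Thresholds at least halve, so [2 ^ i <= P] as long as [tq i] is positive; hence the stamps stay
     small. *)
  have sP : i < P.
    have := tq_le i; have := ltn_expl i (isT : 1 < 2); move: ti => /=; clear; nia.
  exists (level_cost G D x nb (tq i) (tq i.+1)).
  have fR : 0 < fq i <= Rr by have /andP[? ->] := fq_bounds i; rewrite andbT; lia.
  apply: tr_conseq (level_spec HG PM HW MD Mbig nP nbE L1 ox (tq_leP i) fR RrP sP) (leqnn _) _.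
  move=> s2 [ o2' [L2 ox2 ok2]].
  exists (\sum_(i.+1 <= j < k.+1) (level_cost G D x nb (tq j) (tq j.+1)).+1).
  split; last by rewrite [leqRHS]big_ltn // addSn.
  exists i.+1, o2'; split=> //; first exact: hierarchy_step ok2.
  split=> //; rewrite big_nat_recr //=; have [_ sz _ _] := ok2.
  by apply: leq_trans sz _; rewrite -addnA leq_add2r.
- exists 0, [::]; split=> //; split=> //; by rewrite big_geq.
- move=> st' [f [[i [ o [L1 ox ho ik [so _]]]]]].
  have [[_ _ Or _] [h16 _ _ _]] := L1; rewrite /= !mod0n h16 -eqn0Ngt => /eqP ti.
  have {ik} e : i = k.+1.
    apply/eqP; rewrite eqn_leq ik ltnNge; apply/negP => ki.
    by have := tpos i ki; rewrite ti.
  by rewrite e in ho so; exists o; split=> //; rewrite /total_edges -(big_mkord xpredT (fun j => n + new_edges G x (tq j) (tq j.+1))).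
Qed.

End Levels.

(** * Preprocessing: the parameters and the adjacency lists *)

Definition c_log : cmd :=
  CSeq (CWStore 4 (WConst 0) (WConst 1))
  (CSeq (CWStore 22 (WConst 0) (WConst 0))
    (CWhile (BWLt (V 4) (WLoad 0 (WConst 0)))
      (CSeq (CWStore 4 (WConst 0) (WBin WMul (WConst 2) (V 4)))
            (CWStore 22 (WConst 0) (WBin WAdd (V 22) (WConst 1)))))).

(* The least power of two [2 ^ j] with [z <= j d], into the cell [k]. *)
Definition c_pow (k : nat) (z d : rexp) : cmd :=
  CSeq (CWStore k (WConst 0) (WConst 1))
  (CSeq (CRStore 5 (WConst 0) (RCast (WConst 0)))
    (CWhile (BRLt (RLoad 5 (WConst 0)) z)
      (CSeq (CRStore 5 (WConst 0) (RBin RAdd (RLoad 5 (WConst 0)) d))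
            (CWStore k (WConst 0) (WBin WMul (WConst 2) (V k)))))).

(** With [L] the binary logarithm of [n] rounded up, the exponents are the ceilings of [L / kappa]
    and [rho * L]. As reals cannot be rounded to words, they are found by adding up multiples; [L]
    rounds suffice because [1 <= kappa] and [rho <= 1]. *)
Definition c_init : cmd :=
  CSeq c_log
  (CSeq (c_pow 18 (RCast (V 22)) (RLoad 0 (WConst 0)))
        (c_pow 19 (RBin RMul (RLoad 0 (WConst 1)) (RCast (V 22))) (RCast (WConst 1)))).

Definition c_arc (a fr to : wexp) : cmd :=
  CSeq (CWStore 10 a (WLoad 9 fr))
  (CSeq (CWStore 9 fr (WBin WAdd a (WConst 1)))
  (CSeq (CWStore 11 a to) (CRStore 4 a (RLoad 1 ei)))).

Definition e2i := WBin WMul (WConst 2) ei.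

Definition c_adj : cmd :=
  CSeq (CWStore 5 (WConst 0) (WConst 0))
  (CSeq (CWhile (BWLt ei cnt)
          (CSeq (c_arc e2i (WLoad 1 ei) (WLoad 2 ei))
          (CSeq (c_arc (WBin WAdd e2i (WConst 1)) (WLoad 2 ei) (WLoad 1 ei))
                (CWStore 5 (WConst 0) (WBin WAdd ei (WConst 1))))))
        (CWStore 0 (WConst 1) (WConst 0))).

Definition sample_body : cmd :=
  CSeq (CFlip 21 (WConst 0))
  (CSeq (CWStore 6 (WBin WDiv ei (V 22))
          (WBin WAdd (WBin WMul (WConst 2) (WLoad 6 (WBin WDiv ei (V 22)))) (V 21)))
        (CWStore 5 (WConst 0) (WBin WAdd ei (WConst 1)))).

Definition c_sample : cmd :=
  CSeq (CWStore 5 (WConst 0) (WConst 0))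
    (CWhile (BWLt ei (WBin WMul (WLoad 0 (WConst 0)) (V 22))) sample_body).

Definition c_main : cmd := CSeq (CWStore 16 (WConst 0) (V 4)) c_levels.

Definition hopset_prog : cmd := CSeq c_init (CSeq c_adj (CSeq c_sample c_main)).

Section Init.
Variables (R : realType) (n : nat) (w L P M : nat).
Hypothesis LE : L = up_log 2 n.
Hypothesis PE : P = 2 ^ L.
Hypothesis PM : M = P * P.
Hypothesis HW : 2 ^ w = M * M.
Hypothesis Mbig : 100 <= M.
Implicit Types st : state R.
Local Notation tr := (@tr R w).

Lemma log_spec st : words st 0 0 = n ->
  tr c_log st (5 * L + 6) (fun st' =>
    [/\ words st' 4 0 = P, words st' 22 0 = L & same [:: 4; 22] [::] st st']).
Proof.
move=> h0; have WB := W_big HW Mbig; have Ple := P_le_M PM Mbig.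
have nP : n <= P by rewrite PE LE; apply: up_logP.
have LP : L < P by rewrite PE; apply: ltn_expl.
pose I f st' := exists k, [/\ k <= L, f = 5 * (L - k), words st' 4 0 = 2 ^ k,
   words st' 22 0 = k & same [:: 4; 22] [::] st st'].
apply: (@tr_le _ _ _ _ (1 + (1 + (5 * L).+1).+1).+1); last by lia.
apply: tr_seq; wst 0 1; apply: tr_seq; wst 0 0.
apply: tr_conseq (tr_while (I := I) _ _) (leqnn _) _.
- move=> f st' [k [kL -> e4 e22 sm]].
  have e0 : words st' 0 0 = n by rewrite (proj1 sm).
  ev => kn.
  have kl : k < L.
    by rewrite ltnNge; apply/negP => Lk; move: kn; rewrite ltnNge (leq_trans nP) // PE leq_exp2l.
  have kP : 2 ^ k.+1 <= P by rewrite PE leq_exp2l.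
  exists (1 + 1).+1; rewrite expnS in kP; apply: tr_seq; wst 0 (2 * 2 ^ k); wst 0 k.+1.
  exists (5 * (L - k.+1)); split; last by lia.
  exists k.+1; split=> //; first by rewrite expnS.
  by apply: same_wstore => //; apply: same_wstore.
- exists 0; rewrite subn0; split=> //.
  by apply: same_wstore => //; apply: same_wstore => //; exact: same_refl.
- move=> st' [f [[k [kL _ e4 e22 sm]]]].
  have e0 : words st' 0 0 = n by rewrite (proj1 sm).
  ev; rewrite -leqNgt => nk.
  have e : k = L by apply/eqP; rewrite eqn_leq kL LE /=; apply: up_log_min.
  by split=> //; rewrite ?e4 ?e22 ?PE ?e.
Qed.

Lemma pow_spec st (k : nat) z d (rz rd : R) : k \in [:: 18; 19] ->
  (forall st', same [:: k] [:: 5] st st' ->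
     eval_r w st' z = rz /\ eval_r w st' d = rd) ->
  (0 < rd)%R -> (rz <= rd * L%:R)%R ->
  tr (c_pow k z d) st (5 * L + 11) (fun st' => exists j,
    [/\ words st' k 0 = 2 ^ j, (rz <= j%:R * rd)%R,
        j = 0 \/ 0 < j /\ (j.-1%:R * rd < rz)%R, j <= L & same [:: k] [:: 5] st st']).
Proof.
move=> hk He d0 zL; have WB := W_big HW Mbig; have Ple := P_le_M PM Mbig.
have LP : 2 ^ L = P by rewrite PE.
pose I f st' := exists j, [/\ f = 5 * (L - j), words st' k 0 = 2 ^ j,
   reals st' 5 0 = (j%:R * rd)%R, j = 0 \/ 0 < j /\ (j.-1%:R * rd < rz)%R & 
   j <= L /\ same [:: k] [:: 5] st st'].
apply: (@tr_le _ _ _ _ (1 + (1 + (5 * L).+1).+1).+1); last by lia.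
have k5 : exists k', k = k'.+1 by case: (k) hk => // k' _; exists k'.
apply: tr_seq; apply: (@tr_ws _ _ _ _ _ _ 0 1); [by ev|by ev|].
apply: tr_seq; apply: (@tr_rs _ _ _ _ _ _ 0 0%R); [by ev|by rewrite /= mod0n|].
apply: tr_conseq (tr_while (I := I) _ _) (leqnn _) _.
- move=> f st' [j [-> ek e5 hj [jL sm]]]; have [ez ed] := He _ sm.
  rewrite /= mod0n ez e5 => lt.
  have jl : j < L.
    rewrite ltnNge; apply/negP => Lj; move: lt; apply/negP; rewrite -leNgt.
    by apply: le_trans zL _; rewrite mulrC; apply: ler_wpM2r; [exact: ltW|rewrite ler_nat].
  have kP : 2 ^ j.+1 <= P by rewrite -LP leq_exp2l.
  rewrite expnS in kP.
  exists (1 + 1).+1; apply: tr_seq.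
  apply: (@tr_rs _ _ _ _ _ _ 0 (j.+1%:R * rd)%R); first by ev.
    by rewrite /= mod0n e5 ed -natr1 mulrDl mul1r.
  apply: (@tr_ws _ _ _ _ _ _ 0 (2 * 2 ^ j)); [by ev|by ev|].
  exists (5 * (L - j.+1)); split; last by lia.
  exists j.+1; split=> //.
  + by rewrite /= /upd eqxx /= expnS.
  + by right.
  + split=> //; apply: same_wstore; last by rewrite mem_head.
    exact: same_rstore.
- exists 0; rewrite subn0; split=> //.
  + by rewrite /= /upd eqxx.
  + by rewrite /upd /= mul0r.
  + by left.
  + split=> //; apply: same_rstore => //; apply: same_wstore; rewrite ?mem_head //; exact: same_refl.
- move=> st' [f [[j [_ ek e5 hj [jL sm]]]]]; have [ez ed] := He _ sm.
  by rewrite /= mod0n ez e5 -leNgt => lt; exists j; split.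
Qed.

Lemma init_spec st (kappa rho : R) : words st 0 0 = n ->
  reals st 0 0 = kappa -> reals st 0 1 = rho -> (1 <= kappa)%R -> (rho <= 1)%R ->
  tr c_init st (15 * L + 40) (fun st' => exists a r,
   [/\ words st' 4 0 = P, words st' 22 0 = L, words st' 18 0 = 2 ^ a,
       words st' 19 0 = 2 ^ r & same [:: 4; 22; 18; 19] [:: 5] st st'] /\
   [/\ (L%:R <= a%:R * kappa)%R, a = 0 \/ 0 < a /\ (a.-1%:R * kappa < L%:R)%R, 
       (rho * L%:R <= r%:R)%R, r = 0 \/ 0 < r /\ (r.-1%:R < rho * L%:R)%R &
       a <= L /\ r <= L]).
Proof.
move=> h0 hk hr k1 r1; have WB := W_big HW Mbig; have Ple := P_le_M PM Mbig.
apply: (@tr_le _ _ _ _ ((5 * L + 6) + ((5 * L + 11) + (5 * L + 11)).+1).+1); last by lia.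
apply: tr_seq; apply: tr_conseq (log_spec h0) (leqnn _) _ => s1 [e4 e22 sm1].
have He1 : forall st', same [:: 18] [:: 5] s1 st' ->
  eval_r w st' (RCast (V 22)) = L%:R%R /\ eval_r w st' (RLoad 0 (WConst 0)) = kappa.
  by move=> st' sm; rewrite /= !mod0n (proj1 sm) // e22 (proj2 sm) // (proj2 sm1).
have kL : (L%:R <= kappa * L%:R)%R by rewrite ler_peMl.
have k0 : (0 < kappa)%R by apply: lt_le_trans k1.
apply: tr_seq; apply: tr_conseq (pow_spec (mem_head _ _) He1 k0 kL) (leqnn _) _.
move=> s2 [a [a1 a2 a3 a4 sm2]].
have He2 : forall st', same [:: 19] [:: 5] s2 st' ->
  eval_r w st' (RBin RMul (RLoad 0 (WConst 1)) (RCast (V 22))) = (rho * L%:R)%R /\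
  eval_r w st' (RCast (WConst 1)) = 1%R.
  move=> st' sm; rewrite /= !mod0n mW; last by nlia.
  rewrite (proj1 sm) // (proj1 sm2) // e22.
  by rewrite (proj2 sm) // (proj2 sm2) // (proj2 sm1) // hr.
have rL : (rho * L%:R <= 1 * L%:R)%R by apply: ler_wpM2r.
have i19 : 19 \in [:: 18; 19] by [].
apply: tr_conseq (pow_spec i19 He2 ltr01 rL) (leqnn _) _.
move=> s3 [r [r1' r2 r3 r4 sm3]]; exists a, r; split; split=> //.
- by rewrite (proj1 sm3) // (proj1 sm2).
- by rewrite (proj1 sm3) // (proj1 sm2).
- by rewrite (proj1 sm3).
- apply: same_trans (same_sub sm3 _ _) => //.
  by apply: same_trans (same_sub sm2 _ _) => //; apply: same_sub sm1 _ _.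
- by rewrite mulr1 in r2.
- by rewrite mulr1 in r3.
Qed.

End Init.

Section Adjacency.
Variables (R : realType) (n : nat) (G : wgraph R n).
Variables (w P M : nat).
Hypothesis PM : M = P * P.
Hypothesis HW : 2 ^ w = M * M.
Hypothesis Mbig : 100 <= M.
Hypothesis nP : n <= P.
Implicit Types (st : state R) (u v z : 'I_n) (l : seq ('I_n * 'I_n)).
Local Notation tr := (@tr R w).

Definition add_arc (nb : 'I_n -> seq 'I_n) u z : 'I_n -> seq 'I_n :=
  fun v => if v == u then z :: nb v else nb v.

Definition neighbors l : 'I_n -> seq 'I_n :=
  foldl (fun nb e => add_arc (add_arc nb e.1 e.2) e.2 e.1) (fun _ => [::]) l.

Lemma mem_neighbors l v z : (z \in neighbors l v) = ((v, z) \in l) || ((z, v) \in l).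
Proof.
elim/last_ind: l => [|l e IH] //.
rewrite /neighbors -cats1 foldl_cat /= -/(neighbors l) cats1 !mem_rcons !inE.
rewrite orbACA -IH; case: e => a b; rewrite !xpair_eqE /add_arc /=.
case: (eqVneq v b) => /= _; case: (eqVneq v a) => /= _; rewrite ?inE ?andbT ?andbF ?orbF ?orFb //.
by rewrite orbA [(z == a) || _]orbC.
Qed.

Lemma sum_add_arc nb u z :
  \sum_(v : 'I_n) size (add_arc nb u z v) = (\sum_(v : 'I_n) size (nb v)).+1.
Proof.
rewrite (bigD1 u) // [in RHS](bigD1 u) //= /add_arc eqxx /= addSn; congr (_ + _).+1.
by apply: eq_bigr => v /negbTE ->.
Qed.

Lemma sum_neighbors l : \sum_(v : 'I_n) size (neighbors l v) = 2 * size l.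
Proof.
elim/last_ind: l => [|l e IH]; first by rewrite big1.
rewrite /neighbors -cats1 foldl_cat /= -/(neighbors l) !sum_add_arc IH size_cat /=.
by rewrite addn1 mulnS.
Qed.

Definition arcs_ok K st (nb : 'I_n -> seq 'I_n) : Prop := forall v,
  chain G K (words st 10) (words st 11) (reals st 4) v (words st 9 v) (nb v).

Lemma chain_bound K nx to aw v b L : chain G K nx to aw v b L -> b <= K.
Proof. by case: L => [|z L] /= => [->|[/andP[_ ?]]]. Qed.

Lemma chain_le K K' nx to aw nx' to' aw' v b L : K <= K' ->
  (forall i, i < K -> [/\ nx' i = nx i, to' i = to i & aw' i = aw i]) ->
  chain G K nx to aw v b L -> chain G K' nx' to' aw' v b L.
Proof.
move=> KK h; elim: L b => //= z L IH b [/andP[b0 bK] h5 h6 h7].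
have [-> -> ->] : [/\ nx' b.-1 = nx b.-1, to' b.-1 = to b.-1 & aw' b.-1 = aw b.-1].
  by apply: h; lia.
by split=> //; [rewrite b0 (leq_trans bK)|apply: IH].
Qed.

Lemma arc_spec st nb K (ea efr eto : wexp) u z i :
  (forall st', same [:: 9; 10; 11] [::] st st' ->
    [/\ eval_w w st' ea = K, eval_w w st' efr = u & eval_w w st' eto = z]) ->
  words st 5 0 = i -> K.+1 < M -> reals st 1 i = wt G u z -> arcs_ok K st nb ->
  tr (c_arc ea efr eto) st 7 (fun st' =>
    arcs_ok K.+1 st' (add_arc nb u z) /\ same [:: 9; 10; 11] [:: 4] st st').
Proof.
move=> He h5 KM hw ok; have WB := W_big HW Mbig.
pose s1 := State (upd (words st) 10 K (words st 9 u)) (reals st).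
pose s2 := State (upd (words s1) 9 u K.+1) (reals st).
pose s3 := State (upd (words s2) 11 K z) (reals st).
pose s4 := State (words s3) (upd (reals st) 4 K (wt G u z)).
have m1 : same [:: 9; 10; 11] [::] st s1 by apply: same_wstore => //; exact: same_refl.
have m2 : same [:: 9; 10; 11] [::] st s2 by apply: (@same_wstore _ _ _ _ s1).
have m3 : same [:: 9; 10; 11] [::] st s3 by apply: (@same_wstore _ _ _ _ s2).
apply: (@tr_le _ _ _ _ (1 + (1 + (1 + 1).+1).+1).+1) => //.
have [a1 a2 a3] := He st (same_refl _ _ _).
have [b1 b2 b3] := He s1 m1; have [c1 c2 c3] := He s2 m2; have [d1 d2 d3] := He s3 m3.
apply: tr_seq; apply: (@tr_ws _ _ _ _ _ _ K (words st 9 u)) => //=; first by rewrite a2.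
rewrite -/s1; apply: tr_seq; apply: (@tr_ws _ _ _ _ _ _ u K.+1) => //=.
  by rewrite b1 !mW; nlia.
rewrite -/s2; apply: tr_seq; apply: (@tr_ws _ _ _ _ _ _ K z) => //=.
rewrite -/s3; apply: (@tr_rs _ _ _ _ _ _ K (wt G u z)) => //=.
  by rewrite mod0n /upd /= h5.
rewrite -/s4; split; last first.
  apply: (@same_rstore _ _ _ _ s3) => //; exact: same_sub m3 _ _.
have cells i' : i' < K -> [/\ words s4 10 i' = words st 10 i',
    words s4 11 i' = words st 11 i' & reals s4 4 i' = reals st 4 i'].
  by move=> iK; rewrite /= /upd /= !ifF //; apply/eqP; lia.
move=> v; rewrite /add_arc; have okv := ok v; have bv := chain_bound okv.
case: (eqVneq v u) => [e|ne].
  rewrite e in okv *.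
  have -> : words s4 9 u = K.+1 by rewrite /= /upd /= eqxx.
  split; rewrite /= /upd /= ?eqxx ?ltnSn //.
  by apply: chain_le okv => // i' iK; apply: cells.
have -> : words s4 9 v = words st 9 v by rewrite /= /upd /= val_eqE (negbTE ne).
by apply: chain_le okv => // i' iK; apply: cells.
Qed.

Lemma adj_spec st l : words st 0 1 = size l -> 2 * size l < M ->
  (forall i d, i < size l -> [/\ words st 1 i = (nth d l i).1,
     words st 2 i = (nth d l i).2 & reals st 1 i = wt G (nth d l i).1 (nth d l i).2]) ->
  (forall i, words st 9 i = 0) ->
  tr c_adj st (20 * size l + 6) (fun st' =>
    [/\ arcs_ok (2 * size l) st' (neighbors l), words st' 0 0 = words st 0 0,
        words st' 0 1 = 0 & same [:: 0; 5; 9; 10; 11] [:: 4] st st']).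
Proof.
move=> h01 lM hl h9; have WB := W_big HW Mbig.
pose I f st' := exists k, [/\ k <= size l, f = 20 * (size l - k), words st' 5 0 = k,
  arcs_ok (2 * k) st' (neighbors (take k l)) & same [:: 5; 9; 10; 11] [:: 4] st st'].
apply: (@tr_le _ _ _ _ (1 + ((20 * size l).+1 + 1).+1).+1); last by lia.
apply: tr_seq; wst 0 0; apply: tr_seq.
apply: tr_conseq (tr_while (I := I) _ _) (leqnn _) _.
- move=> f st' [k [kl -> e5 ok sm]].
  have e01 : words st' 0 1 = size l by rewrite (proj1 sm).
  ev => ks.
  have [d _] : exists d : 'I_n * 'I_n, True by case: (l) ks => // d _ _; exists d.
  have [w1 w2 w3] := hl k d ks; set e := nth d l k in w1 w2 w3.
  have nbE : neighbors (take k.+1 l) =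
      add_arc (add_arc (neighbors (take k l)) e.1 e.2) e.2 e.1.
    by rewrite (take_nth d) // /neighbors -cats1 foldl_cat.
  exists (7 + (7 + 1).+1).+1; apply: tr_seq.
  have He1 : forall st2, same [:: 9; 10; 11] [::] st' st2 ->
    [/\ eval_w w st2 e2i = 2 * k, eval_w w st2 (WLoad 1 ei) = e.1 &
        eval_w w st2 (WLoad 2 ei) = e.2].
    move=> st2 sm2; have e5' : words st2 5 0 = k by rewrite (proj1 sm2).
    split; ev => //; by rewrite (proj1 sm2) // (proj1 sm).
  have hw1 : reals st' 1 k = wt G e.1 e.2 by rewrite (proj2 sm).
  have kM : (2 * k).+1 < M by nlia.
  apply: tr_conseq (arc_spec He1 e5 kM hw1 ok) (leqnn _) _ => s2 [ok2 sm2].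
  have e52 : words s2 5 0 = k by rewrite (proj1 sm2).
  have He2 : forall st2, same [:: 9; 10; 11] [::] s2 st2 ->
    [/\ eval_w w st2 (WBin WAdd e2i (WConst 1)) = (2 * k).+1,
        eval_w w st2 (WLoad 2 ei) = e.2 & eval_w w st2 (WLoad 1 ei) = e.1].
    move=> st2 sm3; have e5' : words st2 5 0 = k by rewrite (proj1 sm3).
    split; ev => //; first by rewrite addn1.
      by rewrite (proj1 sm3) // (proj1 sm2) // (proj1 sm).
    by rewrite (proj1 sm3) // (proj1 sm2) // (proj1 sm).
  have hw2 : reals s2 1 k = wt G e.2 e.1 by rewrite wt_sym (proj2 sm2).
  have kM2 : (2 * k).+2 < M by nlia.
  apply: tr_seq; apply: tr_conseq (arc_spec He2 e52 kM2 hw2 ok2) (leqnn _) _ => s3 [ok3 sm3].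
  have e53 : words s3 5 0 = k by rewrite (proj1 sm3).
  wst 0 k.+1; exists (20 * (size l - k.+1)); split; last by nlia.
  exists k.+1; split=> //.
  + by rewrite nbE (_ : 2 * k.+1 = (2 * k).+2) //; lia.
  + apply: same_wstore => //; apply: same_trans sm _.
    by apply: same_trans (same_sub sm2 _ _) (same_sub sm3 _ _).
- exists 0; rewrite take0 subn0; split=> //; first by move=> v; rewrite /= /upd /= h9.
  by apply: same_wstore => //; exact: same_refl.
- move=> s2 [f [[k [kl _ e5 ok sm]]]].
  have e01 : words s2 0 1 = size l by rewrite (proj1 sm).
  ev; rewrite -leqNgt => lk; have e : k = size l by lia.
  rewrite e take_size in ok; wst 1 0; split=> //.
  + by rewrite /upd /= (proj1 sm).
  + by apply: same_wstore => //; apply: same_sub sm _ _.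
Qed.

End Adjacency.

(** * Drawing the keys *)

Section Sample.
Variables (R : realType) (n w L P M : nat).
Hypothesis PE : P = 2 ^ L.
Hypothesis PM : M = P * P.
Hypothesis HW : 2 ^ w = M * M.
Hypothesis Mbig : 100 <= M.
Hypothesis nP : n <= P.
Hypothesis L0 : 0 < L.
Implicit Types (st : state R) (bs r : seq bool).

Definition bits_val (r : seq bool) : nat := foldl (fun a b => 2 * a + nat_of_bool b) 0 r.

Lemma bits_val_rcons r b : bits_val (rcons r b) = 2 * bits_val r + b.
Proof. by rewrite /bits_val -cats1 foldl_cat. Qed.

Lemma bits_val_lt r : bits_val r < 2 ^ size r.
Proof.
elim/last_ind: r => // r b IH; rewrite bits_val_rcons size_rcons expnS.
by move: IH; case: b => /=; lia.
Qed.

(** For an incomplete or missing block this is the value of the bits drawn so far, which is what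
    array 6 contains in the middle of the loop. *)
Definition sampled r (i : nat) : nat := bits_val (take L (drop (i * L) r)).

Lemma sampled_lt r i : sampled r i < P.
Proof.
rewrite /sampled PE; apply: leq_trans (bits_val_lt _) _.
by rewrite leq_exp2l // size_take; case: ifP => // /negbT; rewrite -leqNgt.
Qed.

Lemma sampled_rcons r b i :
  sampled (rcons r b) i = if i == size r %/ L then 2 * sampled r i + b else sampled r i.
Proof.
rewrite /sampled; case: (ltngtP i (size r %/ L)) => h.
- have h1 : i * L + L <= size r by have := leq_trunc_div (size r) L; nia.
  rewrite -cats1 drop_cat ifT; last by lia.
  by rewrite takel_cat // size_drop; lia.
- have h1 : size r < i * L by have := ltn_ceil (size r) L0; nia.
  by rewrite !drop_oversize // ?size_rcons; lia.
- have h1 := leq_trunc_div (size r) L; have h2 := ltn_ceil (size r) L0.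
  rewrite -h in h1 h2; rewrite drop_rcons //.
  rewrite !take_oversize ?size_rcons ?size_drop ?bits_val_rcons //; nia.
Qed.

(* One round of the sampling loop takes six steps, the third being the flip. *)
Fixpoint flips (k : nat) bs : seq bool :=
  if k is k'.+1 then nth false bs 2 :: flips k' (drop 6 bs) else [::].

Local Notation loop := (CWhile (BWLt ei (WBin WMul (WLoad 0 (WConst 0)) (V 22))) sample_body).

(** [tr] asks for one final state whatever the bits, so it cannot describe sampling; the statement
    is about a given bit string instead. The number of steps is still independent of the bits: six
    per flip and one for the final test. *)
Lemma sample_loop k st r bs : words st 0 0 = n -> words st 22 0 = L ->
  words st 5 0 = size r -> size r + k = n * L -> n * L <= M ->
  (forall i, words st 6 i = sampled r i) -> size bs = 6 * k + 1 ->
  exists st', [/\ forall i, words st' 6 i = sampled (r ++ flips k bs) i,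
     same [:: 5; 6; 21] [::] st st' &
     forall bs' c, run w (bs ++ bs') (loop :: c) st = run w bs' c st'].
Proof.
have WB := W_big HW Mbig; have Ple := P_le_M PM Mbig.
move=> + + + + nM; elim: k st r bs => [|k IH] st r bs h0 h22 h5 sz h6 sb.
  exists st; split; [by rewrite cats0|exact: same_refl|].
  case: bs sb => [|b [|? ?]] // _ bs' c; rewrite /= !mod0n h0 h22 h5 mW; last by nlia.
  by rewrite ltnNge -sz addn0 leqnn.
have rL : size r < n * L by lia.
case: bs sb => [|b0 [|b1 [|b2 [|b3 [|b4 [|b5 bs]]]]]]; try (by rewrite mulnS => /= ?; lia).
move=> sb; set q := size r %/ L.
have qn : q < n by rewrite ltn_divLR.
pose s1 := State (upd (words st) 21 0 (nat_of_bool b2)) (reals st).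
pose s2 := State (upd (words s1) 6 q (2 * sampled r q + b2)) (reals st).
pose s3 := State (upd (words s2) 5 0 (size r).+1) (reals st).
have xP := sampled_lt r q; have b21 : b2 <= 1 by case: (b2).
have sm3 : same [:: 5; 6; 21] [::] st s3.
  apply: (@same_wstore _ _ _ _ s2) => //; apply: (@same_wstore _ _ _ _ s1) => //.
  by apply: same_wstore => //; exact: same_refl.
have [||||||st' [g1 g2 g3]] := IH s3 (rcons r b2) bs.
- by [].
- by [].
- by rewrite size_rcons.
- by rewrite size_rcons -sz addnS.
- move=> i; rewrite sampled_rcons /= /upd /= -/q.
  by case: eqP => [->|].
- by move: sb => /=; lia.
exists st'; split.
- by move=> i; rewrite g1 /= drop0 cat_rcons.
- exact: same_trans sm3 g2.
- move=> bs' c; have qE : size r %/ L = q by [].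
  have t1 : eval_b w st (BWLt ei (WBin WMul (WLoad 0 (WConst 0)) (V 22))).
    by ev.
  move: t1 => /= t1; rewrite t1 /= -(g3 bs' c); congr (run _ _ _ _).
  rewrite /s3 /s2 /s1 /= !mod0n /upd /= h5 h22 qE h6.
  have -> : (b2 %% 2 ^ w) = b2 by rewrite mW //; nlia.
  rewrite !mW //; try nlia.
  by rewrite addn1.
Qed.

Lemma sample_spec st bs : words st 0 0 = n -> words st 22 0 = L -> n * L <= M ->
  (forall i, words st 6 i = 0) -> size bs = 6 * (n * L) + 3 ->
  exists st', [/\ forall i, words st' 6 i = sampled (flips (n * L) (drop 2 bs)) i,
     same [:: 5; 6; 21] [::] st st' &
     forall bs' c, run w (bs ++ bs') (c_sample :: c) st = run w bs' c st'].
Proof.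
move=> h0 h22 nM h6 sb.
case: bs sb => [|b0 [|b1 bs]]; try (by move=> /= ?; lia).
move=> sb; pose s1 := State (upd (words st) 5 0 0) (reals st).
have sm1 : same [:: 5; 6; 21] [::] st s1.
  by apply: same_wstore => //; exact: same_refl.
have h6' i : words s1 6 i = sampled [::] i.
  by rewrite /= /upd /= h6 /sampled drop_oversize // take_oversize.
have sb' : size bs = 6 * (n * L) + 1 by move: sb => /=; lia.
have [st' [g1 g2 g3]] := @sample_loop (n * L) s1 [::] bs h0 h22 erefl erefl nM h6' sb'.
exists st'; split.
- by move=> i; rewrite g1 /= drop0.
- exact: same_trans sm1 g2.
- by move=> bs' c; rewrite -(g3 bs' c) /= !mod0n.
Qed.

End Sample.

Local Open Scope ring_scope.

(** * Averages over random bits *)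

Section Averages.
Variable R : realType.
Implicit Types (F : seq bool -> R) (b : seq bool).

Fixpoint all_bits (T : nat) : seq (seq bool) :=
  if T is T'.+1 then map (cons true) (all_bits T') ++ map (cons false) (all_bits T')
  else [:: [::]].

Fixpoint avg (T : nat) F : R :=
  if T is T'.+1 then
    (avg T' (fun b => F (true :: b)) + avg T' (fun b => F (false :: b))) / 2
  else F [::].

Lemma mem_all_bits T b : (b \in all_bits T) = (size b == T).
Proof.
elim: T b => [|T IH] [|x b] //=; rewrite mem_cat.
  by apply/negbTE; rewrite negb_or; apply/andP; split; apply/negP => /mapP[].
have inj y : injective (cons y : seq bool -> seq bool) by move=> ? ? [].
have no y z : y != z -> (y :: b \in map (cons z) (all_bits T)) = false.
  by move=> yz; apply/negP => /mapP[c _ [e _]]; rewrite e eqxx in yz.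
by case: x; rewrite (mem_map (inj _)) IH no ?orbF.
Qed.

Lemma uniq_all_bits T : uniq (all_bits T).
Proof.
elim: T => //= T IH; have inj y : injective (cons y : seq bool -> seq bool) by move=> ? ? [].
rewrite cat_uniq !(map_inj_uniq (inj _)) IH /= andbT.
by apply/hasPn => _ /mapP[c _ ->]; apply/negP => /mapP[].
Qed.

Lemma size_all_bits T : size (all_bits T) = (2 ^ T)%N.
Proof. by elim: T => //= T IH; rewrite size_cat !size_map IH addnn -mul2n expnS. Qed.

Lemma avg_sum T F : avg T F = (\sum_(b <- all_bits T) F b) / 2 ^+ T.
Proof.
elim: T F => [|T IH] F /=; first by rewrite big_seq1 divr1.
by rewrite !IH big_cat !big_map /= exprS invfM -mulrDl; ring.
Qed.

Lemma eq_avg T F F' : (forall b, size b = T -> F b = F' b) -> avg T F = avg T F'.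
Proof.
elim: T F F' => [|T IH] F F' h /=; first exact: h.
by congr ((_ + _) / 2); apply: IH => b sb; apply: h; rewrite /= sb.
Qed.

Lemma avg_cst T c : avg T (fun _ => c) = c.
Proof. by elim: T => //= T ->; field. Qed.

Lemma avg_le T F F' : (forall b, size b = T -> F b <= F' b) -> avg T F <= avg T F'.
Proof.
elim: T F F' => [|T IH] F F' h /=; first exact: h.
rewrite ler_pM2r ?invr_gt0 //; apply: lerD; apply: IH => b sb; apply: h; by rewrite /= sb.
Qed.

Lemma avgD T F F' : avg T (fun b => F b + F' b) = avg T F + avg T F'.
Proof. by elim: T F F' => //= T IH F F'; rewrite !IH; field. Qed.

Lemma avgZ T c F : avg T (fun b => c * F b) = c * avg T F.
Proof. by elim: T F => //= T IH F; rewrite !IH; field. Qed.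

Lemma avg_bigsum (I : Type) (r : seq I) (P : pred I) T (F : I -> seq bool -> R) :
  avg T (fun b => \sum_(i <- r | P i) F i b) = \sum_(i <- r | P i) avg T (F i).
Proof.
elim: r => [|i r IH]; first by rewrite big_nil -[RHS](avg_cst T); apply: eq_avg => b _; rewrite big_nil.
rewrite big_cons -IH; case: ifP => h.
  by rewrite -avgD; apply: eq_avg => b _; rewrite big_cons h.
by apply: eq_avg => b _; rewrite big_cons h.
Qed.

Lemma avg_cat T T' F :
  avg (T + T') F = avg T (fun b => avg T' (fun b' => F (b ++ b'))).
Proof. by elim: T F => //= T IH F; rewrite !IH. Qed.

(** A prefix [b] of length [T] extends to [2 ^ t b] halting runs of weight 2^-(T + t b) each,
    together 2^-T. The later bits average out because [X] is a function of the prefix. *)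
Lemma expect_avg w p (s : state R) T (t : seq bool -> nat) (X Y : seq bool -> R) :
  (forall bs, halting_runs w p s bs <->
     (T <= size bs)%N /\ size bs = (T + t (take T bs))%N) ->
  (forall bs, halting_runs w p s bs -> X bs = Y (take T bs)) ->
  (forall bs, halting_runs w p s bs -> 0 <= X bs) ->
  expect w p s X = (avg T Y)%:E.
Proof.
move=> H XY X0.
pose L := flatten [seq [seq b ++ b' | b' <- all_bits (t b)] | b <- all_bits T].
have memL bs : bs \in L <-> halting_runs w p s bs.
  rewrite H; split.
    case/flattenP => _ /mapP[b + ->] /mapP[b' + ->].
    rewrite !mem_all_bits => /eqP sb /eqP sb'.
    by rewrite size_cat sb sb' leq_addr -sb take_size_cat.
  case=> h1 h2; apply/flattenP; exists [seq take T bs ++ b' | b' <- all_bits (t (take T bs))].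
    by apply/mapP; exists (take T bs) => //; rewrite mem_all_bits size_takel.
  apply/mapP; exists (drop T bs); last by rewrite cat_take_drop.
  by rewrite mem_all_bits size_drop h2 addKn.
have uL : uniq L.
  rewrite /L; have := uniq_all_bits T; have : all (fun b => size b == T) (all_bits T).
    by apply/allP => b; rewrite mem_all_bits.
  elim: (all_bits T) => //= b r IH /andP[/eqP sb ar] /andP[br ur].
  rewrite cat_uniq IH // andbT; apply/andP; split.
    rewrite map_inj_uniq ?uniq_all_bits // => b1 b2 /(congr1 (drop (size b))).
    by rewrite !drop_size_cat.
  apply/hasPn => _ /flattenP[_ /mapP[c cr ->] /mapP[c' _ ->]].
  apply/negP => /mapP[b' _ /(congr1 (take T))].
  have sc : size c = T by move/allP: ar => /(_ _ cr) /eqP.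
  rewrite (take_size_cat _ sc) (take_size_cat _ sb) => e.
  by rewrite -e cr in br.
have -> : expect w p s X = (\sum_(bs <- L) (X bs / 2 ^+ size bs)%:E)%E.
  rewrite /expect (_ : halting_runs w p s = [set` L]%classic); last first.
    by apply/seteqP; split=> bs /=; rewrite memL.
  rewrite esum_fset; [by rewrite -fsbig_seq|exact: finite_seq|].
  move=> bs; rewrite inE /= memL => hb; rewrite lee_fin divr_ge0 ?X0 //.
rewrite sumEFin avg_sum /L big_flatten big_map mulr_suml; congr EFin.
rewrite [LHS]big_seq [RHS]big_seq; apply: eq_bigr => b; rewrite mem_all_bits => /eqP sb.
rewrite big_map.
transitivity (\sum_(b' <- all_bits (t b)) Y b / 2 ^+ (T + t b)).
  rewrite [LHS]big_seq [RHS]big_seq; apply: eq_bigr => b'; rewrite mem_all_bits => /eqP sb'.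
  rewrite XY ?size_cat ?sb ?sb'; first by rewrite -sb take_size_cat.
  by apply/H; rewrite size_cat sb sb' leq_addr -sb take_size_cat.
rewrite big_const_seq count_predT size_all_bits iter_addr_0 -[_ *+ (2 ^ _)%N]mulr_natr natrX exprD.
by field; rewrite !expf_neq0 // pnatr_eq0.
Qed.

End Averages.

(** * Expected sizes of bunches *)

Section Sampling.
Variables (R : realType) (n L : nat).
Hypothesis L0 : (0 < L)%N.
Local Notation P := (2 ^ L)%N.
Local Notation avg := (@avg R).
Local Notation sampled := (sampled L).

Lemma avg_drop d T (F : seq bool -> R) :
  avg (d + T) (fun b => F (drop d b)) = avg T F.
Proof.
rewrite avg_cat -[RHS](avg_cst d); apply: eq_avg => b sb.
by apply: eq_avg => b' _; rewrite drop_size_cat.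
Qed.

Lemma avg_flips k e (F : seq bool -> R) :
  avg (6 * k + e) (fun b => F (flips k b)) = avg k F.
Proof.
elim: k F => [|k IH] F; first by rewrite /= -[RHS](avg_cst e).
rewrite mulnS -addnA avg_cat.
rewrite (@eq_avg _ 6 _ (fun b => avg k (fun r => F (nth false b 2 :: r)))).
  by rewrite /=; field.
move=> b sb; rewrite -IH; apply: eq_avg => b' _ /=.
by rewrite nth_cat sb /= drop_size_cat.
Qed.

(** The accumulator [a] carries the induction: reading a bit splits the interval of the numbers with
    leading part [a] into two halves. *)
Lemma avg_bits_val k (f : nat -> R) a :
  avg k (fun b => f (foldl (fun a b => (2 * a + nat_of_bool b)%N) a b)) =
  (\sum_(0 <= y < 2 ^ k) f (a * 2 ^ k + y)%N) / (2 ^ k)%:R.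
Proof.
elim: k a => [|k IH] a /=; first by rewrite big_nat1 muln1 addn0 divr1.
rewrite !IH expnS [(2 * 2 ^ k)%N]mul2n -[(2 ^ k).*2]addnn.
rewrite [in RHS](@big_cat_nat _ _ _ (2 ^ k)%N) //= ?leq_addr //.
have -> (H : nat -> R) : \sum_(2 ^ k <= i < 2 ^ k + 2 ^ k) H i =
    \sum_(0 <= i < 2 ^ k) H (i + 2 ^ k)%N.
  by rewrite -{1}[(2 ^ k)%N]add0n big_addn addnK.
rewrite (eq_bigr (fun y => f ((2 * a + 1) * 2 ^ k + y)%N)
  (F1 := fun i => f (a * (2 ^ k + 2 ^ k) + (i + 2 ^ k))%N)); last first.
  by move=> y _; congr f; ring.
rewrite [in RHS](eq_bigr (fun y => f ((2 * a + 0) * 2 ^ k + y)%N)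
  (F1 := fun i => f (a * (2 ^ k + 2 ^ k) + i)%N)); last first.
  by move=> y _; congr f; ring.
rewrite [in RHS]addrC natrD; field.
by rewrite -natrD !pnatr_eq0 addn_eq0 !expn_eq0.
Qed.

(** The keys are independent and uniform below [P], as they are read from disjoint blocks of [L]
    bits. *)
Lemma avg_prod (m : nat) (phi : nat -> nat -> R) :
  avg (m * L) (fun r => \prod_(0 <= i < m) phi i (sampled r i)) =
  \prod_(0 <= i < m) ((\sum_(0 <= y < P) phi i y) / P%:R).
Proof.
elim: m => [|m IH]; first by rewrite !big_geq //= big_geq.
rewrite mulSn addnC avg_cat big_nat_recr //= -IH mulrC -avgZ.
apply: eq_avg => b sb.
have <- := avg_bits_val L (phi m) 0; rewrite mulrC -avgZ; apply: eq_avg => b' sb'.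
rewrite big_nat_recr //=; congr (_ * phi m _).
  apply: eq_big_nat => i /andP[_ im]; congr phi; rewrite /sampled.
  have h : (i * L + L <= m * L)%N by rewrite addnC -mulSn leq_mul2r im orbT.
  rewrite drop_cat ifT; last by rewrite sb; lia.
  by rewrite takel_cat // size_drop sb; lia.
by rewrite /sampled drop_size_cat // take_oversize // sb'.
Qed.

Lemma avg_event (F : 'I_n -> pred nat) :
  avg (n * L) (fun r => [forall i, F i (sampled r i)]%:R) =
  \prod_(i : 'I_n) ((\sum_(0 <= y < P) (F i y)%:R) / P%:R).
Proof.
pose phi (k y : nat) : R := if insub k is Some i then (F i y)%:R else 1.
have phiE (i : 'I_n) y : phi i y = (F i y)%:R by rewrite /phi valK.
have := avg_prod n phi; rewrite big_mkord.
under [in RHS]eq_bigr => i _ do under eq_bigr => y _ do rewrite phiE.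
move=> <-; apply: eq_avg => r _; rewrite big_mkord.
under eq_bigr => i _ do rewrite phiE.
case: (boolP [forall i, _]) => [/forallP h|].
  by rewrite big1 // => i _; rewrite h.
by rewrite negb_forall => /existsP[i /negbTE h]; rewrite (bigD1 i) //= h mul0r.
Qed.

Variables (th tp : nat).
Hypothesis tt : (tp <= th)%N.
Hypothesis thP : (th <= P)%N.
Definition level_prob : R := (th - tp)%N%:R / P%:R.
Definition pivot_free : R := 1 - tp%:R / P%:R.
Local Notation q := level_prob.
Local Notation t := pivot_free.

Lemma P_gt0 : 0 < P%:R :> R. Proof. by rewrite ltr0n expn_gt0. Qed.

Lemma sum_interval a b : (a <= b)%N -> (b <= P)%N ->
  \sum_(0 <= y < P) ((a <= y < b)%N%:R : R) = (b - a)%N%:R.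
Proof.
move=> ab bP; rewrite (@big_cat_nat _ _ _ b) //= (@big_cat_nat _ _ _ a 0 b) //=.
rewrite big_nat_cond big1 ?add0r; last first.
  by move=> y /andP[/andP[_ ya] _]; rewrite leqNgt ya.
rewrite [X in _ + X]big_nat_cond [X in _ + X]big1 ?addr0; last first.
  by move=> y /andP[/andP[yb _] _]; rewrite ltnNge yb andbF.
rewrite big_nat_cond (eq_bigr (fun _ => 1)); last by move=> y /andP[-> _].
by rewrite -big_nat_cond big_const_nat iter_addr_0.
Qed.

Lemma level_prob_ge0 : 0 <= q. Proof. by rewrite divr_ge0. Qed.

Lemma pivot_free_ge0 : 0 <= t.
Proof. by rewrite subr_ge0 ler_pdivrMr ?P_gt0 // mul1r ler_nat (leq_trans tt). Qed.

Implicit Types (s v p a : 'I_n) (sigma A : seq 'I_n) (r : seq bool).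

(** Independence applies because [s], the members of [A] and the part of [sigma] before [s] are
    distinct vertices. [A] is empty when work is counted, and [[:: v]] when edges at [v] are
    counted, for which [v] must lie in the level too. *)
Lemma avg_first A sigma s : uniq sigma -> s \in sigma -> 
  (forall a, a \in A -> a \notin sigma) -> uniq A ->
  avg (n * L) (fun r => [&& (tp <= sampled r s < th)%N,
     all (fun a => (tp <= sampled r a < th)%N) A &
     all (fun p => (tp <= sampled r p)%N) (take (index s sigma) sigma)]%:R) =
  q ^+ (size A) * (q * t ^+ (index s sigma)).
Proof.
move=> us ss As uA; set j := index s sigma.
have sj : s \notin take j sigma.
  by rewrite in_take_leq ?index_size // ltnn.
have sA : s \notin A by apply/negP => /As; rewrite ss.
pose F i y := if (i == s) || (i \in A) then (tp <= y < th)%N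
  else (i \in take j sigma) ==> (tp <= y)%N.
have PP := P_gt0.
transitivity (avg (n * L) (fun r => [forall i : 'I_n, F i (sampled r i)]%:R)).
  apply: eq_avg => r _; congr (nat_of_bool _)%:R; apply/idP/forallP.
    case/and3P => h1 /allP h2 /allP h3 i; rewrite /F.
    case: eqP => [->//|_] /=; case: ifP => [/h2 //|_]; apply/implyP; exact: h3.
  move=> h; apply/and3P; split.
  - by have := h s; rewrite /F eqxx.
  - by apply/allP => a aA; have := h a; rewrite /F aA orbT.
  - apply/allP => p pj; have := h p; rewrite /F pj /=.
    rewrite ifF //; apply/negbTE; rewrite negb_or; apply/andP; split.
      by apply: contraNneq sj => <-.
    by apply/negP => /As; rewrite (mem_take pj).
rewrite avg_event.
rewrite (eq_bigr (fun i => (if (i == s) || (i \in A) then q else 1) *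
  (if i \in take j sigma then t else 1))); last first.
  move=> i _; rewrite /F; case: ifP => h.
    rewrite sum_interval // ifF ?mulr1 //; apply/negbTE.
    case/orP: h => [/eqP->//|/As]; by apply: contra => /mem_take.
  rewrite mul1r; case: ifP => h' /=.
    rewrite (eq_big_nat _ _ (F2 := fun y => (tp <= y < P)%N%:R)); last first.
      by move=> y /andP[_ ->]; rewrite andbT.
    have tP := leq_trans tt thP.
    by rewrite sum_interval // natrB // mulrBl divff ?gt_eqF.
  rewrite (eq_bigr (fun _ => 1)) // big_const_nat subn0 iter_addr_0 divff //.
rewrite big_split /= -big_mkcond -[X in _ * X]big_mkcond /= !prodr_const.
have -> : #|[pred i | i \in take j sigma]| = j.
  rewrite -[RHS](size_takel (s := sigma)) ?index_size //.
  by rewrite -(card_uniqP (take_uniq j us)); apply: eq_card.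
have -> : #|[pred i | (i == s) || (i \in A)]| = (size A).+1.
  have uA' : uniq (s :: A) by rewrite /= sA.
  rewrite -[RHS]/(size (s :: A)) -(card_uniqP uA').
  by apply: eq_card => i; rewrite !inE.
by rewrite exprS; ring.
Qed.

Definition level_size : R := \sum_(0 <= j < n) q * t ^+ j.

Lemma avg_sum_first A sigma : uniq sigma -> (forall a, a \in A -> a \notin sigma) ->
  uniq A ->
  avg (n * L) (fun r => \sum_(s <- sigma) [&& (tp <= sampled r s < th)%N,
     all (fun a => (tp <= sampled r a < th)%N) A &
     all (fun p => (tp <= sampled r p)%N) (take (index s sigma) sigma)]%:R) <=
  q ^+ (size A) * level_size.
Proof.
move=> us As uA; rewrite avg_bigsum.
rewrite big_seq (eq_bigr (fun s => q ^+ (size A) * (q * t ^+ (index s sigma)))); last first.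
  by move=> s ss; apply: avg_first.
rewrite -big_seq -big_distrr /=; apply: ler_wpM2l.
  by apply: exprn_ge0; exact: level_prob_ge0.
case E : sigma => [|s0 sigma'].
  rewrite big_nil sumr_ge0 // => j _; apply: mulr_ge0; first exact: level_prob_ge0.
  by apply: exprn_ge0; exact: pivot_free_ge0.
rewrite -{}E.
have sn : (size sigma <= n)%N.
  by rewrite -(card_uniqP us); apply: leq_trans (max_card _) _; rewrite card_ord.
rewrite (big_nth s0) /level_size (@big_cat_nat _ _ _ (size sigma) 0 n) //=.
rewrite (eq_big_nat _ _ (F2 := fun j => q * t ^+ j)); last first.
  by move=> j /andP[_ js]; rewrite index_uniq.
rewrite lerDl sumr_ge0 // => j _; apply: mulr_ge0; first exact: level_prob_ge0.
by apply: exprn_ge0; exact: pivot_free_ge0.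
Qed.

(** The geometric sum multiplied by [tp / P] is [1 - t ^ n], and the factor [q] is at most [f] times
    [tp / P]. *)
Lemma level_size_pivots f : (0 < tp)%N -> (th <= tp * f)%N -> level_size <= f%:R.
Proof.
move=> tp0 thf; have PP := P_gt0; have t0 : 0 < tp%:R / P%:R :> R.
  by apply: divr_gt0; rewrite ltr0n ?expn_gt0.
have geo m : (tp%:R / P%:R) * \sum_(0 <= j < m) t ^+ j = 1 - t ^+ m.
  elim: m => [|m IH]; first by rewrite big_geq // mulr0 expr0 subrr.
  by rewrite big_nat_recr //= mulrDr IH /pivot_free exprS; ring.
rewrite /level_size -big_distrr /=.
have h1 : (tp%:R / P%:R) * \sum_(0 <= j < n) t ^+ j <= 1.
  by rewrite geo lerBlDr lerDl exprn_ge0 // pivot_free_ge0.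
have S0 : 0 <= \sum_(0 <= j < n) t ^+ j.
  by apply: sumr_ge0 => j _; apply: exprn_ge0; exact: pivot_free_ge0.
apply: (@le_trans _ _ (f%:R * (tp%:R / P%:R) * \sum_(0 <= j < n) t ^+ j)).
  apply: ler_wpM2r => //; rewrite /level_prob mulrA -natrM; apply: ler_wpM2r.
    by rewrite invr_ge0 ler0n.
  by rewrite ler_nat mulnC; apply: leq_trans thf; apply: leq_subr.
by rewrite -mulrA ler_piMr.
Qed.

Lemma level_size_last : tp = 0%N -> level_size = n%:R * (th%:R / P%:R).
Proof.
move=> tp0; rewrite /level_size /level_prob /pivot_free tp0 subn0 mul0r subr0.
under eq_bigr do rewrite expr1n mulr1.
by rewrite big_const_nat subn0 iter_addr_0 [RHS]mulr_natl.
Qed.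

Variable G : wgraph R n.
Hypothesis HG : pos_int_weights G.

Definition by_dist v : rel 'I_n := fun a b => (dist G a v <= dist G b v)%E.

Lemma allowed_first r v sigma s : s \in sigma -> sorted (by_dist v) sigma ->
  allowed G (sampled r) th tp s v ->
  all (fun p => (tp <= sampled r p)%N) (take (index s sigma) sigma).
Proof.
move=> ss so /and3P[_ _ /forallP al]; apply/allP => p pj.
rewrite leqNgt; apply/negP => xp; have /implyP /(_ xp) := al p.
rewrite ltNge => /negP; apply.
have tr : transitive (by_dist v) by move=> a b c; apply: le_trans.
have ps := mem_take pj.
have ij : (index p sigma < index s sigma)%N by rewrite -in_take.
exact: (sorted_ltn_index tr so _ _ ps ss ij).
Qed.

Lemma avg_allowed v :
  avg (n * L) (fun r => \sum_(s : 'I_n) (allowed G (sampled r) th tp s v)%:R) <= level_size.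
Proof.
pose sigma := sort (by_dist v) (enum 'I_n).
have us : uniq sigma by rewrite sort_uniq enum_uniq.
have so : sorted (by_dist v) sigma.
  by apply: sort_sorted => a b; apply: le_total.
rewrite -[level_size]mul1r; apply: le_trans (@avg_sum_first [::] sigma us _ _) => //.
apply: avg_le => r _.
rewrite [X in X <= _](_ : _ = \sum_(s <- sigma) (allowed G (sampled r) th tp s v)%:R); last first.
  by rewrite [RHS](perm_big (enum 'I_n)) /=; [rewrite big_enum|rewrite perm_sort].
rewrite big_seq [leRHS]big_seq; apply: ler_sum => s ss.
rewrite ler_nat; case: (boolP (allowed _ _ _ _ _ _)) => // al.
have := allowed_first ss so al; case/and3P: al => -> -> _ /=.
by move=> ->.
Qed.

(** The additional factor [q] is the probability that [v] itself lies in the level, which is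
    independent of the rest because [v] is left out of [sigma]. The key of [v] is at least [tp]:
    otherwise [v] would be a pivot at distance 0 from itself, and no source would be strictly
    closer. *)
Lemma avg_edges v :
  avg (n * L) (fun r => \sum_(s : 'I_n)
    [&& allowed G (sampled r) th tp s v, (sampled r v < th)%N & s != v]%:R) <=
  q * level_size.
Proof.
pose sigma := sort (by_dist v) (enum (predC1 v)).
have us : uniq sigma by rewrite sort_uniq enum_uniq.
have so : sorted (by_dist v) sigma.
  by apply: sort_sorted => a b; apply: le_total.
have vs : forall a, a \in [:: v] -> a \notin sigma.
  by move=> a; rewrite inE => /eqP->; rewrite mem_sort mem_enum !inE eqxx.
rewrite -[q in leRHS]expr1; apply: le_trans (@avg_sum_first [:: v] sigma us vs _) => //.
apply: avg_le => r _.
rewrite [X in X <= _](_ : _ = \sum_(s <- sigma) (allowed G (sampled r) th tp s v && (sampled r v < th)%N)%:R); last first.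
  rewrite [RHS](perm_big (enum (predC1 v))) /=; last by rewrite perm_sort.
  rewrite big_enum /= [RHS]big_mkcond /=; apply: eq_bigr => s _.
  by rewrite !inE; case: (eqVneq s v) => /=; rewrite ?andbF ?andbT.
rewrite big_seq [leRHS]big_seq; apply: ler_sum => s ss.
rewrite ler_nat; case: (boolP (allowed _ _ _ _ _ _)) => //= al; case: ltnP => // xv.
have := allowed_first ss so al; case/and3P: al => -> -> /forallP al /= ->.
rewrite !andbT lt0b leqNgt; apply/negP => xv'; have /implyP /(_ xv') := al v.
have [_ d1 d2] := rdist_spec HG (walk0 G v).
rewrite d2 ltNge => /negP; apply.
have [[l w]|nw] := pselect (exists l, walk G s v l); last first.
  by rewrite dist_no_walk ?leey // => l h; apply: nw; exists l.
have [w' _ ->] := rdist_spec HG w; rewrite lee_fin; apply: le_trans d1 _.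
exact: (walk_ge0 (pos_int_wt_ge0 HG) w').
Qed.

End Sampling.

(** * The parameters *)

Section Exponents.
Local Open Scope nat_scope.
Variables (L a r : nat).
Hypothesis a0 : 0 < a.
Hypothesis ar : a <= r.

Definition expo (i : nat) : nat := minn (2 ^ i * a) r.
Definition expo_sum (i : nat) : nat := \sum_(j < i) expo j.

Local Notation f := (fq (2 ^ r) (2 ^ a)).
Local Notation t := (tq (2 ^ L) (2 ^ r) (2 ^ a)).

Lemma expo_gt0 i : 0 < expo i.
Proof. by rewrite /expo leq_min muln_gt0 expn_gt0 a0 (leq_trans a0 ar). Qed.

Lemma expo_sumS i : expo_sum i.+1 = expo_sum i + expo i.
Proof. by rewrite /expo_sum big_ord_recr. Qed.

Lemma fqE i : f i = 2 ^ expo i.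
Proof.
elim: i => [|i IH] /=; first by rewrite /expo expn0 mul1n (minn_idPl ar).
rewrite /next_f IH -expnD addnn -mul2n ltn_exp2l // /expo.
have -> : 2 ^ i.+1 * a = 2 * (2 ^ i * a) by rewrite expnS mulnA.
by move: (2 ^ i * a) => y; case: ifP => h; congr (2 ^ _); lia.
Qed.

Lemma tqE i : (forall j, j < i -> r + expo_sum j < L) ->
  expo_sum i <= L /\ t i = 2 ^ (L - expo_sum i).
Proof.
elim: i => [|i IH] h.
  by rewrite /expo_sum big_ord0 subn0.
have [h1 h2] := IH (fun j ji => h j (ltnW ji)).
have h3 := h i (ltnSn i); have er : expo i <= r by rewrite /expo geq_minr.
rewrite expo_sumS /= /next_th h2 ltn_exp2l // ifT; last by lia.
split; first lia.
rewrite fqE subnDA; have h4 : expo i <= L - expo_sum i by lia.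
by rewrite -{1}(subnK h4) expnD mulnK // expn_gt0.
Qed.

Definition last_level : exists k, L <= r + expo_sum k.
Proof.
exists L; suff h : L <= expo_sum L by lia.
elim: (L) => // i IH; rewrite expo_sumS; have := expo_gt0 i; lia.
Qed.

(** The first level whose threshold is at most [2 ^ r]; from there [next_th] yields 0. *)
Definition depth : nat := ex_minn last_level.

Lemma depth_spec : L <= r + expo_sum depth /\
  (forall j, j < depth -> r + expo_sum j < L) /\ 
  (forall j, L <= r + expo_sum j -> depth <= j).
Proof.
rewrite /depth; case: ex_minnP => k h1 h2; split=> //; split=> // j jk.
by rewrite ltnNge; apply/negP => /h2; lia.
Qed.

Lemma tq_depth : [/\ forall i, i <= depth -> 0 < t i,
  forall i, i < depth -> t i.+1 * f i = t i,
  t depth <= 2 ^ r & forall j, depth < j -> t j = 0].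
Proof.
have [h1 [h2 h3]] := depth_spec.
have tE i : i <= depth -> expo_sum i <= L /\ t i = 2 ^ (L - expo_sum i).
  by move=> id; apply: tqE => j ji; apply: h2; lia.
have td : t depth <= 2 ^ r.
  by have [h4 ->] := tE _ (leqnn _); rewrite leq_exp2l //; lia.
split=> //.
- by move=> i /tE[_ ->]; rewrite expn_gt0.
- move=> i id; have [h4 ->] := tE _ id; have [h5 ->] := tE _ (ltnW id).
  rewrite fqE -expnD; congr (2 ^ _); move: h4; rewrite expo_sumS; lia.
- elim=> // j IH; rewrite ltnS leq_eqVlt => /orP[/eqP<-|/IH e].
    by rewrite /= /next_th ltnNge td.
  by rewrite /= e /next_th ltn0.
Qed.

(** Exponents at most double, so [f i.+1 <= f i * f i], while [t i.+1 = t i / f i]: the product does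
    not grow. Divided by [P], it bounds the chance of a vertex to be in the level times the expected
    size of its bunch. *)
Lemma tq_fq i : i < depth -> t i * f i <= 2 ^ L * 2 ^ a.
Proof.
have [_ h _ _] := tq_depth; elim: i => [|i IH] id; first by [].
apply: leq_trans (IH (ltnW id)); rewrite -(h i (ltnW id)) -mulnA leq_mul2l.
apply/orP; right; rewrite !fqE -expnD leq_exp2l // /expo expnS -mulnA.
by move: (2 ^ i * a) => y; lia.
Qed.

(** While the exponent is below [r], the ratios at least double and form a geometric sum, charged to
    [2 * f m]. A ratio equal to [2 ^ r] is charged to its exponent [r] in [expo_sum]. Since the
    exponents sum to at most [L] up to the depth, the levels together cost about
    [2 ^ r * (2 + L / r)]; this is where the factor [1 / rho] of the time comes from. *)
Lemma sum_fq m : r * \sum_(i < m) f i <= 2 * r * f m + 2 ^ r * expo_sum m.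
Proof.
elim: m => [|m IH]; first by rewrite big_ord0 muln0.
rewrite big_ord_recr mulnDr expo_sumS; apply: leq_trans (leq_add IH (leqnn _)) _.
rewrite [f m.+1]fqE [f m]fqE.
have [h|h] := leqP r (expo m).
  have e1 : expo m = r by apply/eqP; rewrite eqn_leq h /expo geq_minr.
  have e2 : expo m.+1 = r.
    by apply/eqP; rewrite eqn_leq /expo geq_minr leq_min leqnn andbT expnS -mulnA;
      move: h; rewrite /expo leq_min => /andP[h _]; lia.
  by rewrite e1 e2; move: (expo_sum m) (2 ^ r) => s R; clear; nia.
have e2 : expo m < expo m.+1.
  move: h; rewrite /expo expnS -mulnA; have : 0 < 2 ^ m * a by rewrite muln_gt0 expn_gt0.
  by move: (2 ^ m * a) => y; lia.
have : 2 ^ (expo m).+1 <= 2 ^ expo m.+1 by rewrite leq_exp2l.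
rewrite expnS; move: (2 ^ expo m) (2 ^ expo m.+1) (expo_sum m) (2 ^ r) (expo m) => A B s R e.
clear; nia.
Qed.

Lemma sum_fq_depth : r * \sum_(i < depth) f i <= 2 ^ r * (2 * r + L).
Proof.
apply: leq_trans (sum_fq _) _; have [_ [h2 _]] := depth_spec.
have [h3 _] := tqE h2; rewrite mulnDr; apply: leq_add.
  rewrite mulnC leq_mul2r fqE leq_exp2l // /expo geq_minr orbT //.
by rewrite leq_mul2l h3 orbT.
Qed.

End Exponents.

(** * Depth of the hierarchy and the hop bound *)

Section Bounds.
Variable R : realType.
Implicit Types (kappa rho eps : R).

(** A bound on the depth that is independent of [n], as the hop bound has to be. *)
Definition level_bound kappa rho : nat := Num.truncn (log2 kappa + 1 / rho).

Lemma ln2_gt0 : 0 < ln (2 : R).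
Proof. by apply: ln_gt0; rewrite (ltr_nat R 1 2). Qed.

Lemma le_log2 (m : nat) (y : R) : 0 < y -> (2 ^+ m <= y) = (m%:R <= log2 y).
Proof.
move=> y0; rewrite /log2 ler_pdivlMr ?ln2_gt0 // mulrC mulr_natr -lnXn //.
by rewrite ler_ln // ?posrE ?exprn_gt0.
Qed.

Lemma inv_gt2 rho : 0 < rho -> rho < 1 / 2 -> 2 < 1 / rho.
Proof. by move=> r0 r1; rewrite ltr_pdivlMr // mulrC; lra. Qed.

Lemma level_bound_spec kappa rho : 2 <= kappa -> rho < 1 / 2 -> 1 / kappa <= rho ->
  [/\ 0 < rho, (3 <= level_bound kappa rho)%N, 1 <= log2 kappa,
    (level_bound kappa rho)%:R <= log2 kappa + 1 / rho &
    log2 kappa + 1 / rho < (level_bound kappa rho).+1%:R].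
Proof.
move=> k2 r1 rk; have k0 : 0 < kappa by lra.
have r0 : 0 < rho by apply: lt_le_trans rk; apply: divr_gt0.
have l1 : 1 <= log2 kappa by rewrite -(le_log2 1) // expr1.
have i2 := inv_gt2 r0 r1; have s0 : 0 <= log2 kappa + 1 / rho by lra.
split=> //; [|by rewrite truncn_le|by rewrite truncnS_gt].
by rewrite truncn_ge_nat //; lra.
Qed.

(** The last level is reached once the exponents add up to [L - r]. Their lower bounds double until
    [rho * L] is reached, within [i1 <= log2 kappa] levels, and each later level contributes at
    least [rho * L], so that about [1 / rho] more are enough. The term [r], at least [rho * L],
    makes up for rounding [log2 kappa + 1 / rho] down. *)
Lemma depth_le (L a r : nat) kappa rho (a0 : (0 < a)%N) (ar : (a <= r)%N) :
  2 <= kappa -> rho < 1 / 2 -> 1 / kappa <= rho ->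
  L%:R <= a%:R * kappa -> rho * L%:R <= r%:R ->
  (depth L a0 ar <= level_bound kappa rho)%N.
Proof.
move=> k2 r1 rk La Lr; have [r0 K3 l1 Kle Klt] := level_bound_spec k2 r1 rk.
set K := level_bound kappa rho in K3 Kle Klt *.
have k0 : 0 < kappa by lra.
have [_ [_ dmin]] := depth_spec L a0 ar; apply: dmin.
have kr1 : 1 <= kappa * rho by move: rk; rewrite ler_pdivrMr // mulrC.
have ex : exists i, kappa * rho < 2 ^+ i.
  exists (Num.truncn (kappa * rho)).+1; apply: lt_le_trans (truncnS_gt _) _.
  by rewrite -natrX ler_nat ltnW // ltn_expl.
case: (ex_minnP ex) => i1 i1lt imin.
have i1pos : (0 < i1)%N by case: (i1) i1lt => //; rewrite expr0; lra.
have i1le j : (j < i1)%N -> 2 ^+ j <= kappa * rho.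
  by move=> ji; rewrite leNgt; apply/negP => /imin; rewrite leqNgt ji.
(* By minimality 2^(i1 - 1) <= kappa * rho, and [rho < 1 / 2] saves the missing factor 2. *)
have i1k : i1%:R <= log2 kappa.
  rewrite -le_log2 // -(prednK i1pos) exprS.
  have := i1le i1.-1; rewrite prednK // leqnn => /(_ isT).
  have : kappa * rho <= kappa * (1 / 2) by apply: ler_wpM2l; lra.
  lra.
set l : R := L%:R in La Lr *; have l0 : 0 <= l by rewrite /l.
set m : R := l / kappa.
have m0 : 0 <= m by rewrite divr_ge0 // ltW.
have ma : m <= a%:R by rewrite ler_pdivrMr.
have lm : l = kappa * m by rewrite /m mulrC divfK // gt_eqF.
have exlo j : (expo a r j)%:R >= Num.min (2 ^+ j * a%:R) (r%:R : R).
  rewrite /expo /minn; case: ifP => _; last by rewrite ge_min lexx orbT.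
  by rewrite natrM natrX ge_min lexx.
have e1 j : (j < i1)%N -> 2 ^+ j * m <= (expo a r j)%:R.
  move=> ji; apply: le_trans (exlo j); rewrite le_min; apply/andP; split.
    by apply: ler_wpM2l.
  apply: le_trans Lr; rewrite lm mulrA [rho * _]mulrC.
  by apply: ler_wpM2r => //; apply: i1le.
have s1 j : (j <= i1)%N -> (2 ^+ j - 1) * m <= (expo_sum a r j)%:R.
  elim: j => [|j IH] ji; first by rewrite expr0 subrr mul0r.
  rewrite expo_sumS natrD; have := IH (ltnW ji); have := e1 j ji.
  rewrite exprS; lra.
have e2 j : (i1 <= j)%N -> rho * l <= (expo a r j)%:R.
  move=> ij; apply: le_trans (exlo j); rewrite le_min Lr andbT.
  apply: (@le_trans _ _ (2 ^+ j * m)); last by apply: ler_wpM2l.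
  rewrite lm mulrA [rho * _]mulrC; apply: ler_wpM2r => //.
  apply: le_trans (ltW i1lt) _; rewrite ler_eXn2l //; last by rewrite (ltr_nat R 1 2).
have s2 j : (kappa * rho - 1) * m + j%:R * (rho * l) <= (expo_sum a r (i1 + j))%:R.
  elim: j => [|j IH].
    rewrite mul0r addr0 addn0; apply: le_trans (s1 i1 (leqnn _)).
    by apply: ler_wpM2r => //; rewrite lerD2r ltW.
  rewrite addnS expo_sumS natrD -[j.+1%:R]natr1 [(j%:R + 1) * _]mulrDl mul1r.
  have := e2 (i1 + j)%N (leq_addr _ _); lra.
have iK : (i1 <= K)%N.
  rewrite -ltnS -(ltr_nat R); apply: le_lt_trans Klt.
  have := inv_gt2 r0 r1; lra.
have := s2 (K - i1)%N; rewrite subnKC // => sK.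
rewrite -(ler_nat R) natrD -/l.
have jr : 1 <= ((K - i1)%N%:R + 1) * rho.
  rewrite -ler_pdivrMr // natrB //; move: Klt; rewrite -natr1; lra.
have : m <= rho * l.
  by rewrite [rho * l]mulrC /m; apply: ler_wpM2l; rewrite // -div1r.
have : l <= ((K - i1)%N%:R + 1) * rho * l by rewrite ler_peMl.
have E1 : kappa * rho * m = rho * l by rewrite lm; ring.
move: sK; rewrite mulrBl E1 mul1r; lra.
Qed.

Lemma up_log_bound n : (2 <= n)%N -> (2 ^ up_log 2 n <= 2 * n)%N.
Proof.
move=> n2; have /andP[h _] := up_log_bounds (isT : 1 < 2)%N n2.
have l0 : (0 < up_log 2 n)%N by rewrite up_log_gt0.
by rewrite -(prednK l0) expnS leq_mul2l ltnW.
Qed.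

(** One factor 2 is lost by rounding the exponent [j] up, and another one, 2^theta, because
    [2 ^ up_log 2 n] may be almost [2 * n]. *)
Lemma pow2_le (n j : nat) (theta : R) : (2 <= n)%N -> 0 <= theta -> theta <= 1 ->
  j = 0%N \/ (0 < j)%N /\ j.-1%:R < theta * (up_log 2 n)%:R ->
  2 ^+ j <= 4 * n%:R `^ theta.
Proof.
move=> n2 t0 t1 hj; have n1 : 1 <= n%:R :> R by rewrite (ler_nat R 1) ltnW.
have p1 : 1 <= n%:R `^ theta.
  by rewrite -[leLHS](powRr0 (n%:R : R)); apply: ler_powR.
case: hj => [->|[j0 hj]]; first by rewrite expr0; lra.
have h1 : 2 ^+ j.-1 <= 2 `^ (theta * (up_log 2 n)%:R) :> R.
  rewrite -powR_mulrn //; apply: ler_powR; last exact: ltW.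
  by rewrite (ler_nat R 1 2).
have h2 : 2 `^ (theta * (up_log 2 n)%:R) <= (2 * n%:R) `^ theta :> R.
  rewrite mulrC powRrM powR_mulrn //; apply: ge0_ler_powR; rewrite ?nnegrE ?exprn_ge0 ?mulr_ge0 //.
  by rewrite -natrX -natrM ler_nat up_log_bound.
have h3 : 2 `^ theta <= 2 :> R.
  by rewrite -[leRHS]powRr1 //; apply: ler_powR => //; rewrite (ler_nat R 1 2).
rewrite -(prednK j0) exprS; move: h2; rewrite powRM //.
have : 2 `^ theta * n%:R `^ theta <= 2 * n%:R `^ theta.
  by apply: ler_wpM2r => //; apply: powR_ge0.
lra.
Qed.

Lemma log2_nat_ge n (m : nat) : (0 < m)%N -> m%:R <= log2 (n%:R : R) -> (2 ^ m <= n)%N.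
Proof.
move=> m0; case: n => [|n].
  rewrite /log2 ln0 // mul0r lern0; by case: m m0.
by rewrite -le_log2 ?ltr0n // -natrX ler_nat.
Qed.

Lemma up_log_le_log2 n : (256 <= n)%N -> 8 <= log2 (n%:R : R) /\
  (up_log 2 n)%:R <= 2 * log2 (n%:R : R).
Proof.
move=> n256; have n0 : 0 < n%:R :> R by rewrite ltr0n; lia.
have l8 : 8 <= log2 (n%:R : R).
  by rewrite -(le_log2 8) // -natrX ler_nat.
split=> //; have n2 : (2 <= n)%N by lia.
have /andP[h _] := up_log_bounds (isT : 1 < 2)%N n2.
have l0 : (0 < up_log 2 n)%N by rewrite up_log_gt0.
have : (up_log 2 n).-1%:R <= log2 (n%:R : R).
  by rewrite -le_log2 // -natrX ler_nat ltnW.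
rewrite -{2}(prednK l0) -natr1; lra.
Qed.

(** The number [J] of pieces exceeds [8 * K / eps], so that the relative error [8 * K / J] stays
    below [eps]. *)
Definition beta_fun kappa rho eps : nat :=
  let K := level_bound kappa rho in
  hopbound (Num.truncn ((8 * K)%:R / eps)).+1 K.

Lemma beta_fun_spec kappa rho eps : 2 <= kappa -> rho < 1 / 2 -> 1 / kappa <= rho ->
  0 < eps -> eps < 1 / 2 ->
  let K := level_bound kappa rho in let J := (Num.truncn ((8 * K)%:R / eps)).+1 in
  [/\ (6 <= J)%N, (8 * K)%:R <= eps * J%:R, (0 < beta_fun kappa rho eps)%N &
    forall C, 27 <= C -> (beta_fun kappa rho eps)%:R <=
      (C * ((log2 kappa + 1 / rho) / eps)) `^ (log2 kappa + 1 / rho)].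
Proof.
move=> k2 r1 rk e0 e1 K J; have [r0 K3 l1 Kle Klt] := level_bound_spec k2 r1 rk.
rewrite -/K in K3 Kle Klt.
have K3' : 3 <= K%:R :> R by rewrite (ler_nat R 3).
have q0 : 0 <= (8 * K)%:R / eps by rewrite divr_ge0 // ltW.
have ie : 1 / eps > 2 by apply: inv_gt2.
(* Here 24 is [8 * 3], from [3 <= K], and the factor 2 comes from [eps < 1 / 2]. *)
have q48 : 48 <= (8 * K)%:R / eps.
  rewrite -[_ / eps]mulr1 mulrAC -mulrA natrM.
  have : 24 * 2 <= (8 * K%:R) * (1 / eps) by apply: ler_pM; lra.
  by rewrite [_ * (1 / eps)]mulrC mulrC; lra.
have J1 : (8 * K)%:R / eps < J%:R by exact: truncnS_gt.
have J2 : J%:R <= (8 * K)%:R / eps + 1.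
  by rewrite /J -natr1 lerD2r truncn_le.
have J6 : (6 <= J)%N by rewrite -(ler_nat R); lra.
split=> //.
- by have := ltW J1; rewrite ler_pdivrMr // mulrC.
- by rewrite /beta_fun -/K -/J; case: (K) => //= K'; rewrite addn_gt0 orbT.
move=> C C27; rewrite /beta_fun -/K -/J.
set y := log2 kappa + 1 / rho in Kle Klt *.
have y3 : 3 <= y by lra.
(* The constant is 27 = 3 * (8 + 1): the 1 accounts for rounding up in [J] and is absorbed by
   [1 <= y / eps]. *)
have base : (3 * J)%:R <= C * (y / eps).
  have h1 : (8 * K)%:R / eps <= 8 * (y / eps).
    rewrite natrM mulrA; apply: ler_wpM2r; first by rewrite invr_ge0 ltW.
    by apply: ler_wpM2l.
  have h2 : 1 <= y / eps.
    by rewrite ler_pdivlMr //; lra.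
  have h3 : 27 * (y / eps) <= C * (y / eps) by apply: ler_wpM2r => //; lra.
  rewrite natrM; lra.
apply: (@le_trans _ _ ((3 * J)%:R ^+ K)).
  by rewrite -natrX ler_nat; apply: hopbound_le; rewrite (leq_trans _ J6).
apply: (@le_trans _ _ ((C * (y / eps)) ^+ K)).
  by rewrite ler_pXn2r ?nnegrE //; [rewrite (leq_trans _ K3)|apply: le_trans base].
have b1 : 1 <= C * (y / eps) by apply: le_trans base; rewrite (ler_nat R 1) muln_gt0.
rewrite -powR_mulrn; last by lra.
by apply: ler_powR.
Qed.

End Bounds.

(** * A complete execution of the program *)

Section Run.
Variables (R : realType) (n : nat) (G : wgraph R n) (l : seq ('I_n * 'I_n)).
Hypothesis HG : pos_int_weights G.
Hypothesis Hl : edge_listing G l.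
Hypothesis n256 : (256 <= n)%N.

Local Open Scope nat_scope.
Local Notation L := (up_log 2 n).
Local Notation P := (2 ^ L).
Local Notation M := (P * P).
Local Notation w := (4 * L).

Lemma n_le_P : n <= P. Proof. by apply: up_logP. Qed.

Lemma L_gt0 : 0 < L. Proof. by rewrite up_log_gt0; lia. Qed.

Lemma M_pow : M = 2 ^ (2 * L). Proof. by rewrite -expnD addnn mul2n. Qed.

Lemma w_pow : 2 ^ w = M * M.
Proof. by rewrite -!expnD; congr (2 ^ _); lia. Qed.

Lemma M_ge : 100 <= M.
Proof. have := n_le_P; move: n256; move: P => p; clear; nia. Qed.

Lemma nL_le : n * L <= M.
Proof. apply: leq_mul; first exact: n_le_P. by apply/ltnW/ltn_expl. Qed.

Lemma arcs_lt : 2 * size l < M.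
Proof.
have [un asym _] := Hl; pose l2 := l ++ [seq (e.2, e.1) | e <- l].
have nd u : (u, u) \notin l by apply/negP => h; have := asym _ _ h; rewrite h.
have ul2 : uniq l2.
  rewrite cat_uniq un map_inj_uniq ?un ?andbT; last by move=> [? ?] [? ?] [-> ->].
  apply/hasPn => _ /mapP[[u v] uv ->]; exact: asym.
have n0 : 0 < n by lia.
(* A diagonal pair, which is never listed, makes the inequality strict. *)
pose z := Ordinal n0.
have -> : 2 * size l = size l2 by rewrite size_cat size_map addnn mul2n.
rewrite -(card_uniqP ul2); apply: leq_trans (_ : n * n <= _); last first.
  by apply: leq_mul; exact: n_le_P.
have sub : l2 \subset predC1 (z, z).
  apply/fintype.subsetP => e; rewrite mem_cat !inE => h; apply/eqP => e1.
  move: h; rewrite e1 (negbTE (nd _)) /= => /mapP[[u v] uv [e2 e3]].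
  by move: uv; rewrite /= -e2 -e3 (negbTE (nd _)).
have := subset_leq_card sub; rewrite cardC1 card_prod card_ord => h.
by apply: leq_ltn_trans h _; rewrite prednK ?muln_gt0 ?n0.
Qed.

Lemma adj_neighbors v z : adj G v z = (z \in neighbors l v).
Proof. by rewrite mem_neighbors; have [_ _ ->] := Hl. Qed.

Lemma run_drop t c (s s1 : state R) (H : forall bs bs' k, size bs = t ->
    run w (bs ++ bs') (c :: k) s = run w bs' k s1) :
  forall bs k, t <= size bs -> run w bs (c :: k) s = run w (drop t bs) k s1.
Proof. by move=> bs k tb; rewrite -{1}(cat_take_drop t bs) H // size_takel. Qed.

Lemma treeok_zero (st : state R) : words st 3 =1 (fun=> 0) -> words st 7 =1 (fun=> 0) ->
  words st 8 =1 (fun=> 0) -> @treeok R n P M 0 st.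
Proof.
move=> h3 h7 h8; split; [split; [split|]|split].
- by move=> j _; rewrite !h3.
- by move=> c _; left; rewrite h3.
- by move=> j; rewrite h3.
- by move=> c _; rewrite h3.
- by move=> i; rewrite h7 h8.
Qed.

(** [d] counts the steps before the first round of the sampling loop. After [T] steps no bit is
    looked at any more, so the remaining time, the final state and the output are fixed by the first
    [T] bits, and time and size are bounded through the keys [x] alone. *)
Lemma run_summary kappa rho eps (s0 := init_state G l kappa rho eps) :
  (2 <= kappa)%R -> (rho < 1 / 2)%R -> (1 / kappa <= rho)%R ->
  exists (a r : nat) (a0 : 0 < a) (ar : a <= r) (d : nat),
  let k := depth L a0 ar in let T := d + (6 * (n * L) + 1) in
  [/\ (L%:R <= a%:R * kappa)%R, (a.-1%:R * kappa < L%:R)%R,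
      (rho * L%:R <= r%:R)%R & 0 < r /\ (r.-1%:R < rho * L%:R)%R] /\
  d <= 15 * L + 20 * size l + 60 /\
  forall bs, size bs = T -> exists t s' o,
    let x := fun v : 'I_n => sampled L (flips (n * L) (drop d bs)) v in
    [/\ t <= total_work G P (2 ^ r) (2 ^ a) x (2 * L) (neighbors l) k + k + 4,
        forall bs2 bs', size bs2 = t ->
          run w (bs ++ bs2 ++ bs') [:: hopset_prog] s0 = run w bs' [::] s',
        outrep P s' o /\ oexact G o,
        hierarchy_ok G P (2 ^ r) (2 ^ a) x k.+1 o &
        size o <= total_edges G P (2 ^ r) (2 ^ a) x k].
Proof.
move=> k2 r1 rk.
have nP := n_le_P; have L0 := L_gt0; have MP := M_pow; have HW := w_pow; have Mbig := M_ge.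
have k1 : (1 <= kappa)%R by lra.
have rr1 : (rho <= 1)%R by lra.
have [t1 [s1 [t1le [a [r [[e4 e22 e18 e19 sm1] [ka ha kr hr [aL rL]]]]] H1]]] :=
  init_spec erefl erefl erefl HW Mbig (erefl : words s0 0 0 = n)
    (erefl : reals s0 0 0 = kappa) (erefl : reals s0 0 1 = rho) k1 rr1.
have Lpos : (0 < L%:R :> R)%R by rewrite ltr0n.
have r0 : (0 < rho)%R.
  by apply: lt_le_trans rk; apply: divr_gt0; lra.
have a0 : 0 < a.
  by rewrite lt0n; apply/eqP => a0; move: ka; rewrite a0 mul0r; lra.
have {}ha : (a.-1%:R * kappa < L%:R)%R by case: ha => [e|[]//]; rewrite e in a0.
have rpos : 0 < r.
  rewrite lt0n; apply/eqP => e; move: kr; rewrite e; have := mulr_gt0 r0 Lpos; lra.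
have {}hr : (r.-1%:R < rho * L%:R)%R by case: hr => [e|[]//]; rewrite e in rpos.
have ar : a <= r.
  suff : (a.-1%:R < r%:R :> R)%R by rewrite ltr_nat; lia.
  apply: lt_le_trans kr; have kp : (0 < kappa)%R by lra.
  rewrite -ltr_pdivlMr // in ha; apply: lt_le_trans ha _.
  by rewrite mulrC; apply: ler_wpM2r; [apply: ltW|rewrite -div1r].
have h01 : words s1 0 1 = size l by rewrite (proj1 sm1).
have hl i d0 : i < size l -> [/\ words s1 1 i = (nth d0 l i).1,
   words s1 2 i = (nth d0 l i).2 & reals s1 1 i = wt G (nth d0 l i).1 (nth d0 l i).2].
  move=> il; rewrite !(proj1 sm1) // (proj2 sm1) //=.
  by rewrite !(nth_map d0).
have h9 i : words s1 9 i = 0 by rewrite (proj1 sm1).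
have [t2 [s2 [t2le [ok2 e00 e01 sm2] H2]]] := adj_spec erefl HW Mbig nP h01 arcs_lt hl h9.
have f4 : words s2 4 0 = P by rewrite (proj1 sm2).
have f22 : words s2 22 0 = L by rewrite (proj1 sm2).
have f00 : words s2 0 0 = n by rewrite e00 (proj1 sm1).
have f6 i : words s2 6 i = 0 by rewrite (proj1 sm2) // (proj1 sm1).
(* The 3 counts the unfolded [CSeq] around the initialisation, the adjacency lists and the sampling;
   the first two steps of the sampling itself are added afterwards. *)
pose d0 := t1 + t2 + 3.
exists a, r, a0, ar, (d0 + 2) => k T; split; first by split.
split; first by rewrite /d0; move: t1le t2le; clear; lia.
move=> bs sb; pose bsS := drop d0 bs.
have sS : size bsS = 6 * (n * L) + 3.
  by rewrite size_drop sb /T; clear; lia.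
have [s3 [x3 sm3 H3]] := sample_spec erefl erefl HW Mbig nP L0 f00 f22 nL_le f6 sS.
pose x := fun v : 'I_n => sampled L (flips (n * L) (drop (d0 + 2) bs)) v.
have x3' v : words s3 6 (val v) = x v by rewrite x3 /bsS drop_drop addnC.
pose s4 := State (upd (words s3) 16 0 P) (reals s3).
have sm4 : same [:: 16] [::] s3 s4 by apply: same_wstore => //; exact: same_refl.
have zero kk i : kk \in [:: 3; 7; 8; 12] -> words s4 kk i = 0.
  move=> hk; have nk (s : seq nat) : all (fun j => j \notin [:: 3; 7; 8; 12]) s -> kk \notin s.
    by move=> /allP hs; apply/negP => /hs; rewrite hk.
  rewrite (proj1 sm4) ?nk // (proj1 sm3) ?nk // (proj1 sm2) ?nk // (proj1 sm1) ?nk //=.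
  by move: hk; rewrite !inE => /or4P[] /eqP ->.
have L4 : lst G P M x (neighbors l) s4 P (2 ^ a) (2 ^ r) 0 [::].
  split; split.
  - split.
    + by rewrite (proj1 sm4) // (proj1 sm3).
    + by rewrite (proj1 sm4) // (proj1 sm3).
    + by move=> v; rewrite (proj1 sm4) // x3'.
    + move=> v; rewrite (proj1 sm4) // (proj1 sm3) //.
      apply: (chain_le erefl HW Mbig nP _ _ (ok2 v)) => [|i _].
        by apply: ltnW arcs_lt.
      by rewrite !(proj1 sm4) // !(proj1 sm3) // (proj2 sm4) // (proj2 sm3).
  - by apply: treeok_zero => i; apply: zero.
  - split=> //.
    + by rewrite (proj1 sm4) // (proj1 sm3).
    + by move=> u v; rewrite zero.
  - by move=> c _; apply: zero.
  - by [].
  - by rewrite (proj1 sm4) // (proj1 sm3) // (proj1 sm2).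
  - by rewrite (proj1 sm4) // (proj1 sm3) // (proj1 sm2).
  - by rewrite (proj1 sm4) // (proj1 sm3) // (proj1 sm2) // (proj1 sm1).
have [tpos _ _ tz] := tq_depth L a0 ar.
have fa : 2 <= 2 ^ a by rewrite -{1}(expn1 2) leq_exp2l.
have far : 2 ^ a <= 2 ^ r by rewrite leq_exp2l.
have rP : 2 ^ r <= P by rewrite leq_exp2l.
have trL := levels_spec HG fa far erefl HW MP Mbig nP rP adj_neighbors L4 tpos (tz _ (ltnSn _)).
have trM : tr w c_main s3 (1 + (total_work G P (2 ^ r) (2 ^ a) x (2 * L) (neighbors l) k + k.+2)).+1
    (fun st' => exists o, [/\ outrep P st' o, oexact G o,
      hierarchy_ok G P (2 ^ r) (2 ^ a) x k.+1 o &
      size o <= total_edges G P (2 ^ r) (2 ^ a) x k]).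
  apply: tr_seq; apply: (@tr_ws _ _ _ _ _ _ 0 P) => //=; first by rewrite mod0n.
  by rewrite mod0n (proj1 sm3).
have [t [s' [tle [ o' [oo1 oo2 oo3 oo4]] H4]]] := trM.
exists t, s', o'; split=> //.
  apply: leq_trans tle _; rewrite -/x; set W := total_work _ _ _ _ _ _ _ _.
  by clearbody W k; clear; lia.
move=> bs2 bs' st.
have sbd : d0 <= size bs by rewrite sb /T; clear; lia.
have -> : run w (bs ++ bs2 ++ bs') [:: hopset_prog] s0 =
    run w (drop d0 (bs ++ bs2 ++ bs')) [:: c_sample; c_main] s2.
  have big : d0 <= size (bs ++ bs2 ++ bs') by rewrite size_cat; apply: leq_trans sbd (leq_addr _ _).
  case: (bs ++ bs2 ++ bs') big => [|b0 b] bg; first by move: bg; rewrite /d0 /=; clear; lia.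
  rewrite [LHS]/= (run_drop H1); last by move: bg; rewrite /d0 /=; clear; lia.
  case E : (drop t1 b) => [|b1 b'].
    by have := congr1 size E; rewrite size_drop; move: bg; rewrite /d0 /=; clear; lia.
  have sE : size b' = size b - t1 - 1.
    by have := congr1 size E; rewrite size_drop /=; clear; lia.
  rewrite [LHS]/= (run_drop H2); last by rewrite sE; move: bg; rewrite /d0 /=; clear; lia.
  case E2 : (drop t2 b') => [|b2 b''].
    by have := congr1 size E2; rewrite size_drop sE; move: bg; rewrite /d0 /=; clear; lia.
  rewrite [LHS]/=; congr (run _ _ _ _).
  have -> : b'' = drop 1 (drop t2 (drop 1 (drop t1 b))) by rewrite E /= drop0 E2 /= drop0.
  by rewrite !drop_drop /d0 addn3 /=; congr drop; clear; lia.
have -> : drop d0 (bs ++ bs2 ++ bs') = bsS ++ bs2 ++ bs'.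
  rewrite drop_cat; case: ltnP => // h.
  have -> : d0 - size bs = 0 by move: h sbd; clear; lia.
  by rewrite drop0 /bsS (drop_oversize h).
by rewrite H3 H4.
Qed.

End Run.

(** * Expected size and time *)

Section Expected.
Variables (R : realType) (n L : nat) (G : wgraph R n).
Hypothesis HG : pos_int_weights G.
Hypothesis L0 : (0 < L)%N.
Hypothesis nP : (n <= 2 ^ L)%N.
Local Notation P := (2 ^ L)%N.
Local Notation avg := (@avg R (n * L)).
Local Notation q := (level_prob R L).
Local Notation sz := (level_size R n L).
Implicit Types (nb : 'I_n -> seq 'I_n).

Lemma level_size_ge0 th tp : (tp <= th)%N -> (th <= P)%N -> 0 <= sz th tp.
Proof.
move=> tt thP; apply: sumr_ge0 => j _.
apply: mulr_ge0; first exact: level_prob_ge0.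
by apply: exprn_ge0; exact: pivot_free_ge0 tt thP.
Qed.

Lemma avg_work nb th tp : (tp <= th)%N -> (th <= P)%N ->
  avg (fun b => (work G (fun v => sampled L b v) nb th tp)%:R) <=
  (deg_sum nb)%:R * sz th tp.
Proof.
move=> tt thP.
rewrite (@eq_avg _ _ _ (fun b => \sum_(v : 'I_n) (size (nb v)).+1%:R *
    \sum_(s : 'I_n) (allowed G (fun v => sampled L b v) th tp s v)%:R)); last first.
  move=> b _; rewrite /work natr_sum big_mkcond /=.
  rewrite -(pair_bigA _ (fun s v => if allowed G _ th tp s v then (size (nb v)).+1%:R else 0)) /=.
  rewrite exchange_big; apply: eq_bigr => v _; rewrite big_distrr; apply: eq_bigr => s _ /=.
  by case: ifP; rewrite ?mulr1 ?mulr0.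
rewrite avg_bigsum /deg_sum natr_sum big_distrl; apply: ler_sum => v _ /=.
rewrite avgZ ler_wpM2l //; exact: avg_allowed.
Qed.

Lemma avg_new_edges th tp : (tp <= th)%N -> (th <= P)%N ->
  avg (fun b => (new_edges G (fun v => sampled L b v) th tp)%:R) <=
  n%:R * (q th tp * sz th tp).
Proof.
move=> tt thP.
rewrite (@eq_avg _ _ _ (fun b => \sum_(v : 'I_n) \sum_(s : 'I_n)
    [&& allowed G (fun v => sampled L b v) th tp s v, (sampled L b v < th)%N & s != v]%:R)).
  rewrite avg_bigsum.
  apply: le_trans (_ : \sum_(v : 'I_n) q th tp * sz th tp <= _).
    by apply: ler_sum => v _; apply: avg_edges.
  by rewrite sumr_const card_ord -[leLHS]mulr_natl.
move=> b _; rewrite /new_edges cardsE -sum1_card natr_sum big_mkcond /=.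
rewrite exchange_big pair_bigA; apply: eq_bigr => -[s v] _ /=.
by rewrite unfold_in; case: ifP.
Qed.

Variables (a r : nat).
Hypothesis a0 : (0 < a)%N.
Hypothesis ar : (a <= r)%N.
Hypothesis rL : (r <= L)%N.
Local Notation f := (fq (2 ^ r) (2 ^ a)).
Local Notation t := (tq P (2 ^ r) (2 ^ a)).
Local Notation k := (depth L a0 ar).

Lemma f0_ge2 : (2 <= 2 ^ a)%N. Proof. by rewrite -{1}(expn1 2) leq_exp2l. Qed.

Lemma f0_le : (2 ^ a <= 2 ^ r)%N. Proof. by rewrite leq_exp2l. Qed.

Lemma t_le j : (t j.+1 <= t j)%N.
Proof. by have := tq_half P f0_ge2 f0_le j; lia. Qed.

Lemma t_leP j : (t j <= P)%N.
Proof. exact: tq_leP f0_ge2 f0_le _. Qed.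

Lemma t_last : t k.+1 = 0%N.
Proof. by have [_ _ _ ->] := tq_depth L a0 ar. Qed.

Lemma level_size_le j : (j < k)%N -> sz (t j) (t j.+1) <= (f j)%:R.
Proof.
move=> jk; have [tpos te _ _] := tq_depth L a0 ar.
by apply: level_size_pivots; rewrite ?t_le ?t_leP ?te ?tpos.
Qed.

Lemma level_size_depth : sz (t k) (t k.+1) <= 2 ^+ r.
Proof.
have [_ _ tk _] := tq_depth L a0 ar.
rewrite t_last level_size_last // mulrCA -natrX; apply: le_trans (_ : (t k)%:R * 1 <= _).
  apply: ler_wpM2l => //; rewrite ler_pdivrMr ?ltr0n ?expn_gt0 // mul1r.
  by rewrite ler_nat.
by rewrite mulr1 ler_nat.
Qed.

Lemma edges_le j : (j < k)%N -> q (t j) (t j.+1) * sz (t j) (t j.+1) <= 2 ^+ a.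
Proof.
move=> jk; have PP : 0 < P%:R :> R by rewrite ltr0n expn_gt0.
apply: le_trans (_ : (t j)%:R / P%:R * (f j)%:R <= _).
  apply: ler_pM; rewrite ?level_prob_ge0 ?level_size_le //.
    by apply: level_size_ge0; rewrite ?t_le ?t_leP.
  by rewrite ler_pM2r ?invr_gt0 // ler_nat leq_subr.
rewrite mulrAC ler_pdivrMr // -natrX -!natrM ler_nat mulnC [leqRHS]mulnC mulnC.
exact: tq_fq.
Qed.

(** Without pivots any two vertices of the last level may be joined, but their expected number is at
    most [2 ^ r]. *)
Lemma edges_depth : n%:R * (q (t k) (t k.+1) * sz (t k) (t k.+1)) <= (2 ^+ r) ^+ 2.
Proof.
rewrite mulrA expr2; have PP : 0 < P%:R :> R by rewrite ltr0n expn_gt0.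
have [_ _ tk _] := tq_depth L a0 ar.
apply: ler_pM.
- by rewrite mulr_ge0 ?level_prob_ge0.
- by apply: level_size_ge0; rewrite ?t_le ?t_leP.
- rewrite /level_prob mulrCA -natrX; apply: le_trans (_ : (t k)%:R * 1 <= _).
    rewrite t_last subn0; apply: ler_wpM2l => //; rewrite ler_pdivrMr // mul1r.
    by rewrite ler_nat.
  by rewrite mulr1 ler_nat.
- exact: level_size_depth.
Qed.

Lemma avg_total_work nb (D : nat) :
  avg (fun b => (total_work G P (2 ^ r) (2 ^ a) (fun v => sampled L b v) D nb k)%:R) <=
  (5 * D + 70)%:R * (k.+1%:R * (4 * n + 2 * deg_sum nb + 2)%:R +
    2 * (deg_sum nb)%:R * ((\sum_(j < k) f j)%:R + 2 ^+ r)).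
Proof.
rewrite (@eq_avg _ _ _ (fun b => \sum_(j < k.+1) ((5 * D + 70)%:R *
   ((4 * n + 2 * deg_sum nb + 2)%:R + 2 *
     (work G (fun v => sampled L b v) nb (t j) (t j.+1))%:R)))); last first.
  move=> b _; rewrite /total_work natr_sum; apply: eq_bigr => j _.
  rewrite /level_cost -natrM -natrD -natrM; congr _%:R; lia.
rewrite avg_bigsum.
apply: le_trans (_ : \sum_(j < k.+1) ((5 * D + 70)%:R *
   ((4 * n + 2 * deg_sum nb + 2)%:R + 2 * ((deg_sum nb)%:R * sz (t j) (t j.+1)))) <= _).
  apply: ler_sum => j _; rewrite avgZ avgD avg_cst avgZ ler_wpM2l // lerD2l ler_wpM2l //.
  by apply: avg_work; rewrite ?t_le ?t_leP.
rewrite -mulr_sumr ler_wpM2l // big_split sumr_const card_ord /= -[X in X + _ <= _]mulr_natl lerD2l.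
rewrite -!mulr_sumr mulrA ler_wpM2l ?mulr_ge0 // big_ord_recr /= natr_sum.
by apply: lerD level_size_depth; apply: ler_sum => j _; apply: level_size_le.
Qed.

Lemma avg_total_edges :
  avg (fun b => (total_edges G P (2 ^ r) (2 ^ a) (fun v => sampled L b v) k)%:R) <=
  k.+1%:R * n%:R * (1 + 2 ^+ a) + (2 ^+ r) ^+ 2.
Proof.
rewrite (@eq_avg _ _ _ (fun b => \sum_(j < k.+1) (n%:R +
     (new_edges G (fun v => sampled L b v) (t j) (t j.+1))%:R))); last first.
  by move=> b _; rewrite /total_edges natr_sum; apply: eq_bigr => j _; rewrite natrD.
rewrite avg_bigsum.
apply: le_trans (_ : \sum_(j < k.+1) (n%:R +
   n%:R * (q (t j) (t j.+1) * sz (t j) (t j.+1))) <= _).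
  apply: ler_sum => j _; rewrite avgD avg_cst lerD2l.
  by apply: avg_new_edges; rewrite ?t_le ?t_leP.
rewrite big_split sumr_const card_ord /= -[X in X + _ <= _]mulr_natl mulrDr mulr1 -addrA lerD2l.
rewrite big_ord_recr /=; apply: lerD edges_depth.
apply: le_trans (_ : \sum_(j < k) n%:R * 2 ^+ a <= _).
  by apply: ler_sum => j _; rewrite ler_wpM2l // edges_le.
rewrite sumr_const card_ord -[X in X <= _]mulr_natl -mulrA ler_wpM2r ?mulr_ge0 ?exprn_ge0 //.
by rewrite ler_nat.
Qed.

End Expected.

(** * Halting runs as extensions of a random prefix *)

Section Halting.
Variables (R : realType) (w : nat).
Implicit Types (p : cmd) (s : state R).

Lemma run_cat bs bs' ks s s' : run w bs ks s = Some s' ->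
  run w (bs ++ bs') ks s = run w bs' [::] s'.
Proof.
elim: bs ks s => [|b bs IH] [|c ks] s //=; first by case=> ->.
exact: IH.
Qed.

Lemma run_prefix p s s1 bs bs' : run w (bs ++ bs') [:: p] s = Some s1 ->
  bs' <> [::] -> run w bs [:: p] s = None.
Proof.
case E : (run w bs [:: p] s) => [s'|] //; rewrite (run_cat _ E).
by case: bs'.
Qed.

(** No halting run is a proper prefix of another one. A halting run that is too short is refuted by
    padding it with arbitrary bits to a run covered by [H]; one that is too long has such a run as a
    proper prefix. *)
Lemma run_halting p s T (t : seq bool -> nat) (sf : seq bool -> state R) :
  (forall b b' bs, size b = T -> size b' = t b ->
     run w (b ++ b' ++ bs) [:: p] s = run w bs [::] (sf b)) ->
  forall bs s', run w bs [:: p] s = Some s' <->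
    [/\ (T <= size bs)%N, size bs = (T + t (take T bs))%N & s' = sf (take T bs)].
Proof.
move=> H bs s'; split=> [E|[h1 h2 ->]]; last first.
  rewrite -{1}(cat_take_drop T bs) -[drop T bs]cats0 H //; first exact: size_takel.
  by rewrite size_drop h2 addKn.
have Tb : (T <= size bs)%N.
  rewrite leqNgt; apply/negP => bT; pose e := nseq (T - size bs) false.
  have sb : size (bs ++ e) = T by rewrite size_cat size_nseq subnKC // ltnW.
  have := H _ (nseq (t (bs ++ e)) false) [::] sb (size_nseq _ _).
  rewrite -catA => /run_prefix; rewrite E.
  suff e0 : e ++ nseq (t (bs ++ e)) false ++ [::] <> [::] by move=> /(_ e0).
  by rewrite /e; move: bT; rewrite -subn_gt0; case: (_ - _)%N.
have sb := size_takel Tb; set b := take T bs in sb *.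
have eb : bs = b ++ drop T bs by rewrite cat_take_drop.
have tb : (t b <= size (drop T bs))%N.
  rewrite leqNgt; apply/negP => bt; pose e := nseq (t b - size (drop T bs)) false.
  have sb' : size (drop T bs ++ e) = t b by rewrite size_cat size_nseq subnKC // ltnW.
  have := H _ _ [::] sb sb'; rewrite cats0 catA -eb => /run_prefix; rewrite E.
  suff e0 : e <> [::] by move=> /(_ e0).
  by rewrite /e; move: bt; rewrite -subn_gt0; case: (_ - _)%N.
have := H b (take (t b) (drop T bs)) (drop (t b) (drop T bs)) sb (size_takel tb).
rewrite cat_take_drop -eb E; case D : (drop (t b) (drop T bs)) => [|x y] // [->].
split=> //; have := congr1 size D; rewrite !size_drop /= => D1.
by move: tb; rewrite size_drop; lia.
Qed.

End Halting.

(** * Asymptotic estimates with explicit constants *)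

Section Asymptotics.
Variables (R : realType) (n : nat).
Implicit Types (kappa rho : R).
Local Notation lg := (log2 (n%:R : R)).

Lemma size_listing (G : wgraph R n) l : edge_listing G l -> (size l <= nedges G)%N.
Proof.
move=> [ul al el]; pose swap (e : 'I_n * 'I_n) := if (e.1 < e.2)%N then e else (e.2, e.1).
have inj : {in l &, injective swap}.
  move=> [u v] [u' v'] h h'; rewrite /swap /=; case: ifP => _; case: ifP => _ //.
  - by case=> e1 e2; move: (al _ _ h'); rewrite -e1 -e2 h.
  - by case=> e1 e2; move: (al _ _ h'); rewrite -e1 -e2 h.
  - by case=> -> ->.
have us : uniq (map swap l) by rewrite map_inj_in_uniq.
rewrite -(size_map swap) -(card_uniqP us) /nedges; apply: subset_leq_card.
apply/fintype.subsetP => _ /mapP[[u v] h ->]; rewrite inE /swap /=.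
have a1 : adj G u v by rewrite el h.
case: ltngtP => //= uv; rewrite ?a1 ?uv //; first by rewrite adj_sym a1.
by move: a1; rewrite (val_inj uv) adj_irr.
Qed.

Lemma ln2_ge : 1 / 2 <= ln 2 :> R.
Proof.
have -> : 2 = (1 / 2)^-1 :> R by rewrite div1r invrK.
rewrite lnV ?posrE //; have := @le_ln1Dx R (1 / 2 - 1).
rewrite (_ : 1 + (1 / 2 - 1) = 1 / 2); last by ring.
have h : - 1 < 1 / 2 - 1 :> R by lra.
by move=> /(_ h); lra.
Qed.

Lemma log2_le2 kappa : 0 < kappa -> log2 kappa <= 2 * kappa.
Proof.
move=> k0; rewrite /log2 ler_pdivrMr; last exact: ln2_gt0.
have h1 : ln kappa <= kappa - 1.
  have := @le_ln1Dx R (kappa - 1); rewrite (_ : 1 + (kappa - 1) = kappa); last by ring.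
  by apply; lra.
have : 2 * kappa * (1 / 2) <= 2 * kappa * ln 2 by apply: ler_wpM2l ln2_ge; lra.
lra.
Qed.

Definition admissible kappa rho : Prop :=
  [/\ 2 <= kappa, kappa <= lg / 4, rho < 1 / 2 & 1 / kappa <= rho].

Lemma n_ge256 kappa rho : admissible kappa rho ->
  (256 <= n)%N.
Proof. move=> [k2 k4 _ _]; apply: (@log2_nat_ge R n 8) => //; lra. Qed.

Lemma rho_gt0 kappa rho : admissible kappa rho ->
  0 < rho.
Proof. by move=> [k2 _ r1 rk]; have [] := level_bound_spec k2 r1 rk. Qed.

Lemma n_gt0 kappa rho : admissible kappa rho ->
  0 < n%:R :> R.
Proof. by move=> /n_ge256 h; rewrite ltr0n; lia. Qed.

Lemma powR_rho kappa rho : admissible kappa rho ->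
  1 <= n%:R `^ rho /\ rho * lg / 2 <= n%:R `^ rho.
Proof.
move=> H; have [k2 k4 r1 rk] := H.
have r0 := rho_gt0 H; have n0 := n_gt0 H.
have n1 : 1 <= n%:R :> R by rewrite (ler_nat R 1); have := n_ge256 H; lia.
split; first by rewrite -[leLHS](powRr0 (n%:R : R)); apply: ler_powR => //; apply: ltW.
rewrite /powR gt_eqF //; apply: le_trans (expR_ge1Dx _).
suff : rho * lg / 2 <= rho * ln n%:R by move=> h; rewrite (le_trans h) // lerDr.
rewrite -mulrA ler_wpM2l ?(ltW r0) // /log2 -mulrA ler_piMr ?ln_ge0 //.
rewrite -invfM invf_le1 ?mulr_gt0 ?ln2_gt0 //.
by have := ln2_ge; lra.
Qed.

Lemma X_ge kappa rho (X := n%:R `^ rho / rho) : admissible kappa rho ->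
  [/\ 1 / rho <= X, lg / 2 <= X, 2 <= X & 8 <= lg].
Proof.
move=> H; have [k2 k4 r1 rk] := H.
have r0 := rho_gt0 H; have [p1 p2] := powR_rho H; have i2 := inv_gt2 r0 r1.
have h1 : 1 / rho <= X by rewrite ler_wpM2r ?invr_ge0 // ltW.
split=> //; [|by move: h1 i2; clear; lra|by move: k2 k4; clear; lra].
by rewrite ler_pdivlMr // mulrC mulrA.
Qed.

Lemma depth_le_X kappa rho k (X := n%:R `^ rho / rho) : admissible kappa rho ->
  k%:R <= log2 kappa + 1 / rho ->
  k.+1%:R <= 3 * X /\ k.+1%:R <= lg.
Proof.
move=> H kle; have [k2 k4 r1 rk] := H.
have [h1 h2 h3 h4] := X_ge H; rewrite -/X in h1 h2 h3; have k0 : 0 < kappa by move: k2; clear; lra.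
have h5 := log2_le2 k0; have h6 : 1 / rho <= kappa.
  rewrite ler_pdivrMr ?(rho_gt0 H) // mulrC -ler_pdivrMr //.
rewrite -natr1; move: kle h1 h2 h3 h4 h5 h6 k4; move: X (1 / rho) (log2 kappa) lg k%:R.
by clear; move=> *; split; lra.
Qed.

Lemma edges_bound kappa rho (k a r : nat) : admissible kappa rho ->
  (0 < a)%N -> (0 < r)%N ->
  k%:R <= log2 kappa + 1 / rho ->
  a.-1%:R * kappa < (up_log 2 n)%:R -> r.-1%:R < rho * (up_log 2 n)%:R ->
  k.+1%:R * n%:R * (1 + 2 ^+ a) + (2 ^+ r) ^+ 2 <=
  2000 * (n%:R `^ (1 + 1 / kappa) * lg).
Proof.
move=> H a0 r0 /(depth_le_X H)[_ kl] ha hr; have [k2 k4 r1 rk] := H.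
 have n0 := n_gt0 H; have n256 := n_ge256 H.
have [p1 _] := powR_rho H; have [_ _ _ l8] := X_ge H.
have k0 : 0 < kappa by move: k2; clear; lra.
have ik0 : 0 <= 1 / kappa by rewrite divr_ge0 // ltW.
have ik1 : 1 / kappa <= 1 by rewrite ler_pdivrMr // mul1r; move: k2; clear; lra.
have n2 : (2 <= n)%N by move: n256; clear; lia.
have n1 : 1 <= n%:R :> R by rewrite (ler_nat R 1); move: n256; clear; lia.
have ea : 2 ^+ a <= 4 * n%:R `^ (1 / kappa).
  by apply: pow2_le => //; right; split=> //; rewrite mulrC mulrA mulr1 ltr_pdivlMr.
have er : 2 ^+ r <= 4 * n%:R `^ rho.
  apply: pow2_le => //; [exact: ltW (rho_gt0 H)|by move: r1; clear; lra|by right].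
have q1 : 1 <= n%:R `^ (1 / kappa).
  by rewrite -[leLHS](powRr0 (n%:R : R)); apply: ler_powR.
have eN : n%:R `^ (1 + 1 / kappa) = n%:R * n%:R `^ (1 / kappa).
  by rewrite powRD ?powRr1 ?(ltW n0) //; apply/implyP => _; rewrite gt_eqF.
(* The last level stays linear because [2 * rho < 1]; 16 is the square of the constant of
   [pow2_le]. *)
have e2 : (2 ^+ r) ^+ 2 <= 16 * n%:R :> R.
  have -> : 16 * n%:R = (4 * 4) * n%:R :> R by ring.
  apply: le_trans (_ : (4 * n%:R `^ rho) ^+ 2 <= _).
    by rewrite ler_pXn2r ?nnegrE ?exprn_ge0 ?mulr_ge0 ?powR_ge0.
  rewrite exprMn expr2 ler_wpM2l // -powR_mulrn ?powR_ge0 // -powRrM.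
  rewrite -[leRHS]powRr1 ?(ltW n0) //; apply: ler_powR => //.
  by move: r1; clear; lra.
rewrite eN; set Q := n%:R `^ (1 / kappa) in ea q1 *.
apply: le_trans (_ : lg * n%:R * (5 * Q) + 16 * n%:R <= _).
  apply: lerD => //; apply: ler_pM; rewrite ?mulr_ge0 ?addr_ge0 ?exprn_ge0 //.
    by rewrite ler_wpM2r ?(ltW n0).
  by move: ea q1; clear; lra.
have Q1 : n%:R * 8 <= n%:R * (Q * lg).
  rewrite ler_wpM2l ?(ltW n0) //; rewrite -[leLHS]mul1r; apply: ler_pM => //.
have Q0 : 0 <= n%:R * Q * lg by apply: mulr_ge0; [apply: mulr_ge0; rewrite ?powR_ge0|lra].
lra.
Qed.

Lemma time_bound kappa rho (m d k r F dg : nat) (X := n%:R `^ rho / rho) :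
  admissible kappa rho -> (0 < r)%N -> dg = (n + 2 * m)%N ->
  (d <= 15 * up_log 2 n + 20 * m + 60)%N -> k%:R <= log2 kappa + 1 / rho ->
  rho * (up_log 2 n)%:R <= r%:R -> r.-1%:R < rho * (up_log 2 n)%:R ->
  (r * F <= 2 ^ r * (2 * r + up_log 2 n))%N ->
  (d + (6 * (n * up_log 2 n) + 1))%:R + (k + 4)%:R +
  (5 * (2 * up_log 2 n) + 70)%:R * (k.+1%:R * (4 * n + 2 * dg + 2)%:R +
    2 * dg%:R * (F%:R + 2 ^+ r)) <=
  2000 * ((m%:R + n%:R * lg) * X * lg).
Proof.
move=> H rp -> dle kle rL hr hF; have [k2 k4 r1 rk] := H.
have [kX kl] := depth_le_X H kle.
have [h1 h2 h3 l8] := X_ge H; rewrite -/X in kX h1 h2 h3; have n256 := n_ge256 H; have [p1 _] := powR_rho H.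
have r0 := rho_gt0 H; have n0 := n_gt0 H.
have n2 : (2 <= n)%N by move: n256; clear; lia.
have [_ Ll] := up_log_le_log2 R n256.
have er : 2 ^+ r <= 4 * n%:R `^ rho.
  apply: pow2_le => //; [exact: ltW|by move: r1; clear; lra|by right].
have rp' : 0 < r%:R :> R by rewrite ltr0n.
(* From [L / r <= 1 / rho] the sum is at most 2^r (3 + 1 / rho), hence at most 2^r * (5 / 2) / rho
   as [2 < 1 / rho]; finally 2^r <= 4 n^rho. *)
have FX : F%:R + 2 ^+ r <= 10 * X.
  have f1 : F%:R <= 2 ^+ r * (2 + 1 / rho).
    rewrite -(ler_pM2l rp'); apply: le_trans (_ : 2 ^+ r * (2 * r%:R + (up_log 2 n)%:R) <= _).
      by rewrite -natrX -!natrM -natrD -natrM ler_nat.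
    rewrite mulrCA ler_wpM2l ?exprn_ge0 // mulrDr [r%:R * 2]mulrC lerD2l.
    by rewrite mulrA mulr1 ler_pdivlMr // mulrC.
  have i2 := inv_gt2 r0 r1.
  apply: le_trans (_ : 2 ^+ r * (5 / 2 * (1 / rho)) <= _).
    apply: le_trans (_ : 2 ^+ r * (3 + 1 / rho) <= _).
      by move: f1; rewrite -[3]/(1 + 2 : R) -addrA [in leRHS]mulrDr mulr1; lra.
    by rewrite ler_wpM2l ?exprn_ge0 //; move: i2; clear; lra.
  apply: le_trans (_ : 4 * n%:R `^ rho * (5 / 2 * (1 / rho)) <= _).
    by rewrite ler_wpM2r // mulr_ge0 // divr_ge0 // ltW.
  by rewrite le_eqVlt; apply/orP; left; apply/eqP; rewrite /X; field; rewrite gt_eqF.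
have dR : d%:R <= 15 * (up_log 2 n)%:R + 20 * m%:R + 60 :> R.
  by rewrite -!natrM -!natrD ler_nat.
have X0 : 0 <= X by move: h3; clear; lra.
rewrite !natrD !natrM -[k.+1%:R]natr1 in kX *.
have m0 : 0 <= m%:R :> R by [].
have k0 : 0 <= k%:R :> R by [].
have n16 : 256 <= n%:R :> R by rewrite (ler_nat R 256).
have s0 : 0 <= F%:R + 2 ^+ r :> R by rewrite addr_ge0 ?exprn_ge0.
move: dR m0 k0 kX FX n16 s0 X0 h3 l8 Ll.
clear h1 h2; clearbody X; have : 0 <= (up_log 2 n)%:R :> R by [].
move: ((up_log 2 n)%:R : R) (F%:R + 2 ^+ r : R) X (n%:R : R) (m%:R : R) (k%:R : R) (d%:R : R) lg.
clear; move=> L Y X N m k d l L0 dR m0 k0 kX YX N0 Y0 X0 X2 l8 Ll.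
(* The main term gets 30 * (3 * 6 + 4 * 10) = 1740, with 30 from [10 * L + 70 <= 30 * l]; the
   lower-order terms fit into the remaining 260. *)
set A := m + N * l.
have Nl : 8 * N <= N * l by rewrite mulrC ler_wpM2l //; lra.
have A0 : 2048 <= A by rewrite /A; lra.
have lA : 256 * l <= A.
  have : 256 * l <= N * l by rewrite ler_wpM2r //; lra.
  by rewrite /A; lra.
have NL : N * L <= 2 * A.
  have : N * L <= N * (2 * l) by rewrite ler_wpM2l //; lra.
  by rewrite /A; lra.
have i1 : (k + 1) * (4 * N + 2 * (N + 2 * m) + 2) <= 3 * X * (6 * A).
  by apply: ler_pM; rewrite /A; lra.
have i2 : 2 * (N + 2 * m) * Y <= 4 * A * (10 * X).
  by apply: ler_pM; rewrite /A; lra.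
have i3 : (5 * (2 * L) + 70) * ((k + 1) * (4 * N + 2 * (N + 2 * m) + 2) +
    2 * (N + 2 * m) * Y) <= 30 * l * (58 * (A * X)).
  apply: ler_pM; [lra| |lra|].
    by rewrite addr_ge0 // !mulr_ge0 //; lra.
  by move: i1 i2; lra.
have AX : 2 * A <= A * X by rewrite mulrC ler_wpM2l //; lra.
have XA : 2048 * X <= A * X by rewrite ler_wpM2r //; lra.
have AXl : 8 * (A * X) <= A * X * l by rewrite mulrC ler_wpM2l //; lra.
have e3 : 30 * l * (58 * (A * X)) = 1740 * (A * X * l) by ring.
have mA : m <= A by rewrite /A; lra.
lra.
Qed.

End Asymptotics.

(** Levels beyond the true depth are empty, so all requirements on them are void; this lets the hop
    bound refer to [level_bound] instead of the depth, which depends on [n]. *)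
Lemma hierarchy_ok_ge (R : realType) (n : nat) (G : wgraph R n) P Rr f0 x k K
    (o : seq ('I_n * 'I_n * R)) : (k <= K)%N -> (forall j, (k < j)%N -> tq P Rr f0 j = 0%N) ->
  hierarchy_ok G P Rr f0 x k.+1 o -> hierarchy_ok G P Rr f0 x K.+1 o.
Proof.
move=> kK tz ho j jK; have [jk|kj] := ltnP j k.+1; first exact: ho.
split=> [p v d|s v d]; first by rewrite tz ?ltn0 // ltnW.
by rewrite (tz j).
Qed.

Theorem theorem4p6 (R : realType) :
  exists (p : cmd) (c : nat) (C : R) (beta : R -> R -> R -> nat),
    0 < C /\
    (forall kappa rho eps : R,
       2 <= kappa -> rho < 1 / 2 -> 1 / kappa <= rho -> 0 < eps -> eps < 1 / 2 ->
       (0 < beta kappa rho eps)%N /\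
       (beta kappa rho eps)%:R <=
         (C * ((log2 kappa + 1 / rho) / eps)) `^ (log2 kappa + 1 / rho)) /\
    (forall (n : nat) (G : wgraph R n) (l : seq ('I_n * 'I_n))
            (kappa rho eps : R),
       pos_int_weights G -> edge_listing G l ->
       2 <= kappa -> kappa <= log2 n%:R / 4 ->
       rho < 1 / 2 -> 1 / kappa <= rho -> 0 < eps -> eps < 1 / 2 ->
       let w := (c * up_log 2 n)%N in
       let s0 := init_state G l kappa rho eps in
       expect w p s0 (fun=> 1) = 1%E /\
       exists H : seq bool -> wgraph R n,
         [/\ forall (bs : seq bool) (s : state R),
               run w bs [:: p] s0 = Some s ->
               outputs s (H bs) /\
               is_hopset G (H bs) (beta kappa rho eps) eps,
             (expect w p s0 (fun bs => (nedges (H bs))%:R) <=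
               (C * (n%:R `^ (1 + 1 / kappa) * log2 n%:R))%:E)%E &
             (expect w p s0 (fun bs => (size bs)%:R) <=
               (C * (((nedges G)%:R + n%:R * log2 n%:R) *
                     (n%:R `^ rho / rho) * log2 n%:R))%:E)%E]).
Proof.
(* Words of [4 * up_log 2 n] bits have modulus [M * M], where [M] is the number of codes of
   pairs. *)
exists hopset_prog, 4%N, 2000, (@beta_fun R); split; first by rewrite ltr0n.
split.
  move=> kappa rho eps k2 r1 rk e0 e1; have [_ _ b0 b1] := beta_fun_spec k2 r1 rk e0 e1.
  by split=> //; apply: b1; rewrite ler_nat.
move=> n G l kappa rho eps HG Hl k2 k4 r1 rk e0 e1 w s0.
have adm : admissible n kappa rho by split.
have n256 := n_ge256 adm.
have [a [r [a0 [ar [d [[La ha Lr [rp hr]] [dle Hrun]]]]]]] :=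
  run_summary HG Hl n256 eps k2 r1 rk.
move: Hrun; set L := up_log 2 n in La ha Lr hr dle *.
set k := depth L a0 ar; set T := (d + _)%N => Hrun.
have L0 : (0 < L)%N := L_gt0 n256.
have nP : (n <= 2 ^ L)%N := n_le_P n.
have rL : (r <= L)%N.
  suff : (r.-1 < L)%N by move: rp; clear; lia.
  rewrite -(ltr_nat R); apply: lt_le_trans hr _.
  by rewrite ger_pMl ?ltr0n //; lra.
pose x (b : seq bool) := fun v : 'I_n => sampled L (flips (n * L) (drop d b)) v.
pose spec b (y : nat * state R * seq ('I_n * 'I_n * R)) : Prop := size b = T ->
  [/\ (y.1.1 <= total_work G (2 ^ L) (2 ^ r) (2 ^ a) (x b) (2 * L) (neighbors l) k + k + 4)%N,
      forall b' bs, size b' = y.1.1 ->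
        run w (b ++ b' ++ bs) [:: hopset_prog] s0 = run w bs [::] y.1.2,
      outrep (2 ^ L) y.1.2 y.2 /\ oexact G y.2,
      hierarchy_ok G (2 ^ L) (2 ^ r) (2 ^ a) (x b) k.+1 y.2 &
      (size y.2 <= total_edges G (2 ^ L) (2 ^ r) (2 ^ a) (x b) k)%N].
(* Choice turns the remaining time, the final state and the output into functions of the first [T]
   bits; on strings of other lengths the value is arbitrary. *)
have /boolp.choice[g Hg] : forall b, exists y, spec b y.
  move=> b; have [/Hrun[t [s' [ o h]]]|nb] := boolp.pselect (size b = T).
    by exists (t, s', o).
  by exists (0%N, s0, [::]) => /nb.
have hal := @run_halting R w hopset_prog s0 T (fun b => (g b).1.1) (fun b => (g b).1.2)
  (fun b b' bs sb => let: And5 _ h _ _ _ := Hg b sb in h b' bs).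
have hP bs : halting_runs w hopset_prog s0 bs <->
    (T <= size bs)%N /\ size bs = (T + (g (take T bs)).1.1)%N.
  split=> [[s' /hal[] //]|[h1 h2]]; by exists (g (take T bs)).1.2; apply/hal.
have take_size (bs : seq bool) : (T <= size bs)%N -> size (take T bs) = T by apply: size_takel.
(* Among the first [T] bits only the [n * L] flips matter; the others average out. *)
have avg_x (F : ('I_n -> nat) -> R) :
    avg T (fun b => F (x b)) = avg (n * L) (fun b => F (fun v => sampled L b v)).
  by rewrite -(avg_flips (n * L) 1 (fun b => F (fun v => sampled L b v))) -[RHS](avg_drop d).
split.
  by rewrite (expect_avg (t := fun b => (g b).1.1) hP (Y := fun=> 1)) ?avg_cst // => *; apply: ler01.
have [_ _ _ kK _] := level_bound_spec k2 r1 rk.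
have dK : (k <= level_bound kappa rho)%N := depth_le a0 ar k2 r1 rk La Lr.
have kle : k%:R <= log2 kappa + 1 / rho by apply: le_trans kK; rewrite ler_nat.
exists (fun bs => graph_of HG (g (take T bs)).2); split.
- move=> bs s /hal[Tb _ ->]; have [_ _ [oo ox] ho _] := Hg _ (take_size _ Tb).
  split; first exact: graph_of_outputs oo ox.
  have [J6 Je _ _] := beta_fun_spec k2 r1 rk e0 e1.
  have [_ _ _ tz] := tq_depth L a0 ar.
  apply: graph_of_hopset (hierarchy_ok_ge dK tz ho) ox _ _ J6 e0 Je; last by rewrite tz.
  move=> v; exact: (sampled_lt erefl erefl (w_pow n256) (M_ge n256) nP L0).
- rewrite (expect_avg (t := fun b => (g b).1.1) hP (Y := fun b => (nedges (graph_of HG (g b).2))%:R)) // lee_fin.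
  apply: le_trans (edges_bound adm a0 rp kle ha hr).
  apply: le_trans (avg_total_edges HG L0 nP a0 ar rL).
  rewrite -(avg_x (fun x => (total_edges G _ _ _ x _)%:R)); apply: avg_le => b sb; rewrite ler_nat.
  by have [_ _ [oo _] _] := Hg b sb; apply: leq_trans; apply: nedges_graph_of oo.
- rewrite (expect_avg (t := fun b => (g b).1.1) hP (Y := fun b => (T + (g b).1.1)%:R)) //; last first.
    by move=> bs /hP[_ ->].
  rewrite lee_fin; have [h1 _ h3 l8] := X_ge adm.
  apply: le_trans (_ : 2000 * (((size l)%:R + n%:R * log2 n%:R) *
      (n%:R `^ rho / rho) * log2 n%:R) <= _); last first.
    apply: ler_wpM2l; first exact: ler0n.
    rewrite ler_wpM2r ?(le_trans _ l8) // ler_wpM2r ?(le_trans _ h3) //.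
    by rewrite lerD2r ler_nat size_listing.
  have dg : deg_sum (neighbors l) = (n + 2 * size l)%N.
    rewrite /deg_sum; under eq_bigr do rewrite -add1n.
    by rewrite big_split /= sum_neighbors sum1_card card_ord.
  apply: le_trans (time_bound adm rp dg dle kle Lr hr (sum_fq_depth L a0 ar)).
  apply: le_trans (_ : avg T (fun b => (T + (k + 4))%:R + (total_work G (2 ^ L) (2 ^ r)
      (2 ^ a) (x b) (2 * L) (neighbors l) k)%:R) <= _).
    apply: avg_le => b sb; rewrite -natrD ler_nat; have [h _ _ _ _] := Hg b sb.
    by rewrite -addnA leq_add2l addnC; apply: leq_trans h _; rewrite addnA.
  rewrite avgD avg_cst natrD lerD2l.
  rewrite (avg_x (fun x => (total_work G _ _ _ x _ _ _)%:R)).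
  exact: avg_total_work.
Qed.
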